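(* Assume $K<\infty$. For every $(u,\gamma)\in BV(a,b)\times\mathcal M(a,b)$ with $\|u\|_{L^\infty}\le K$, $\gamma=D^su+g\mathcal L^1$, $g\in L^1(a,b)$, $u'-g\in L^2(a,b)$, one has $E'(u,\gamma)\ge E(u,\gamma)$.
   Context: Fix $0<a<b<\infty$, $c_0>0$, $K\in(0,\infty)$; $f(t)=c_0\min\{t,1\}$; $I_\varepsilon(x)=(x-\varepsilon,x+\varepsilon)$; $\fint_Bh=\frac1{|B|}\int_Bh$. Flat norm $\|\mu\|_{\rm flat}=\sup\{\int\varphi\,d\mu:\varphi\in W^{1,\infty}_0(a,b),\|\varphi\|_{W^{1,\infty}}\le1\}$. For $u\in BV(a,b)$: $Du=u'\mathcal L^1+D^su$, $D^su=[u]\mathcal H^0\llcorner J_u+D^cu$, $[u](x)=u(x+)-u(x-)$. $E_\varepsilon(u,\gamma)=\int_a^b|u'-g|^2dx+\frac1\varepsilon\int_a^bf\big(\varepsilon\fint_{I_\varepsilon(x)\cap(a,b)}|g|dt\big)dx$ if $u\in W^{1,1}(a,b)$, $\|u\|_{L^\infty}\le K$, $\gamma=g\mathcal L^1$, $g\in L^1$, $u'-g\in L^2$; $+\infty$ otherwise. $E'(u,\gamma)=\inf\{\liminf_{\varepsilon\to0}E_\varepsilon(u_\varepsilon,\gamma_\varepsilon):u_\varepsilon\to u\text{ in }L^1,\ \|\gamma_\varepsilon-\gamma\|_{\rm flat}\to0\}$. $E(u,\gamma)=\int_a^b|u'-g|^2dx+c_0\int_a^b|g|dx+2\sum_{x\in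 J_u}f(\frac12|[u](x)|)+c_0|D^cu|(a,b)$ if $u\in BV(a,b)$, $\|u\|_{L^\infty}\le K$, $\gamma=D^su+g\mathcal L^1$, $g\in L^1$, $u'-g\in L^2$; $+\infty$ otherwise. *)

(* Defs.v *)
From HB Require Import structures.
From mathcomp Require Import all_boot all_order all_algebra.
From mathcomp Require Import all_classical all_reals all_analysis.

Set Implicit Arguments.
Unset Strict Implicit.
Unset Printing Implicit Defensive.

Import Order.TTheory GRing.Theory Num.Theory.
Import numFieldNormedType.Exports.

Local Open Scope classical_set_scope.
Local Open Scope ring_scope.

(* Measurable space: the real line with its Borel sigma-algebra; the
   Lebesgue measure on it.  Finite signed Radon measures are mathcomp's
   charges (finite, sigma-additive, extended-real valued with finite values). *)
Notation RT R := (measurableTypeR R).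
Notation leb := (@lebesgue_measure _).
Notation chargeR R := ({charge set (RT R) -> \bar R}).

Section defs.
Context {R : realType}.
Local Open Scope ereal_scope.

Lemma hahn_ex (nu : chargeR R) :
  exists PN : set (RT R) * set (RT R), hahn_decomposition nu PN.1 PN.2.
Proof. by have [P [N h]] := Hahn_decomposition nu; exists (P, N). Qed.

Definition hahn_pair (nu : chargeR R) := projT1 (cid (hahn_ex nu)).
Definition hahn_pf (nu : chargeR R) :
  hahn_decomposition nu (hahn_pair nu).1 (hahn_pair nu).2 :=
  projT2 (cid (hahn_ex nu)).

Definition cpos (nu : chargeR R) := jordan_pos (hahn_pf nu).
Definition cneg (nu : chargeR R) := jordan_neg (hahn_pf nu).
Definition cvar (nu : chargeR R) := charge_variation (hahn_pf nu).

Definition cint (nu : chargeR R) (phi : R -> R) : \bar R :=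
  \int[cpos nu]_x (phi x)%:E - \int[cneg nu]_x (phi x)%:E.

Definition charge_on (a b : R) (nu : chargeR R) : Prop :=
  forall A : set (RT R), measurable A -> nu A = nu (A `&` `]a, b[).

(* unit ball of W^{1,oo}_0(a,b) (Lipschitz representatives, extended by 0):
   ||phi||_oo <= 1 and ||phi'||_oo <= 1 (i.e. 1-Lipschitz) *)
Definition W1inf0_ball (a b : R) (phi : R -> R) : Prop :=
  [/\ (forall x, ~ (a < x < b)%R -> phi x = 0%R),
      (forall x, (`|phi x| <= 1)%R) &
      (forall x y, (`|phi x - phi y| <= `|x - y|)%R)].

Definition flat_dist (a b : R) (mu nu : chargeR R) : \bar R :=
  ereal_sup [set cint mu phi - cint nu phi | phi in W1inf0_ball a b].

Definition test_fun (a b : R) (phi : R -> R) : Prop :=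
  [/\ exists c d : R, [/\ (a < c)%R, (d < b)%R &
        forall x, ~ (c <= x <= d)%R -> phi x = 0%R],
      (forall x, derivable phi x 1) & continuous (derive1 phi)].

Definition distr_deriv (a b : R) (u : R -> R) (Du : chargeR R) : Prop :=
  [/\ leb.-integrable `]a, b[ (EFin \o u), charge_on a b Du &
      forall phi, test_fun a b phi ->
        \int[leb]_(x in `]a, b[) (u x * derive1 phi x)%:E = - cint Du phi].

Definition weak_deriv (a b : R) (u u' : R -> R) : Prop :=
  [/\ leb.-integrable `]a, b[ (EFin \o u),
      leb.-integrable `]a, b[ (EFin \o u') &
      forall phi, test_fun a b phi ->
        \int[leb]_(x in `]a, b[) (u x * derive1 phi x)%:E =
        - \int[leb]_(x in `]a, b[) (u' x * phi x)%:E].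

Definition leb_singular (mu : chargeR R) : Prop :=
  exists N : set (RT R), [/\ measurable N, leb N = 0 & cvar mu (~` N) = 0].

Definition aplim_right (u : R -> R) (x c : R) : Prop :=
  (fun r : R => (r^-1)%:E * \int[leb]_(t in `]x, (x + r)%R[) (`|u t - c|)%:E)
    @ 0%R^'+ --> 0.
Definition aplim_left (u : R -> R) (x c : R) : Prop :=
  (fun r : R => (r^-1)%:E * \int[leb]_(t in `](x - r)%R, x[) (`|u t - c|)%:E)
    @ 0%R^'+ --> 0.

Definition jump_pair (u : R -> R) (x cp cm : R) : Prop :=
  [/\ cp != cm, aplim_right u x cp & aplim_left u x cm].

Definition jump_set (a b : R) (u : R -> R) : set R :=
  [set x | (a < x < b)%R /\ exists cp cm, jump_pair u x cp cm].

Definition jump (u : R -> R) (x : R) : R :=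
  xget 0%R [set d | exists cp cm, jump_pair u x cp cm /\ d = (cp - cm)%R].

Definition fD (c0 t : R) : R := (c0 * Num.min t 1)%R.

Definition avg_abs (a b eps : R) (g : R -> R) (x : R) : R :=
  (fine (\int[leb]_(t in `](x - eps)%R, (x + eps)%R[ `&` `]a, b[) (`|g t|)%:E) /
   fine (leb (`](x - eps)%R, (x + eps)%R[ `&` `]a, b[)))%R.

Definition Eeps_adm (a b K : R) (u : R -> R) (gam : chargeR R) (u' g : R -> R)
  : Prop :=
  [/\ weak_deriv a b u u',
      {ae leb, forall x, (a < x < b)%R -> (`|u x| <= K)%R},
      leb.-integrable `]a, b[ (EFin \o g),
      (forall A, measurable A ->
         gam A = \int[leb]_(x in A `&` `]a, b[) (g x)%:E) &
      leb.-integrable `]a, b[ (fun x => ((u' x - g x) ^+ 2)%:E)].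

Definition Eeps_val (a b c0 eps : R) (u' g : R -> R) : \bar R :=
  \int[leb]_(x in `]a, b[) ((u' x - g x) ^+ 2)%:E
  + (eps^-1)%:E * \int[leb]_(x in `]a, b[) (fD c0 (eps * avg_abs a b eps g x)%R)%:E.

(* E_eps(u, gamma); +oo when no admissible (u', g) exists *)
Definition Eeps (a b c0 K eps : R) (u : R -> R) (gam : chargeR R) : \bar R :=
  ereal_inf [set Eeps_val a b c0 eps ug.1 ug.2
            | ug in [set ug : (R -> R) * (R -> R) | Eeps_adm a b K u gam ug.1 ug.2]].

Definition liminf0 (F : R -> \bar R) : \bar R :=
  ereal_sup [set ereal_inf [set F e | e in `]0%R, d[] | d in `]0%R, +oo[].

Definition L1_conv (a b : R) (ue : R -> R -> R) (u : R -> R) : Prop :=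
  (\forall e \near 0%R^'+, leb.-integrable `]a, b[ (EFin \o ue e)) /\
  (fun e => \int[leb]_(x in `]a, b[) (`|ue e x - u x|)%:E) @ 0%R^'+ --> 0.

Definition flat_conv (a b : R) (ge : R -> chargeR R) (gam : chargeR R) : Prop :=
  (fun e => flat_dist a b (ge e) gam) @ 0%R^'+ --> 0.

Definition Eprime (a b c0 K : R) (u : R -> R) (gam : chargeR R) : \bar R :=
  ereal_inf [set liminf0 (fun e => Eeps a b c0 K e (p.1 e) (p.2 e))
            | p in [set p : (R -> R -> R) * (R -> chargeR R) |
                     [/\ forall e, charge_on a b (p.2 e),
                         L1_conv a b p.1 u & flat_conv a b p.2 gam]]].

Definition E_adm (a b K : R) (u : R -> R) (gam : chargeR R)
  (Du : chargeR R) (u' : R -> R) (Dsu : chargeR R) (g : R -> R) : Prop :=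
  [/\ distr_deriv a b u Du,
      {ae leb, forall x, (a < x < b)%R -> (`|u x| <= K)%R},
      [/\ leb.-integrable `]a, b[ (EFin \o u'), charge_on a b Dsu,
          leb_singular Dsu &
          forall A, measurable A ->
            Du A = \int[leb]_(x in A `&` `]a, b[) (u' x)%:E + Dsu A],
      [/\ leb.-integrable `]a, b[ (EFin \o g), charge_on a b gam &
          forall A, measurable A ->
            gam A = Dsu A + \int[leb]_(x in A `&` `]a, b[) (g x)%:E] &
      leb.-integrable `]a, b[ (fun x => ((u' x - g x) ^+ 2)%:E)].

(* value of E: |D^c u|(a,b) = |D^s u|((a,b) \ J_u)  (D^c u = D^s u restricted
   to the complement of the jump set) *)
Definition E_val (a b c0 : R) (u u' : R -> R) (Dsu : chargeR R) (g : R -> R)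
  : \bar R :=
  \int[leb]_(x in `]a, b[) ((u' x - g x) ^+ 2)%:E
  + c0%:E * \int[leb]_(x in `]a, b[) (`|g x|)%:E
  + 2%:E * (\esum_(x in jump_set a b u) (fD c0 (`|jump u x| / 2)%R)%:E)
  + c0%:E * cvar Dsu (`]a, b[ `\` jump_set a b u).

(* E(u, gamma); +oo when no admissible data exists *)
Definition Efun (a b c0 K : R) (u : R -> R) (gam : chargeR R) : \bar R :=
  ereal_inf [set E_val a b c0 u q.1.2 q.2.1 q.2.2
            | q in [set q : (chargeR R * (R -> R)) * (chargeR R * (R -> R)) |
                     E_adm a b K u gam q.1.1 q.1.2 q.2.1 q.2.2]].

End defs.

(* Main.v *)
(** If [u_e -> u] in L1 and [gam_e -> gam] in the flat norm, then [u_e' - g_e]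
    converges to [u' - g] against test functions, and
    [|v|^2 >= 2 v phi - phi^2] together with the L2 density of test functions
    gives the lower semicontinuity of the quadratic term.

    For the nonlocal term, damping the measure [|gam_e|] by a suitable factor
    removes the truncation at scale [e]; Tonelli then shows that the term at
    scale [e] dominates the same term at any fixed scale [h > e].  At a fixed
    scale it is lower semicontinuous under flat convergence, and as [h -> 0] its
    value at [gam] tends to the integral of [2 / max (2, |gam|{y})] against
    [|gam|], i.e. the diffuse mass plus the sum of [min (|gam{x}|, 2)] over the
    atoms of [gam].  These atoms are the jumps of [u], because
    [u x = C - Du (]x, +oo[)] for almost every [x]. *)

Require Import Defs.
From HB Require Import structures.
From mathcomp Require Import all_boot all_order all_algebra finmap.
From mathcomp Require Import all_classical all_reals all_analysis.
From mathcomp Require Import measurable_realfun ring lra.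
Import Order.TTheory GRing.Theory Num.Theory.
Import numFieldNormedType.Exports.
Local Open Scope classical_set_scope.
Local Open Scope ring_scope.

(** The threshold 2 comes from the length 2e of a window: e times the average of |g| over it is half
    the mass of |g| there, and f truncates at 1. It fits the limit, since 2 f(s/2) = c0 min(s, 2).

    Passing to the limit directly at scale e is blocked: the energy bounds only truncated masses,
    hence not |gam_e|(a,b), and a test function of height 1 living on a window of radius e has
    Lipschitz constant at least 1/e, so that flat convergence controls it only up to the flat
    distance divided by e. At a fixed scale h the test functions no longer depend on e.

    The windows where the truncation is active are not cut out and replaced by jumps of u. The
    weight 2 / max (2, mass) treats all windows alike; it increases as windows shrink, so that the
    limit h -> 0 is a monotone convergence against the single measure |gam|.

    The two terms of the energy are bounded below together, at the same index, with h and the test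
    function phi fixed. The limits are taken in the order e -> 0, h -> 0, phi -> u' - g. *)

(** * Smooth steps, cutoffs and test functions *)

Section C1.
Context {R : realType}.
Implicit Types (f g : R -> R) (a b c d r t x y : R).

(** The derivative is a witness and not [derive1 f], so that sums, products and affine substitutions
    follow from the [is_derive] rules; [C1_fun_derive1] returns to the form that [test_fun] asks
    for. *)
Definition C1_fun f := exists2 f' : R -> R,
  (forall x, is_derive x 1 f (f' x)) & continuous f'.

Lemma C1_fun_derive1 f : C1_fun f ->
  (forall x, derivable f x 1) /\ continuous (derive1 f).
Proof.
move=> [f' df cf']; split=> [x|]; first by have [] := df x.
have -> // : derive1 f = f'.
by apply/funext => x; rewrite derive1E; have [_ ->] := df x.
Qed.

Lemma C1_fun_continuous f : C1_fun f -> continuous f.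
Proof.
move=> /C1_fun_derive1[df _] x.
exact/differentiable_continuous/derivable1_diffP.
Qed.

Lemma C1_fun_cst (k : R) : C1_fun (cst k).
Proof. by exists (cst 0) => [x|]; [exact: is_derive_cst|exact: cst_continuous]. Qed.

Lemma C1_fun_add f g : C1_fun f -> C1_fun g -> C1_fun (fun x => f x + g x).
Proof.
move=> [f' df cf] [g' dg cg]; exists (fun x => f' x + g' x) => [x|x].
  exact: is_deriveD.
exact: (continuousD (cf x) (cg x)).
Qed.

Lemma C1_fun_mul f g : C1_fun f -> C1_fun g -> C1_fun (fun x => f x * g x).
Proof.
move=> Cf Cg; have cf := C1_fun_continuous _ Cf; have cg := C1_fun_continuous _ Cg.
case: Cf Cg => [f' df cf'] [g' dg cg'].
exists (fun x => f x * g' x + g x * f' x) => [x|x].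
  exact: (is_deriveM (df x) (dg x)).
by apply: cvgD; apply: cvgM; [exact: cf|exact: cg'|exact: cg|exact: cf'].
Qed.

Lemma is_derive_affine f f' (k l x : R) : (forall x, is_derive x 1 f (f' x)) ->
  is_derive x 1 (fun x => f (k * x + l)) (f' (k * x + l) * k).
Proof.
move=> df; apply: (@is_derive1_comp _ f (fun x => k * x + l)).
have : is_derive x 1 ((k \*: @id R) + cst l) (k *: 1 + 0) by exact: is_deriveD.
by rewrite addr0 /GRing.scale/= mulr1.
Qed.

Lemma continuous_affine (k l : R) : continuous (fun x : R => k * x + l).
Proof.
by move=> x; apply: cvgD; [apply: cvgM; [exact: cvg_cst|]|exact: cvg_cst].
Qed.

Lemma C1_fun_affine f (k l : R) : C1_fun f -> C1_fun (fun x => f (k * x + l)).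
Proof.
move=> [f' df cf]; exists (fun x => f' (k * x + l) * k) => [x|x].
  exact: is_derive_affine.
apply: cvgM; last exact: cvg_cst.
by apply: (@continuous_comp _ _ _ (fun x => k * x + l) f'); [exact: continuous_affine|exact: cf].
Qed.

(** The difference quotient is off by at most |h|. For [sqpos] the quadratic bound holds across 0,
    so no one-sided derivatives have to be glued there. *)
Lemma is_derive_quadratic_error f l x :
  (forall h, `|f (x + h) - f x - l * h| <= h ^+ 2) -> is_derive x 1 f l.
Proof.
move=> H.
have cv : h^-1 *: ((f \o shift x) (h *: (1:R)) - f x) @[h --> 0^'] --> l.
  apply/cvgrPdist_le => e e0; near=> h.
  have h0 : h != 0 by near: h; exact: nbhs_dnbhs_neq.
  rewrite /= /GRing.scale/= mulr1.
  rewrite (_ : l - _ = - (h^-1 * (f (x + h) - f x - l * h))); last first.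
    by rewrite (addrC h x); field.
  rewrite normrN normrM normfV ler_pdivrMl ?normr_gt0//.
  apply: le_trans (H h) _; rewrite -(real_normK (num_real h)) expr2 ler_wpM2l//.
  by near: h; apply: dnbhs0_le.
by apply: DeriveDef; [apply/cvg_ex; exists l|apply: cvg_lim cv].
Unshelve. all: by end_near. Qed.

Definition sqpos x : R := Num.max x 0 ^+ 2.

Lemma is_derive_sqpos x : is_derive x 1 sqpos (2 * Num.max x 0).
Proof.
apply: is_derive_quadratic_error => h; rewrite /sqpos ler_norml.
by case: (lerP x 0) => hx; case: (lerP (x + h) 0) => hy; apply/andP; split; nra.
Qed.

Lemma continuous_pos : continuous (fun x : R => Num.max x 0).
Proof. by move=> x; apply: (@continuous_max _ _ (@id R) (cst 0)) => //; exact: cvg_cst. Qed.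

(* A quadratic spline: 0 on the left of 0, 1 on the right of 1, whose derivative
   [tent] is the hat of height 2 on [0, 1]. *)
Definition step t : R := 2 * sqpos t - 4 * sqpos (t - 2^-1) + 2 * sqpos (t - 1).
Definition tent t : R :=
  4 * Num.max t 0 - 8 * Num.max (t - 2^-1) 0 + 4 * Num.max (t - 1) 0.

Lemma continuous_tent : continuous tent.
Proof.
have cm (k l : R) x : {for x, continuous (fun t : R => k * Num.max (t - l) 0)}.
  apply: cvgM; first exact: cvg_cst.
  apply: (@continuous_comp _ _ _ (fun t => t - l) (fun t => Num.max t 0)).
    by apply: cvgB => //; exact: cvg_cst.
  exact: continuous_pos.
have -> : tent = (fun t => 4 * Num.max (t - 0) 0 - 8 * Num.max (t - 2^-1) 0 +
    4 * Num.max (t - 1) 0) by apply/funext => t; rewrite subr0.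
move=> x; apply: cvgD; last exact: cm.
by apply: cvgB; exact: cm.
Qed.

Lemma is_derive_step t : is_derive t 1 step (tent t).
Proof.
have dm (k l : R) : is_derive t 1 (fun t : R => k * sqpos (t - l)) (k * (2 * Num.max (t - l) 0)).
  have := @is_derive_affine sqpos _ 1 (- l) t is_derive_sqpos.
  rewrite mulr1 !mul1r => D1.
  have : is_derive t 1 (k \*: (fun t : R => sqpos (1 * t - l))) (k *: (2 * Num.max (t - l) 0)).
    exact: is_deriveZ.
  by apply: near_eq_is_derive; near=> x; rewrite /= /GRing.scale/= mul1r.
have -> : tent t = 2 * (2 * Num.max (t - 0) 0) - 4 * (2 * Num.max (t - 2^-1) 0) +
    2 * (2 * Num.max (t - 1) 0) by rewrite subr0 /tent; lra.
have -> : step = (fun t => 2 * sqpos (t - 0) - 4 * sqpos (t - 2^-1) + 2 * sqpos (t - 1)).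
  by apply/funext => x; rewrite subr0.
exact: (is_deriveD (is_deriveB (dm _ _) (dm _ _)) (dm _ _)).
Unshelve. all: by end_near. Qed.

Lemma step_le0 t : t <= 0 -> step t = 0.
Proof.
move=> t0; rewrite /step /sqpos !max_r; first by rewrite expr0n/=; lra.
all: lra.
Qed.

Lemma step_ge1 t : 1 <= t -> step t = 1.
Proof.
move=> t1; rewrite /step /sqpos !max_l; first by field.
all: lra.
Qed.

Lemma step_itv t : 0 <= step t <= 1.
Proof.
case: (leP t 0) => t0; first by rewrite step_le0// lexx ler01.
case: (leP 1 t) => t1; first by rewrite step_ge1// lexx ler01.
rewrite /step /sqpos (max_r (_ : t - 1 <= 0)); last by lra.
rewrite (max_l (ltW t0)); case: (lerP (t - 2^-1) 0) => h; apply/andP; split; nra.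
Qed.

Lemma tent_itv t : 0 <= tent t <= 2.
Proof.
rewrite /tent; case: (lerP t 0) => ?; case: (lerP (t - 2^-1) 0) => ?;
  case: (lerP (t - 1) 0) => ?; lra.
Qed.

Lemma tent_out t : ~ (0 <= t <= 1) -> tent t = 0.
Proof.
move=> h; rewrite /tent; case: (lerP t 0) => ?; case: (lerP (t - 2^-1) 0) => ?;
  case: (lerP (t - 1) 0) => ?; try lra.
all: by exfalso; apply: h; apply/andP; split; lra.
Qed.

Lemma C1_fun_step : C1_fun step.
Proof. exists tent; [exact: is_derive_step|exact: continuous_tent]. Qed.

(** The shift by -1 keeps the support at distance 1/(n+1) from both ends, because a [test_fun] must
    vanish outside a compact part of the open interval. The plateau begins at distance 2/(n+1). *)
Definition cutoff c d (n : nat) t : R :=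
  step (n.+1%:R * (t - c) - 1) * step (n.+1%:R * (d - t) - 1).

Lemma C1_fun_cutoff c d n : C1_fun (cutoff c d n).
Proof.
rewrite (_ : cutoff c d n = fun t => step (n.+1%:R * t + (- (n.+1%:R * c) - 1)) *
    step (- n.+1%:R * t + (n.+1%:R * d - 1))).
  by apply: C1_fun_mul; apply: C1_fun_affine; exact: C1_fun_step.
by apply/funext => t; rewrite /cutoff; congr (step _ * step _); ring.
Qed.

Lemma cutoff_itv c d n t : 0 <= cutoff c d n t <= 1.
Proof.
rewrite /cutoff; have /andP[? ?] := step_itv (n.+1%:R * (t - c) - 1).
have /andP[? ?] := step_itv (n.+1%:R * (d - t) - 1).
by rewrite mulr_ge0//= mulr_ile1.
Qed.

Lemma cutoff_out c d n t :
  ~ (c + n.+1%:R^-1 <= t <= d - n.+1%:R^-1) -> cutoff c d n t = 0.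
Proof.
move/negP; rewrite negb_and -!ltNge /cutoff => /orP[h|h].
  by rewrite step_le0 ?mul0r// subr_le0 -ler_pdivlMl// mulr1 lerBlDl ltW.
by rewrite [X in _ * X]step_le0 ?mulr0// subr_le0 -ler_pdivlMl// mulr1 lerBlDr -lerBlDl ltW.
Qed.

Lemma cutoff_out_itv c d n t : ~ (c < t < d) -> cutoff c d n t = 0.
Proof.
move=> h; apply: cutoff_out => /andP[h1 h2]; apply: h; have : 0 < n.+1%:R^-1 :> R by [].
by move: (n.+1%:R^-1) h1 h2 => k h1 h2 ?; apply/andP; split; lra.
Qed.

Lemma near_mulSn_ge (k l : R) : 0 < k -> \forall n \near \oo, l <= n.+1%:R * k.
Proof.
move=> k0; near=> n; rewrite -ler_pdivrMr//.
rewrite (@le_trans _ _ n%:R) ?ler_nat//.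
by near: n; exact: nbhs_infty_ger.
Unshelve. all: by end_near. Qed.

Lemma cvg_cutoff c d t : cutoff c d n t @[n --> \oo] --> (\1_(`]c, d[) t : R).
Proof.
rewrite indicE; case: (boolP (t \in _)) => [|/negP]; rewrite inE/= in_itv/=.
  move=> /andP[ct td]; apply: cvg_near_cst; near=> n.
  rewrite /cutoff !step_ge1 ?mulr1// lerBrDr.
    by near: n; apply: near_mulSn_ge; rewrite subr_gt0.
  by near: n; apply: near_mulSn_ge; rewrite subr_gt0.
by move=> h; apply: cvg_near_cst; apply: nearW => n; rewrite cutoff_out_itv.
Unshelve. all: by end_near. Qed.

Lemma test_fun_cutoff a b c d n f : a <= c -> d <= b -> C1_fun f ->
  test_fun a b (fun t => f t * cutoff c d n t).
Proof.
move=> ac db Cf; have [d1 d2] := C1_fun_derive1 _ (C1_fun_mul _ _ Cf (C1_fun_cutoff c d n)).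
split=> //; exists (c + n.+1%:R^-1), (d - n.+1%:R^-1); split.
- by rewrite ltr_pwDr.
- by rewrite ltrBlDr ltr_pwDr.
- by move=> x h; rewrite cutoff_out ?mulr0.
Qed.

Lemma test_fun_C1 a b f : test_fun a b f -> C1_fun f.
Proof.
move=> [_ df cf]; exists (derive1 f) => // x.
by apply: DeriveDef => //; rewrite derive1E.
Qed.

(** Compactness bounds f and f', and the mean value theorem turns the second bound into a Lipschitz
    one. The [+ 1] in the witness makes M positive even for f = 0: later f is divided by M to enter
    the unit ball of the flat norm. *)
Lemma test_fun_bounds a b f : a < b -> test_fun a b f -> exists2 M : R, 0 < M &
  [/\ (forall x, `|f x| <= M), (forall x, `|derive1 f x| <= M),
      (forall x y, `|f x - f y| <= M * `|x - y|) &
      (forall x, ~ (a < x < b) -> f x = 0)].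
Proof.
move=> ab [[c [d [ac db fcd]]] df cf'].
have cf : continuous f by move=> x; exact/differentiable_continuous/derivable1_diffP.
have f0 x : ~ (a < x < b) -> f x = 0.
  by move=> h; apply: fcd => /andP[? ?]; apply: h; apply/andP; split; lra.
have f'0 x : ~ (a <= x <= b) -> derive1 f x = 0.
  move=> /negP; rewrite negb_and -!ltNge => h; rewrite derive1E.
  have D0 : is_derive x 1 (cst 0 : R -> R) 0 by exact: is_derive_cst.
  suff D : is_derive x 1 f 0 by rewrite derive_val.
  apply: near_eq_is_derive D0; case/orP: h => h.
    near=> y; rewrite f0//; apply/negP; rewrite negb_and -leNgt.
    have -> // : y <= a by near: y; apply: cvgr_le h; exact: cvg_id.
  near=> y; rewrite f0//; apply/negP; rewrite negb_and orbC -leNgt.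
  have -> // : b <= y by near: y; apply: cvgr_ge h; exact: cvg_id.
have bd g : continuous g -> (forall x, ~ (a <= x <= b) -> g x = 0) ->
    exists M : R, forall x, `|g x| <= M.
  move=> cg g0; have cn : {within `[a, b], continuous (fun x => `|g x|)}.
    apply: continuous_subspaceT => x.
    by apply: (@continuous_comp _ _ _ g (fun x : R => `|x|)); [exact: cg|exact: norm_continuous].
  have [m mab mM] := EVT_max (ltW ab) cn; exists `|g m| => x.
  case: (pselect (a <= x <= b)) => [h|/g0 ->]; last by rewrite normr0.
  by apply: mM; rewrite in_itv.
have [M1 hM1] := bd f cf (fun x h => f0 x (fun k => h (andb_true_intro (conj (ltW (proj1 (andP k))) (ltW (proj2 (andP k))))))).
have [M2 hM2] := bd _ cf' f'0.
have p1 : 0 <= M1 by apply: le_trans (hM1 0).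
have p2 : 0 <= M2 by apply: le_trans (hM2 0).
exists (M1 + M2 + 1); first lra.
split=> //.
- by move=> x; apply: le_trans (hM1 x) _; lra.
- by move=> x; apply: le_trans (hM2 x) _; lra.
move=> x y; wlog xy : x y / x <= y.
  move=> H; have [/H//|/ltW/H] := leP x y.
  by rewrite distrC (distrC y).
have D z : z \in `]x, y[ -> is_derive z 1 f (derive1 f z).
  by move=> _; apply: DeriveDef => //; rewrite derive1E.
have [z _ fz] := MVT_segment xy D (continuous_subspaceT cf).
rewrite distrC fz normrM (distrC x) ler_wpM2r//.
by apply: le_trans (hM2 z) _; lra.
Unshelve. all: by end_near. Qed.

End C1.

Lemma cvge_near_lt {R : realType} (u : nat -> \bar R) (l z : \bar R) :
  u n @[n --> \oo] --> l -> (l < z)%E -> \forall n \near \oo, (u n < z)%E.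
Proof.
move=> ul lz; have oz := @open_ereal_lt_ereal R z.
exact: (ul _ (open_nbhs_nbhs (conj oz lz))).
Qed.

Lemma cvge_near_gt {R : realType} (u : nat -> \bar R) (l z : \bar R) :
  u n @[n --> \oo] --> l -> (z < l)%E -> \forall n \near \oo, (z < u n)%E.
Proof.
move=> ul lz; have oz := @open_ereal_gt_ereal R z.
exact: (ul _ (open_nbhs_nbhs (conj oz lz))).
Qed.

(** * L1 density of C1 functions for a finite measure *)

Section density.
Context {R : realType}.
Variable mu : {measure set (RT R) -> \bar R}.
Variable D : set (RT R).
Hypothesis mD : measurable D.
Hypothesis muD : (mu D < +oo)%E.
Implicit Types (f : R -> R) (A : set (RT R)).

Lemma C1_fun_measurable f (E : set (RT R)) : C1_fun f -> measurable_fun E (f : RT R -> R).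
Proof.
move=> Cf; apply: (@measurable_funTS _ _ _ _ E).
by apply: continuous_measurable_fun; exact: C1_fun_continuous.
Qed.

Lemma integrable_bounded f (M : R) : measurable_fun D (f : RT R -> R) ->
  (forall x, D x -> `|f x| <= M) -> mu.-integrable D (EFin \o f).
Proof.
move=> mf fM; apply: measurable_bounded_integrable => //.
exists M; split; first exact: num_real.
by move=> N MN x Dx; apply: le_trans (fM _ Dx) (ltW MN).
Qed.

Definition C1_approx f := forall eta : R, 0 < eta -> exists psi : R -> R,
  [/\ C1_fun psi, (forall x, 0 <= psi x <= 1) &
      (\int[mu]_(x in D) (`|f x - psi x|)%:E <= eta%:E)%E].

Lemma C1_approx_C1 f : C1_fun f -> (forall x, 0 <= f x <= 1) -> C1_approx f.
Proof.
move=> Cf f01 eta eta0; exists f; split=> //.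
rewrite integral0_eq ?lee_fin ?ltW// => x _.
by rewrite subrr normr0.
Qed.

Lemma measurable_normB f g : measurable_fun D (f : RT R -> R) ->
  measurable_fun D (g : RT R -> R) ->
  measurable_fun D (fun x : RT R => (`|f x - g x|)%:E).
Proof.
by move=> mf mg; apply/measurable_EFinP; apply: measurableT_comp => //; exact: measurable_funB.
Qed.

Lemma C1_approx_lim (f_ : nat -> R -> R) f :
  (forall n, measurable_fun D (f_ n : RT R -> R)) ->
  (forall n x, 0 <= f_ n x <= 1) -> measurable_fun D (f : RT R -> R) ->
  (forall x, f_ n x @[n --> \oo] --> f x) ->
  (forall n, C1_approx (f_ n)) -> C1_approx f.
Proof.
move=> mf_ f01 mf fcvg fapp eta eta0.
have fx01 x : 0 <= f x <= 1.
  apply/andP; split.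
    rewrite -(cvg_lim _ (fcvg x))//; apply: limr_ge; first exact: cvgP (fcvg x).
    by apply: nearW => n; have /andP[] := f01 n x.
  rewrite -(cvg_lim _ (fcvg x))//; apply: limr_le; first exact: cvgP (fcvg x).
  by apply: nearW => n; have /andP[] := f01 n x.
have : (\int[mu]_(x in D) (`|f_ n x - f x|)%:E)%E @[n --> \oo] --> (\int[mu]_(x in D) 0)%E.
  apply: (@dominated_cvg _ _ _ mu D mD _ _ (cst 1%E)) => //.
  - by move=> n; exact: measurable_normB.
  - move=> x _; apply: cvg_EFin; first exact: nearW.
    have : (`|f_ n x - f x| @[n --> \oo] --> `|f x - f x|).
      by apply: cvg_norm; apply: cvgB; [exact: fcvg|exact: cvg_cst].
    by rewrite subrr normr0.
  - by have := @integrable_bounded (cst 1) 1 (measurable_cst _) (fun _ _ => ltac:(by rewrite /= normr1)).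
  - move=> n x _; rewrite lee_fin normr_id ler_norml.
    by have /andP[? ?] := f01 n x; have /andP[? ?] := fx01 x; apply/andP; split; lra.
rewrite integral0 => /cvge_near_lt H; have {H} := H (eta / 2)%:E; rewrite lte_fin divr_gt0// => /(_ isT).
case=> N _ /(_ _ (leqnn N)) /= hN.
have [psi [Cpsi psi01 hpsi]] := fapp N (eta / 2) (divr_gt0 eta0 (ltr0Sn _ _)).
exists psi; split => //.
have mpsi := C1_fun_measurable psi D Cpsi.
have le1 : (\int[mu]_(x in D) (`|f x - psi x|)%:E <=
   \int[mu]_(x in D) ((`|f_ N x - f x|)%:E + (`|f_ N x - psi x|)%:E))%E.
  apply: ge0_le_integral => //; first exact: measurable_normB.
    by apply: emeasurable_funD; exact: measurable_normB.
  move=> x _; rewrite -EFinD lee_fin.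
  by rewrite (distrC (f_ N x) (f x)) (le_trans _ (ler_normD _ _))// addrA subrK.
apply: le_trans le1 _; rewrite ge0_integralD//; last 2 first.
  exact: measurable_normB. exact: measurable_normB.
by rewrite [eta](splitr) EFinD leeD// ltW.
Unshelve. all: by end_near. Qed.

(** The approximant f + g - f g is 1 - (1 - f)(1 - g), the indicator of the union has the same form,
    and a product of two numbers in [0, 1] is 1-Lipschitz in each factor. *)
Lemma C1_approx_indicU A B : measurable A -> measurable B ->
  C1_approx \1_A -> C1_approx \1_B -> C1_approx \1_(A `|` B).
Proof.
move=> mA mB hA hB eta eta0.
have [f [Cf f01 hf]] := hA (eta / 2) (divr_gt0 eta0 (ltr0Sn _ _)).
have [g [Cg g01 hg]] := hB (eta / 2) (divr_gt0 eta0 (ltr0Sn _ _)).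
have C : C1_fun (fun x => f x + (g x + (-1) * (f x * g x))).
  apply: C1_fun_add => //; apply: C1_fun_add => //; apply: C1_fun_mul.
    exact: C1_fun_cst.
  exact: C1_fun_mul.
exists (fun x => f x + (g x + (-1) * (f x * g x))); split => //.
  by move=> x; have /andP[? ?] := f01 x; have /andP[? ?] := g01 x; apply/andP; split; nra.
have mf := C1_fun_measurable f D Cf; have mg := C1_fun_measurable g D Cg.
have mI E : measurable E -> measurable_fun D (\1_E : RT R -> R) by move=> ?; exact: measurable_indic.
apply: (@le_trans _ _ (\int[mu]_(x in D) ((`|\1_A x - f x|)%:E + (`|\1_B x - g x|)%:E))%E); last first.
  rewrite ge0_integralD//; last 2 first.
  - by apply: measurable_normB => //; exact: mI.
  - by apply: measurable_normB => //; exact: mI.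
  by rewrite [eta](splitr) EFinD leeD// ltW.
apply: ge0_le_integral => //.
- apply: measurable_normB; first by apply: mI; exact: measurableU.
  exact: C1_fun_measurable.
- by apply: emeasurable_funD; apply: measurable_normB => //; exact: mI.
move=> x _; rewrite -EFinD lee_fin !indicE in_setU.
have /andP[? ?] := f01 x; have /andP[? ?] := g01 x.
rewrite ler_norml; case: (x \in A); case: (x \in B); rewrite /=;
  do ! (match goal with |- context [ `|?y| ] => case: (ler0P y) => ? end);
  apply/andP; split; nra.
Qed.

(** The sets whose indicator can be approximated form a sigma-algebra: complements by 1 - f,
    countable unions as limits of finite ones. It contains the half-open intervals that generate the
    Borel sets. *)
Lemma C1_approx_indic A : measurable A -> C1_approx \1_A.
Proof.
move=> mA; suff [] : measurable A /\ C1_approx \1_A by [].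
pose P := [set A : set (RT R) | measurable A /\ C1_approx \1_A].
suff : (measurable : set (set (RT R))) `<=` P by apply.
move: A mA => _ _.
apply: smallest_sub; first split.
- split; first exact: measurable0.
  by rewrite indic0; apply: C1_approx_C1 => [|x]; [exact: C1_fun_cst|rewrite lexx ler01].
- move=> A [mA hA]; split; first exact: measurableD.
  move=> eta eta0; have [f [Cf f01 hf]] := hA eta eta0.
  exists (fun x => 1 + (-1) * f x); split.
  + by apply: C1_fun_add; [exact: C1_fun_cst|apply: C1_fun_mul => //; exact: C1_fun_cst].
  + by move=> x; have /andP[? ?] := f01 x; apply/andP; split; lra.
  + apply: le_trans hf; rewrite le_eqVlt; apply/orP; left; apply/eqP.
    apply: eq_integral => x _.
    rewrite setTD !indicE in_setC; congr (_%:E); rewrite -normrN; congr (`|_|).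
    by case: (x \in A) => /=; lra.
- move=> A0 hA0; pose A : nat -> set (RT R) := A0; have {}hA0 : forall n, P (A n) := hA0.
  have -> : A0 = A by []. move: A hA0 => {A0} A hA.
  split; first by apply: bigcup_measurable => k _; have [] := hA k.
  have mU n : measurable (\big[setU/set0]_(i < n) A i).
    by apply: bigsetU_measurable => i _; have [] := hA i.
  apply: (@C1_approx_lim (fun n => \1_(\big[setU/set0]_(i < n) A i))).
  + by move=> n; exact: measurable_indic.
  + by move=> n x; rewrite indicE; case: (_ \in _); rewrite /= lexx ler01.
  + by apply: measurable_indic; apply: bigcup_measurable => k _; have [] := hA k.
  + move=> x; rewrite indicE; case: (boolP (x \in _)); rewrite ?inE.
      move=> [k _ Akx]; apply: cvg_near_cst; near=> n.
      rewrite indicE mem_set//; rewrite -bigcup_mkord; exists k => //=.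
      by near: n; exact: nbhs_infty_gt.
    rewrite notin_setE => h; apply: cvg_near_cst; near=> n.
    rewrite indicE memNset// -bigcup_mkord => -[k /= _ Akx]; apply: h; by exists k.
  + elim=> [|n ih]; first by rewrite big_ord0 indic0; apply: C1_approx_C1 => [|x];
      [exact: C1_fun_cst|rewrite lexx ler01].
    have [mAn hAn] := hA n.
    rewrite big_ord_recr; exact: (C1_approx_indicU _ _ (mU n) mAn ih hAn).
- move=> _ [[a b] _ <-] /=; split; first exact: measurable_itv.
  (* The generating intervals are open at [a] and closed at [b]: the [+ 1] makes the second factor
     equal to 1 at [b] itself. *)
  pose f_ n t : R := step (n.+1%:R * (t - a)) * step (n.+1%:R * (b - t) + 1).
  have Cf n : C1_fun (f_ n).
    rewrite (_ : f_ n = fun t => step (n.+1%:R * t + (- (n.+1%:R * a))) *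
      step (- n.+1%:R * t + (n.+1%:R * b + 1))).
      by apply: C1_fun_mul; apply: C1_fun_affine; exact: C1_fun_step.
    by apply/funext => t; rewrite /f_; congr (step _ * step _); ring.
  have f01 n x : 0 <= f_ n x <= 1.
    rewrite /f_; have /andP[? ?] := step_itv (n.+1%:R * (x - a)).
    have /andP[? ?] := step_itv (n.+1%:R * (b - x) + 1).
    by rewrite mulr_ge0//= mulr_ile1.
  apply: (@C1_approx_lim f_) => //.
  + by move=> n; exact: C1_fun_measurable.
  + move=> t; rewrite indicE; case: (boolP (t \in _)) => [|/negP]; rewrite inE/= in_itv/=.
      move=> /andP[at_ tb]; apply: cvg_near_cst; near=> n.
      rewrite /f_ !step_ge1 ?mulr1//; first by rewrite lerDr mulr_ge0// subr_ge0.
      by near: n; apply: near_mulSn_ge; rewrite subr_gt0.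
    move/negP; rewrite negb_and -leNgt -ltNge => /orP[ta|bt].
      apply: cvg_near_cst; near=> n.
      by rewrite /f_ step_le0 ?mul0r// mulr_ge0_le0// subr_le0.
    apply: cvg_near_cst; near=> n.
    rewrite /f_ [X in _ * X]step_le0 ?mulr0// -lerBrDr sub0r -opprB mulrN lerN2.
    by near: n; apply: near_mulSn_ge; rewrite subr_gt0.
  + by move=> n; exact: C1_approx_C1.
Unshelve. all: by end_near. Qed.

End density.

(** * L2 density of test functions *)

Section test_approx.
Context {R : realType}.

Lemma test_fun_sub (a b c d : R) f : a <= c -> d <= b -> test_fun c d f -> test_fun a b f.
Proof.
move=> ac db [[x [y [cx yd h]]] df cf]; split=> //; exists x, y; split=> //.
  exact: le_lt_trans cx.
exact: lt_le_trans db.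
Qed.

Lemma test_fun_add (a b : R) f g : test_fun a b f -> test_fun a b g ->
  test_fun a b (fun x => f x + g x).
Proof.
move=> tf tg; have [df cf] := C1_fun_derive1 _ (C1_fun_add _ _ (test_fun_C1 _ _ _ tf) (test_fun_C1 _ _ _ tg)).
split=> //.
case: tf tg => [[x [y [cx yd h]]] _ _] [[x' [y' [cx' yd' h']]] _ _].
exists (Num.min x x'), (Num.max y y'); split.
- by rewrite lt_min cx cx'.
- by rewrite gt_max yd yd'.
move=> z hz; rewrite h ?h' ?addr0//.
  by move=> /andP[h1 h2]; apply: hz; rewrite ge_min h1 orbT le_max h2 orbT.
by move=> /andP[h1 h2]; apply: hz; rewrite ge_min h1 le_max h2.
Qed.

Lemma test_fun_scale (a b k : R) f : test_fun a b f -> test_fun a b (fun x => k * f x).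
Proof.
move=> tf; have [df cf] := C1_fun_derive1 _ (C1_fun_mul _ _ (C1_fun_cst k) (test_fun_C1 _ _ _ tf)).
split=> //; case: tf => [[x [y [cx yd h]]] _ _]; exists x, y; split=> // z /h ->.
by rewrite mulr0.
Qed.

Lemma test_fun0 (a b : R) : a < b -> test_fun a b (cst 0).
Proof.
move=> ab; have [df cf] := C1_fun_derive1 _ (C1_fun_cst (0:R)).
split=> //; exists ((a + b) / 2), ((a + b) / 2); split=> //.
  by rewrite midf_lt.
by rewrite midf_lt.
Qed.

Variable mu : {measure set (RT R) -> \bar R}.
Variables a b : R.
Let D : set (RT R) := `]a, b[%classic.
Let mD : measurable D. Proof. exact: measurable_itv. Qed.
Hypothesis muD : (mu D < +oo)%E.

(** A C1 approximant need not vanish near the ends of the interval. Multiplying it by a cutoff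
    repairs this at a small cost, since the cutoffs tend to 1 on the whole open interval. *)
Lemma test_approx_indic (A : set (RT R)) (eta : R) : measurable A -> 0 < eta ->
  exists psi : R -> R, [/\ test_fun a b psi, (forall x, 0 <= psi x <= 1) &
    (\int[mu]_(x in D) (`|\1_A x - psi x|)%:E <= eta%:E)%E].
Proof.
move=> mA eta0.
have [f [Cf f01 hf]] := C1_approx_indic mu D mD muD A mA _ (divr_gt0 eta0 (ltr0Sn _ 1)).
have mb n : measurable_fun D (cutoff a b n : RT R -> R).
  by apply: C1_fun_measurable; exact: C1_fun_cutoff.
have : (\int[mu]_(x in D) (`|1 - cutoff a b n x|)%:E)%E @[n --> \oo] --> (\int[mu]_(x in D) 0)%E.
  apply: (@dominated_cvg _ _ _ mu D mD _ _ (cst 1%E)) => //.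
  - by move=> n; apply: measurable_normB.
  - move=> x Dx; apply: cvg_EFin; first exact: nearW.
    have : (`|1 - cutoff a b n x| @[n --> \oo] --> `|1 - (\1_D x : R)|).
      by apply: cvg_norm; apply: cvgB; [exact: cvg_cst|exact: cvg_cutoff].
    by rewrite indicE mem_set// subrr normr0.
  - have := integrable_bounded mu D mD muD (cst 1) 1 (measurable_cst _).
    by apply=> x _; rewrite normr1.
  - move=> n x _; rewrite lee_fin normr_id ler_norml.
    by have /andP[? ?] := cutoff_itv a b n x; apply/andP; split; lra.
rewrite integral0 => /cvge_near_lt H; have {H} := H (eta / 2)%:E; rewrite lte_fin divr_gt0// => /(_ isT).
case=> N _ /(_ _ (leqnn N)) /= hN.
exists (fun x => f x * cutoff a b N x); split.
- exact: test_fun_cutoff.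
- move=> x; have /andP[? ?] := cutoff_itv a b N x; have /andP[? ?] := f01 x.
  by rewrite mulr_ge0//= mulr_ile1.
have mf := C1_fun_measurable f D Cf.
have mi : measurable_fun D (\1_A : RT R -> R) by exact: measurable_indic.
apply: (@le_trans _ _ (\int[mu]_(x in D) ((`|1 - cutoff a b N x|)%:E + (`|\1_A x - f x|)%:E))%E).
  apply: ge0_le_integral => //.
  + by apply: measurable_normB => //; apply: measurable_funM.
  + by apply: emeasurable_funD; apply: measurable_normB.
  move=> x _; rewrite -EFinD lee_fin.
  have /andP[? ?] := cutoff_itv a b N x; have /andP[? ?] := f01 x.
  rewrite (_ : _ - _ = f x * (1 - cutoff a b N x) + (\1_A x - f x)); last ring.
  rewrite (le_trans (ler_normD _ _))// lerD2r normrM ler_piMl// ger0_norm//.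
rewrite ge0_integralD//; last 2 first.
- exact: measurable_normB.
- exact: measurable_normB.
by rewrite [eta](splitr) EFinD leeD// ltW.
Qed.

Definition L2_approx (v : R -> R) := forall eta : R, 0 < eta -> exists2 psi : R -> R,
  test_fun a b psi & (\int[mu]_(x in D) ((v x - psi x) ^+ 2)%:E <= eta%:E)%E.

Lemma measurable_sqB (f g : R -> R) : measurable_fun D (f : RT R -> R) ->
  measurable_fun D (g : RT R -> R) ->
  measurable_fun D (fun x : RT R => ((f x - g x) ^+ 2)%:E).
Proof.
by move=> mf mg; apply/measurable_EFinP; apply: measurable_funX; exact: measurable_funB.
Qed.

Lemma test_fun_measurable psi : test_fun a b psi -> measurable_fun D (psi : RT R -> R).
Proof. by move=> /test_fun_C1; exact: C1_fun_measurable. Qed.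

(** Distances are kept squared, so the triangle inequality becomes (x + y)^2 <= 2 x^2 + 2 y^2. This
    is the origin of the [eta / 4] in the lemmas that follow. *)
Lemma integral_sq_triangle (f g h : R -> R) (s t : R) :
  measurable_fun D (f : RT R -> R) -> measurable_fun D (g : RT R -> R) ->
  measurable_fun D (h : RT R -> R) ->
  (\int[mu]_(x in D) ((f x - g x) ^+ 2)%:E <= s%:E)%E ->
  (\int[mu]_(x in D) ((g x - h x) ^+ 2)%:E <= t%:E)%E ->
  (\int[mu]_(x in D) ((f x - h x) ^+ 2)%:E <= (2 * s + 2 * t)%:E)%E.
Proof.
move=> mf mg mh fs gt.
apply: (@le_trans _ _ (\int[mu]_(x in D) (2%:E * ((f x - g x) ^+ 2)%:E + 2%:E * ((g x - h x) ^+ 2)%:E))%E).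
  apply: ge0_le_integral => //.
  - by move=> x _; rewrite lee_fin sqr_ge0.
  - exact: measurable_sqB.
  - by apply: emeasurable_funD; apply: measurable_funeM; exact: measurable_sqB.
  - move=> x _; rewrite -!EFinM -EFinD lee_fin.
    have := sqr_ge0 (f x - 2 * g x + h x); nra.
rewrite ge0_integralD//; last 4 first.
- by move=> x _; rewrite -EFinM lee_fin mulr_ge0// sqr_ge0.
- by apply: measurable_funeM; exact: measurable_sqB.
- by move=> x _; rewrite -EFinM lee_fin mulr_ge0// sqr_ge0.
- by apply: measurable_funeM; exact: measurable_sqB.
rewrite !ge0_integralZl_EFin//; last 4 first.
- by move=> x _; rewrite lee_fin sqr_ge0.
- exact: measurable_sqB.
- by move=> x _; rewrite lee_fin sqr_ge0.
- exact: measurable_sqB.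
have -> : ((2 * s + 2 * t)%:E = 2%:E * s%:E + 2%:E * t%:E)%E by rewrite -!EFinM -EFinD.
by rewrite leeD// lee_wpmul2l.
Qed.

Lemma L2_approx_lim (v : R -> R) : measurable_fun D (v : RT R -> R) ->
  (forall eta : R, 0 < eta -> exists w : R -> R, [/\ measurable_fun D (w : RT R -> R),
     L2_approx w & (\int[mu]_(x in D) ((v x - w x) ^+ 2)%:E <= eta%:E)%E]) ->
  L2_approx v.
Proof.
move=> mv H eta eta0; have e4 : 0 < eta / 4 by rewrite divr_gt0.
have [w [mw wa vw]] := H _ e4; have [psi tpsi wpsi] := wa _ e4; exists psi => //.
have -> : eta = 2 * (eta / 4) + 2 * (eta / 4) by field.
by apply: integral_sq_triangle vw wpsi => //; exact: test_fun_measurable.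
Qed.

Lemma L2_approx_add (v w : R -> R) :
  measurable_fun D (v : RT R -> R) -> measurable_fun D (w : RT R -> R) ->
  L2_approx v -> L2_approx w -> L2_approx (fun x => v x + w x).
Proof.
move=> mv mw va wa eta eta0; have e4 : 0 < eta / 4 by rewrite divr_gt0.
have [psi tpsi vpsi] := va _ e4; have [chi tchi wchi] := wa _ e4.
have mpsi := test_fun_measurable _ tpsi; have mchi := test_fun_measurable _ tchi.
exists (fun x => psi x + chi x); first exact: test_fun_add.
have -> : eta = 2 * (eta / 4) + 2 * (eta / 4) by field.
apply: (integral_sq_triangle _ (fun x => psi x + w x)); try exact: measurable_funD.
- by under eq_integral do rewrite opprD addrACA subrr addr0.
- by under eq_integral do rewrite opprD addrACA subrr add0r.
Qed.

Lemma L2_approx_scale (k : R) (v : R -> R) : measurable_fun D (v : RT R -> R) ->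
  L2_approx v -> L2_approx (fun x => k * v x).
Proof.
move=> mv va eta eta0; have k0 : 0 < k ^+ 2 + 1 by rewrite ltr_wpDl// sqr_ge0.
have [psi tpsi vpsi] := va _ (divr_gt0 eta0 k0).
exists (fun x => k * psi x); first exact: test_fun_scale.
have mpsi := test_fun_measurable _ tpsi.
under eq_integral do rewrite -mulrBr exprMn EFinM.
rewrite ge0_integralZl_EFin ?sqr_ge0//; last 2 first.
- by move=> x _; rewrite lee_fin sqr_ge0.
- exact: measurable_sqB.
apply: le_trans (lee_wpmul2l _ vpsi) _; first by rewrite lee_fin sqr_ge0.
rewrite -EFinM lee_fin mulrA ler_pdivrMr// mulrDr mulr1 (mulrC eta) lerDl ltW//.
Qed.

Hypothesis ab : a < b.

(** The error takes values in [-1, 1], where the square is below the absolute value, so the L1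
    approximation already suffices. *)
Lemma L2_approx_indic (A : set (RT R)) : measurable A -> L2_approx \1_A.
Proof.
move=> mA eta eta0; have [psi [tpsi p01 hpsi]] := test_approx_indic A eta mA eta0.
exists psi => //; apply: le_trans hpsi; apply: ge0_le_integral => //.
- by move=> x _; rewrite lee_fin sqr_ge0.
- by apply: measurable_sqB; [exact: measurable_indic|exact: test_fun_measurable].
- by apply: measurable_normB; [exact: measurable_indic|exact: test_fun_measurable].
move=> x _; rewrite lee_fin -real_normK ?num_real// expr2 ler_piMl//.
rewrite ler_norml indicE; have /andP[? ?] := p01 x.
by case: (x \in A) => /=; apply/andP; split; lra.
Qed.

Import HBNNSimple.

Lemma L2_approx_nnsfun (h : {nnsfun (RT R) >-> R}) : L2_approx h.
Proof.
have -> : (h : R -> R) = fun x => \sum_(y <- fset_set (range h)) y * \1_(h @^-1` [set y]) x.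
  by apply/funext => x; rewrite [LHS]fimfunE fsbig_finite.
(* The list of values is freed from the range of [h] to allow an induction on it. *)
suff : forall s : seq R, L2_approx (fun x => \sum_(y <- s) y * \1_(h @^-1` [set y]) x) by exact.
have mi y : measurable_fun D ((fun x => y * \1_(h @^-1` [set y]) x) : RT R -> R).
  by apply: measurable_funM => //; exact: measurable_indic.
elim=> [|y s ih].
  by move=> eta eta0; exists (cst 0); [exact: test_fun0|];
    rewrite integral0_eq ?lee_fin ?ltW// => x _; rewrite big_nil subrr expr0n.
under eq_fun do rewrite big_cons; apply: L2_approx_add => //.
  exact: measurable_sum.
by apply: L2_approx_scale; [exact: measurable_indic|exact: L2_approx_indic].
Qed.

Lemma L2_approx_ge0 (v : R -> R) : measurable_fun D (v : RT R -> R) ->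
  (forall x, D x -> 0 <= v x) -> mu.-integrable D (fun x => (v x ^+ 2)%:E) ->
  L2_approx v.
Proof.
move=> mv v0 iv; apply: L2_approx_lim => // eta eta0.
have mv' : measurable_fun D (EFin \o v : RT R -> _) by exact/measurable_EFinP.
pose h := nnsfun_approx mD mv'.
have v0' x : D x -> (0 <= (EFin \o v) x)%E by move=> /v0; rewrite lee_fin.
have mh n : measurable_fun D (h n : RT R -> R) by apply: measurable_funTS.
have : (\int[mu]_(x in D) ((v x - h n x) ^+ 2)%:E)%E @[n --> \oo] --> (\int[mu]_(x in D) 0)%E.
  apply: (@dominated_cvg _ _ _ mu D mD _ _ (fun x => (v x ^+ 2)%:E)) => //.
  - by move=> n; exact: measurable_sqB.
  - move=> x Dx; apply: cvg_EFin; first exact: nearW.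
    have /fine_cvgP[_ hv] := cvg_nnsfun_approx mD mv' v0' Dx.
    have : ((v x - h n x) ^+ 2 @[n --> \oo] --> (v x - v x) ^+ 2).
      apply: (@cvg_comp _ _ _ (fun n => v x - h n x) (fun y : R => y ^+ 2)); last exact: exprn_continuous.
      by apply: cvgB; [exact: cvg_cst|exact: hv].
    by rewrite subrr expr0n.
  - move=> n x Dx; rewrite gee0_abs ?lee_fin ?sqr_ge0//.
    have := le_approx n v0' Dx; rewrite -(nnsfun_approxE mD mv') lee_fin => hv.
    have h0 : 0 <= h n x by [].
    have := v0 _ Dx; rewrite -/h in hv; nra.
rewrite integral0 => /cvge_near_lt H; have {H} := H eta%:E; rewrite lte_fin => /(_ eta0).
case=> N _ /(_ _ (leqnn N)) /= hN; exists (h N); split=> //; last exact: ltW.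
exact: L2_approx_nnsfun.
Qed.

Lemma L2_approx_sq_integrable (v : R -> R) : measurable_fun D (v : RT R -> R) ->
  mu.-integrable D (fun x => (v x ^+ 2)%:E) -> L2_approx v.
Proof.
move=> mv iv.
have -> : v = fun x => Num.max (v x) 0 + (-1) * Num.max (- v x) 0.
  by apply/funext => x; case: (lerP (v x) 0); case: (lerP (- v x) 0) => ? ?; lra.
have m1 : measurable_fun D ((fun x => Num.max (v x) 0) : RT R -> R) by exact: measurable_maxr.
have m2 : measurable_fun D ((fun x => Num.max (- v x) 0) : RT R -> R).
  by apply: measurable_maxr => //; exact: measurableT_comp.
apply: L2_approx_add => //; first exact: measurable_funM.
  apply: L2_approx_ge0 => // [x _|]; first by rewrite le_max lexx orbT.
  apply: le_integrable iv => //; first by apply/measurable_EFinP; exact: measurable_funX.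
  move=> x _; rewrite !gee0_abs ?lee_fin ?sqr_ge0//.
  by case: (lerP (v x) 0) => ?; nra.
apply: L2_approx_scale => //; apply: L2_approx_ge0 => // [x _|]; first by rewrite le_max lexx orbT.
apply: le_integrable iv => //; first by apply/measurable_EFinP; exact: measurable_funX.
move=> x _; rewrite !gee0_abs ?lee_fin ?sqr_ge0//.
by case: (lerP (- v x) 0) => ?; nra.
Qed.

End test_approx.

(** * From equality on sets to equality of integrals *)

Section integral_against_differences.
Context {d} {T : measurableType d} {R : realType}.

Lemma integrable_bounded_finite (m : {finite_measure set T -> \bar R}) (f : T -> R) (M : R) :
  measurable_fun setT f -> (forall x, `|f x| <= M) -> m.-integrable setT (EFin \o f).
Proof.
move=> mf fM; apply: measurable_bounded_integrable => //.
  by rewrite -ge0_fin_numE ?fin_num_measure.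
exists M; split; first exact: num_real.
by move=> N MN x _; apply: le_trans (fM _) (ltW MN).
Qed.

Lemma Rintegral_dominated_cvg (m : {measure set T -> \bar R}) (D : set T)
    (f_ : nat -> T -> R) (f g : T -> R) : measurable D ->
  (forall n, measurable_fun D (f_ n)) -> measurable_fun D f ->
  (forall x, D x -> f_ n x @[n --> \oo] --> f x) ->
  m.-integrable D (EFin \o g) ->
  (forall n x, D x -> `|f_ n x| <= g x) ->
  (\int[m]_(x in D) f_ n x)%R @[n --> \oo] --> (\int[m]_(x in D) f x)%R.
Proof.
move=> mD mf_ mf fcvg ig fg.
have gf x : D x -> `|f x| <= g x.
  move=> Dx; have cn : `|f_ n x| @[n --> \oo] --> `|f x| by apply: cvg_norm; exact: fcvg.
  rewrite -(cvg_lim _ cn)//.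
  by apply: limr_le; [exact: cvgP cn|apply: nearW => n; exact: fg].
apply: fine_cvg.
rewrite fineK; last first.
  apply: integrable_fin_num => //; apply: le_integrable ig => //.
    exact/measurable_EFinP.
  by move=> x Dx; rewrite lee_fin (le_trans (gf x Dx))// ler_norm.
apply: (@dominated_cvg _ _ _ m D mD (fun n x => (f_ n x)%:E) _ (EFin \o g)) => //.
- by move=> n; exact/measurable_EFinP.
- by move=> x Dx; apply: cvg_EFin; [exact: nearW|exact: fcvg].
Qed.

Variables m1 m2 m3 m4 : {finite_measure set T -> \bar R}.
Variable mu : {measure set T -> \bar R}.
Variable D : set T.
Hypothesis mD : measurable D.
Variable f : T -> R.
Hypothesis fint : mu.-integrable D (EFin \o f).
Hypothesis H : forall A, measurable A ->
  fine (m1 A) - fine (m2 A) - (fine (m3 A) - fine (m4 A)) = (\int[mu]_(x in D `&` A) f x)%R.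

(** Four measures are carried so that one statement covers a difference of two charges, through
    their Jordan parts, as well as a single charge, with [m3] and [m4] equal. *)
Definition diff_integral_eq (phi : T -> R) :=
  (\int[m1]_x phi x)%R - (\int[m2]_x phi x)%R - ((\int[m3]_x phi x)%R - (\int[m4]_x phi x)%R) =
  (\int[mu]_(x in D) (f x * phi x))%R.

Definition bounded_measurable (phi : T -> R) :=
  measurable_fun setT phi /\ exists M : R, forall x, `|phi x| <= M.

Lemma bounded_measurable_integrable (m : {finite_measure set T -> \bar R}) phi :
  bounded_measurable phi -> m.-integrable setT (EFin \o phi).
Proof. by move=> [mphi [M hM]]; exact: integrable_bounded_finite hM. Qed.

Let mf : measurable_fun D f.
Proof. by have /measurable_int/measurable_EFinP := fint. Qed.

Lemma bounded_measurable_integrableM phi : bounded_measurable phi ->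
  mu.-integrable D (EFin \o (fun x => f x * phi x)).
Proof.
move=> [mphi [M hM]].
have iM : mu.-integrable D (fun x => M%:E * (EFin \o f) x)%E by exact: integrableZl.
apply: le_integrable iM => //.
  by apply/measurable_EFinP; apply: measurable_funM => //; exact: measurable_funTS.
move=> x _; rewrite lee_fin/= !normrM mulrC ler_wpM2r//.
by rewrite (le_trans (hM x))// ler_norm.
Qed.

Lemma diff_integral_add phi psi : bounded_measurable phi -> bounded_measurable psi ->
  diff_integral_eq phi -> diff_integral_eq psi -> diff_integral_eq (fun x => phi x + psi x).
Proof.
move=> bp bq; rewrite /diff_integral_eq => ep eq.
under [RHS]eq_Rintegral do rewrite mulrDr.
rewrite !RintegralD//; try exact: bounded_measurable_integrable;
  try exact: bounded_measurable_integrableM.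
by rewrite -ep -eq; ring.
Qed.

Lemma diff_integral_scale k phi : bounded_measurable phi ->
  diff_integral_eq phi -> diff_integral_eq (fun x => k * phi x).
Proof.
move=> bp; rewrite /diff_integral_eq => ep.
under [RHS]eq_Rintegral do rewrite mulrCA.
rewrite !RintegralZl//; try exact: bounded_measurable_integrable;
  try exact: bounded_measurable_integrableM.
by rewrite -ep; ring.
Qed.

Lemma bounded_measurable_add phi psi : bounded_measurable phi -> bounded_measurable psi ->
  bounded_measurable (fun x => phi x + psi x).
Proof.
move=> [mp [M hM]] [mq [N hN]]; split; first exact: measurable_funD.
by exists (M + N) => x; rewrite (le_trans (ler_normD _ _))// lerD.
Qed.

Lemma bounded_measurable_scale k phi : bounded_measurable phi ->
  bounded_measurable (fun x => k * phi x).
Proof.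
move=> [mp [M hM]]; split; first exact: measurable_funM.
by exists (`|k| * M) => x; rewrite normrM ler_wpM2l.
Qed.

Lemma bounded_measurable_indic A : measurable A -> bounded_measurable (\1_A : T -> R).
Proof.
move=> mA; split; first exact: measurable_indic.
by exists 1 => x; rewrite indicE; case: (_ \in _); rewrite ?normr1 ?normr0.
Qed.

Lemma diff_integral_indic A : measurable A -> diff_integral_eq \1_A.
Proof.
move=> mA; rewrite /diff_integral_eq /Rintegral !integral_indic// !setIT H//.
rewrite /Rintegral integral_mkcondr; congr fine; apply: eq_integral => x _.
by rewrite patchE indicE; case: (x \in A); rewrite ?mulr1 ?mulr0.
Qed.

Import HBNNSimple.

Lemma diff_integral_nnsfun (h : {nnsfun T >-> R}) :
  bounded_measurable h /\ diff_integral_eq h.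
Proof.
have -> : (h : T -> R) = fun x => \sum_(y <- fset_set (range h)) y * \1_(h @^-1` [set y]) x.
  by apply/funext => x; rewrite [LHS]fimfunE fsbig_finite.
suff : forall s : seq R, (fun phi => bounded_measurable phi /\ diff_integral_eq phi)
  (fun x => \sum_(y <- s) y * \1_(h @^-1` [set y]) x) by exact.
elim=> [|y s [ih1 ih2]].
  under eq_fun do rewrite big_nil.
  split; first by split; [exact: measurable_cst|exists 0 => x; rewrite normr0].
  rewrite /diff_integral_eq /Rintegral !integral0/=.
  under eq_integral do rewrite mulr0.
  by rewrite integral0/=; ring.
under eq_fun do rewrite big_cons.
have mi : measurable (h @^-1` [set y]) by [].
have b1 := bounded_measurable_scale y _ (bounded_measurable_indic _ mi).
split; first exact: bounded_measurable_add.
apply: diff_integral_add => //; apply: diff_integral_scale.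
  exact: bounded_measurable_indic.
exact: diff_integral_indic.
Qed.

Lemma diff_integral_ge0 phi : bounded_measurable phi -> (forall x, 0 <= phi x) ->
  diff_integral_eq phi.
Proof.
move=> bp p0; have [mp [M hM]] := bp.
have mp' : measurable_fun setT (EFin \o phi) by exact/measurable_EFinP.
pose h := nnsfun_approx measurableT mp'.
have p0' x : setT x -> (0 <= (EFin \o phi) x)%E by move=> _; rewrite lee_fin.
have hle n x : `|h n x| <= phi x.
  rewrite ger0_norm//; have := le_approx n p0' (I : setT x).
  by rewrite -(nnsfun_approxE measurableT mp') lee_fin.
have hcv x : h n x @[n --> \oo] --> phi x.
  by have /fine_cvgP[_] := cvg_nnsfun_approx measurableT mp' p0' (I : setT x).
have cv (m : {finite_measure set T -> \bar R}) :
    (\int[m]_x h n x)%R @[n --> \oo] --> (\int[m]_x phi x)%R.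
  apply: Rintegral_dominated_cvg => //; exact: bounded_measurable_integrable.
have cvD : (\int[mu]_(x in D) (f x * h n x))%R @[n --> \oo] --> (\int[mu]_(x in D) (f x * phi x))%R.
  apply: (@Rintegral_dominated_cvg _ _ _ _ (fun x => `|f x * phi x|)) => //.
  - by move=> n; apply: measurable_funM => //; exact: measurable_funTS.
  - by apply: measurable_funM => //; exact: measurable_funTS.
  - by move=> x Dx; apply: cvgM; [exact: cvg_cst|exact: hcv].
  - by have /integrable_abse := bounded_measurable_integrableM _ bp.
  - by move=> n x Dx; rewrite !normrM ler_wpM2l// (le_trans (hle n x))// ler_norm.
have cvL : ((\int[m1]_x h n x)%R - (\int[m2]_x h n x)%R -
    ((\int[m3]_x h n x)%R - (\int[m4]_x h n x)%R)) @[n --> \oo] -->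
    ((\int[m1]_x phi x)%R - (\int[m2]_x phi x)%R - ((\int[m3]_x phi x)%R - (\int[m4]_x phi x)%R)).
  by apply: cvgB; apply: cvgB; exact: cv.
apply: cvg_unique cvD => //.
apply: cvg_trans cvL; apply: near_eq_cvg; apply: nearW => n.
by have [_ /= <-] := diff_integral_nnsfun (h n).
Qed.

Lemma diff_integralE phi : bounded_measurable phi -> diff_integral_eq phi.
Proof.
move=> bp; have [mp [M hM]] := bp.
have bM : bounded_measurable (fun x => M * \1_setT x).
  by apply: bounded_measurable_scale; exact: bounded_measurable_indic.
(* Adding the bound M, written as a multiple of an indicator, reduces a signed function to a
   nonnegative one. *)
have -> : phi = fun x => (phi x + M * \1_setT x) + (-1) * (M * \1_setT x).
  by apply/funext => x; ring.
have b2 := bounded_measurable_add _ _ bp bM.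
apply: diff_integral_add => //.
- exact: bounded_measurable_scale.
- apply: diff_integral_ge0 => // x; rewrite indicT mulr1.
  by have := hM x; rewrite ler_norml => /andP[+ _]; rewrite -subr_ge0 opprK addrC.
- apply: diff_integral_scale => //; apply: diff_integral_scale.
    exact: bounded_measurable_indic.
  exact: diff_integral_indic.
Qed.

End integral_against_differences.

(** * Charges: Jordan parts, variation and duality *)

Section charges.
Context {R : realType}.
Local Notation bmeas := (@bounded_measurable _ (RT R) R).
Implicit Types (nu sig : chargeR R) (A B S : set (RT R)).

Lemma fin_num_cvar nu : fin_num_fun (cvar nu).
Proof. by move=> A mA; rewrite /cvar /charge_variation/= fin_numD !fin_num_measure. Qed.

HB.instance Definition _ nu := Measure.on (cvar nu).
HB.instance Definition _ nu := @Measure_isFinite.Build _ _ _ (cvar nu) (fin_num_cvar nu).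

Definition hahn_P nu : set (RT R) := (hahn_pair nu).1.
Definition hahn_N nu : set (RT R) := (hahn_pair nu).2.

Lemma measurable_hahn_P nu : measurable (hahn_P nu).
Proof. by have [[]] := hahn_pf nu. Qed.

Lemma measurable_hahn_N nu : measurable (hahn_N nu).
Proof. by have [_ []] := hahn_pf nu. Qed.

Lemma hahn_PUN nu : hahn_P nu `|` hahn_N nu = setT.
Proof. by have [] := hahn_pf nu. Qed.

Lemma hahn_PIN nu : hahn_P nu `&` hahn_N nu = set0.
Proof. by have [] := hahn_pf nu. Qed.

Lemma cposE nu A : measurable A -> cpos nu A = nu (A `&` hahn_P nu).
Proof. by move=> mA; rewrite /cpos jordan_posE cjordan_posE /crestr0 mem_set. Qed.

Lemma cnegE nu A : measurable A -> cneg nu A = (- nu (A `&` hahn_N nu))%E.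
Proof. by move=> mA; rewrite /cneg jordan_negE cjordan_negE /crestr0 mem_set. Qed.

Lemma cvarE nu A : cvar nu A = (cpos nu A + cneg nu A)%E.
Proof. by []. Qed.

Lemma cpos_le_cvar nu A : (cpos nu A <= cvar nu A)%E.
Proof. by rewrite cvarE leeDl. Qed.

Lemma cneg_le_cvar nu A : (cneg nu A <= cvar nu A)%E.
Proof. by rewrite cvarE leeDr. Qed.

Lemma charge_cpos_cneg nu A : measurable A -> nu A = (cpos nu A - cneg nu A)%E.
Proof. by move=> mA; rewrite {1}(jordan_decomp (hahn_pf nu) mA) /cadd/= cscaleN1. Qed.

Lemma fine_charge nu A : measurable A ->
  fine (nu A) = fine (cpos nu A) - fine (cneg nu A).
Proof. by move=> mA; rewrite charge_cpos_cneg// fineB ?fin_num_measure. Qed.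

Lemma abs_charge_le_cvar nu A : measurable A -> (`|nu A| <= cvar nu A)%E.
Proof. exact: abse_charge_variation. Qed.

Lemma cpos_hahn_N nu A : measurable A -> cpos nu (A `&` hahn_N nu) = 0%E.
Proof.
move=> mA; rewrite cposE; last by apply: measurableI => //; exact: measurable_hahn_N.
by rewrite -setIA (setIC (hahn_N nu)) hahn_PIN setI0 charge0.
Qed.

Lemma cneg_hahn_P nu A : measurable A -> cneg nu (A `&` hahn_P nu) = 0%E.
Proof.
move=> mA; rewrite cnegE; last by apply: measurableI => //; exact: measurable_hahn_P.
by rewrite -setIA hahn_PIN setI0 charge0 oppe0.
Qed.

Definition rint nu (phi : R -> R) : R :=
  (\int[cpos nu]_x phi x)%R - (\int[cneg nu]_x phi x)%R.

Lemma cint_rint nu (phi : R -> R) :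
  bmeas phi -> cint nu phi = (rint nu phi)%:E.
Proof.
move=> bp; rewrite /cint /rint EFinB /Rintegral !fineK//.
  by apply: integrable_fin_num => //; exact: bounded_measurable_integrable.
by apply: integrable_fin_num => //; exact: bounded_measurable_integrable.
Qed.

Lemma rint_density nu (D : set (RT R)) (f : R -> R) (phi : R -> R) : measurable D ->
  leb.-integrable D (EFin \o f) ->
  (forall A, measurable A -> nu A = \int[leb]_(x in A `&` D) (f x)%:E)%E ->
  bmeas phi ->
  rint nu phi = (\int[leb]_(x in D) (f x * phi x))%R.
Proof.
move=> mD fint H bp.
have := @diff_integralE _ (RT R) R (cpos nu) (cneg nu) (cpos nu) (cpos nu) leb D mD f fint.
move=> /(_ _ phi bp); rewrite /diff_integral_eq subrr subr0; apply.
by move=> A mA; rewrite subrr subr0 -fine_charge// H// setIC.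
Qed.

(** Meant for [Du] and [gam]: their common singular part cancels, so the difference has the density
    u' - g even when neither charge has one. *)
Lemma rint_diff_density nu sig (D : set (RT R)) (f : R -> R) (phi : R -> R) : measurable D ->
  leb.-integrable D (EFin \o f) ->
  (forall A, measurable A -> (nu A - sig A = \int[leb]_(x in A `&` D) (f x)%:E)%E) ->
  bmeas phi ->
  rint nu phi - rint sig phi = (\int[leb]_(x in D) (f x * phi x))%R.
Proof.
move=> mD fint H bp.
have := @diff_integralE _ (RT R) R (cpos nu) (cneg nu) (cpos sig) (cneg sig) leb D mD f fint.
move=> /(_ _ phi bp); apply.
move=> A mA; rewrite -!fine_charge// -fineB ?fin_num_charge//; last 2 first.
  exact: fin_num_measure. exact: fin_num_measure.
by rewrite H// setIC.
Qed.

Lemma rint_le_cvar nu (S : set (RT R)) (phi : R -> R) : measurable S ->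
  measurable_fun setT (phi : RT R -> R) -> (forall x, `|phi x| <= 1) ->
  (forall x, ~ S x -> phi x = 0) -> rint nu phi <= fine (cvar nu S).
Proof.
move=> mS mphi phi1 phi0.
have le (m : {finite_measure set (RT R) -> \bar R}) (f : R -> R) :
    measurable_fun setT (f : RT R -> R) -> (forall x, f x <= \1_S x) ->
    (forall x, `|f x| <= 1) -> (\int[m]_x f x)%R <= fine (m S).
  move=> mf fS f1.
  have -> : fine (m S) = (\int[m]_x (\1_S x : R))%R by rewrite /Rintegral integral_indic// setIT.
  apply: le_Rintegral => //.
  - exact: (integrable_bounded_finite _ _ 1).
  - apply: (integrable_bounded_finite _ _ 1); first exact: measurable_indic.
    by move=> x; rewrite indicE; case: (_ \in _); rewrite ?normr1 ?normr0.
have h1 x : phi x <= \1_S x.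
  rewrite indicE; case: (pselect (S x)) => Sx.
    by rewrite mem_set//; exact: le_trans (ler_norm _) (phi1 x).
  by rewrite memNset// phi0.
have h2 x : - phi x <= \1_S x.
  rewrite indicE; case: (pselect (S x)) => Sx; last by rewrite memNset// phi0// oppr0.
  by rewrite mem_set//; apply: le_trans (ler_norm _) _; rewrite normrN.
rewrite cvarE fineD ?fin_num_measure// /rint lerD//; first exact: le.
have -> : - (\int[cneg nu]_x phi x)%R = (\int[cneg nu]_x ((-1) * phi x))%R.
  rewrite RintegralZl ?mulN1r//; exact: (integrable_bounded_finite _ _ 1).
apply: le => [|x|x]; rewrite ?mulN1r//.
- by apply: measurable_funM.
- by rewrite normrN.
Qed.

Lemma test_fun_bounded_measurable (a b : R) phi : a < b -> test_fun a b phi ->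
  bmeas phi.
Proof.
move=> ab tphi; split; first by apply: C1_fun_measurable; exact: test_fun_C1 tphi.
by have [M _ [hM _ _ _]] := test_fun_bounds _ _ _ ab tphi; exists M.
Qed.

Lemma Rintegral_le_measure (m1 m2 : {finite_measure set (RT R) -> \bar R}) (D : set (RT R))
    (f : R -> R) (eta : R) :
  (forall A, measurable A -> (m1 A <= m2 A)%E) -> measurable D ->
  measurable_fun setT (f : RT R -> R) -> (forall x, 0 <= f x) ->
  (\int[m2]_(x in D) (f x)%:E <= eta%:E)%E ->
  (\int[m1]_(x in D) f x)%R <= eta.
Proof.
move=> m12 mD mf f0 h.
have h1 : (\int[m1]_(x in D) (f x)%:E <= eta%:E)%E.
  apply: le_trans h; apply: ge0_le_measure_integral => //.
  exact/measurable_EFinP.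
have h0 : (0 <= \int[m1]_(x in D) (f x)%:E)%E by apply: integral_ge0 => x Dx; rewrite lee_fin f0.
rewrite /Rintegral -lee_fin fineK// ge0_fin_numE//.
exact: le_lt_trans h1 (ltry _).
Qed.

(** The test function is p - q, where p and q approximate the indicators of the two Hahn sets in L1
    of the variation; p - q is thus close to the sign of the charge. Each Jordan part loses at most
    two errors [eta / 4]. *)
Lemma cvar_itv_approx nu (c d eta : R) : c < d -> 0 < eta ->
  exists psi : R -> R, [/\ test_fun c d psi, (forall x, `|psi x| <= 1) &
    fine (cvar nu `]c, d[%classic) - eta <= rint nu psi].
Proof.
move=> cd eta0; have e4 : 0 < eta / 4 by rewrite divr_gt0.
pose D : set (RT R) := `]c, d[%classic.
have mD : measurable D by exact: measurable_itv.
have muD : (cvar nu D < +oo)%E by rewrite -ge0_fin_numE ?fin_num_measure.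
have [p [tp p01 hp]] := test_approx_indic (cvar nu) c d muD _ _ (measurable_hahn_P nu) e4.
have [q [tq q01 hq]] := test_approx_indic (cvar nu) c d muD _ _ (measurable_hahn_N nu) e4.
exists (fun x => p x + (-1) * q x).
have tpsi : test_fun c d (fun x => p x + (-1) * q x).
  by apply: test_fun_add => //; exact: test_fun_scale.
have [mpsi _] := test_fun_bounded_measurable _ _ _ cd tpsi.
have psi1 x : `|p x + (-1) * q x| <= 1.
  have /andP[? ?] := p01 x; have /andP[? ?] := q01 x.
  by rewrite ler_norml; apply/andP; split; lra.
split=> //.
set psi := (fun x => _) in tpsi mpsi psi1 *.
have {}psi1 : forall x, `|psi x| <= 1 := psi1.
have psi0 x : ~ D x -> psi x = 0.
  move=> Dx; have [_ _ [_ _ _ h]] := test_fun_bounds _ _ _ cd tpsi; apply: h.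
  by move=> h; apply: Dx; rewrite /D/= in_itv.
have rD (m : {finite_measure set (RT R) -> \bar R}) :
    (\int[m]_x psi x)%R = (\int[m]_(x in D) psi x)%R.
  rewrite [RHS]Rintegral_mkcond; congr (Rintegral _ _ _); apply/funext => x.
  rewrite patchE; case: (pselect (D x)) => Dx; first by rewrite mem_set.
  by rewrite memNset// psi0.
have mp : measurable_fun D (p : RT R -> R) by apply: C1_fun_measurable; exact: test_fun_C1 tp.
have mq : measurable_fun D (q : RT R -> R) by apply: C1_fun_measurable; exact: test_fun_C1 tq.
have mP := measurable_hahn_P nu; have mN := measurable_hahn_N nu.
have iD (m : {finite_measure set (RT R) -> \bar R}) (f : R -> R) (M : R) :
    measurable_fun D (f : RT R -> R) -> (forall x, `|f x| <= M) -> m.-integrable D (EFin \o f).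
  move=> mf fM; apply: (integrable_bounded _ _ _ _ _ M) => //.
  by rewrite -ge0_fin_numE ?fin_num_measure.
have i01 (A : set (RT R)) x : `|\1_A x : R| <= 1.
  by rewrite indicE; case: (_ \in _); rewrite ?normr1 ?normr0.
have mi (A : set (RT R)) : measurable A -> measurable_fun D (\1_A : RT R -> R).
  by move=> ?; exact: measurable_indic.
have ind (m : {finite_measure set (RT R) -> \bar R}) A : measurable A ->
    (\int[m]_(x in D) (\1_A x : R))%R = fine (m (D `&` A)).
  by move=> mA; rewrite /Rintegral integral_indic// setIC.
have miT (A : set (RT R)) : measurable A -> measurable_fun setT (\1_A : RT R -> R).
  by move=> ?; exact: measurable_indic.
have [mpT _] := test_fun_bounded_measurable _ _ _ cd tp.
have [mqT _] := test_fun_bounded_measurable _ _ _ cd tq.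
have mn1T : measurable_fun setT ((fun x => `|\1_(hahn_P nu) x - p x|) : RT R -> R).
  by have /measurable_EFinP := measurable_normB setT _ _ (miT _ mP) mpT.
have mn2T : measurable_fun setT ((fun x => `|\1_(hahn_N nu) x - q x|) : RT R -> R).
  by have /measurable_EFinP := measurable_normB setT _ _ (miT _ mN) mqT.
have mn1 := @measurable_funTS _ _ _ _ D _ mn1T; have mn2 := @measurable_funTS _ _ _ _ D _ mn2T.
have e1 (m : {finite_measure set (RT R) -> \bar R}) : (forall A, measurable A -> (m A <= cvar nu A)%E) ->
    (\int[m]_(x in D) (`|\1_(hahn_P nu) x - p x|))%R + (\int[m]_(x in D) (`|\1_(hahn_N nu) x - q x|))%R <= eta / 2.
  move=> mle; rewrite (_ : eta / 2 = eta / 4 + eta / 4); last by field.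
  apply: lerD; apply: (Rintegral_le_measure m (cvar nu)) => //.
have bn (A : set (RT R)) (f : R -> R) : (forall x, 0 <= f x <= 1) ->
    forall x, `| `|\1_A x - f x| | <= 1.
  move=> f01 x; rewrite normr_id ler_norml indicE; have /andP[? ?] := f01 x.
  by case: (x \in A) => /=; apply/andP; split; lra.
have PN x : (\1_(hahn_P nu) x : R) + \1_(hahn_N nu) x = 1.
  have := hahn_PUN nu; have := hahn_PIN nu; rewrite !indicE => /seteqP[h1 _] /seteqP[_ h2].
  case: (pselect (hahn_P nu x)) => hP; case: (pselect (hahn_N nu x)) => hN.
  - by have := h1 x (conj hP hN).
  - by rewrite mem_set// memNset// addr0.
  - by rewrite memNset// mem_set// add0r.
  - by have [] := h2 x I.
(* One estimate for both Jordan parts: [m] lives on the Hahn set [A], does not charge the other one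
   [B], and [s] is the sign of the charge on [A]. *)
have key (m : {finite_measure set (RT R) -> \bar R}) (A B : set (RT R)) (s : R) : s = 1 \/ s = -1 ->
    measurable A -> measurable B -> m (D `&` B) = 0%E ->
    (forall x, (\1_A x : R) + \1_B x = 1) ->
    (forall x, (\1_A x : R) - \1_B x = s * (\1_(hahn_P nu) x - \1_(hahn_N nu) x)) ->
    (forall A, measurable A -> (m A <= cvar nu A)%E) ->
    fine (m D) - eta / 2 <= s * (\int[m]_(x in D) psi x)%R.
  move=> hs mA mB mB0 AB AB' mle.
  have mDE : fine (m D) = (\int[m]_(x in D) ((\1_A x : R) - \1_B x))%R.
    rewrite RintegralB//; try by apply: (iD _ _ 1) => //; exact: mi.
    rewrite !ind// mB0 /= subr0.
    have -> : m D = (m (D `&` A) + m (D `&` B))%E.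
      rewrite -measureU; [|exact: measurableI|exact: measurableI|].
        congr (m _); apply/seteqP; split=> [x Dx|x [[]|[]]//].
        have := AB x; rewrite !indicE; case: (pselect (A x)) => Ax; first by left.
        case: (pselect (B x)) => Bx; first by right.
        by rewrite !memNset//= addr0 => /eqP; rewrite eq_sym oner_eq0.
      apply/seteqP; split=> // x [[_ Ax] [_ Bx]].
      have := AB x; rewrite !indicE !mem_set//= => /eqP; rewrite -subr_eq0 addrK oner_eq0//.
    by rewrite mB0 adde0.
  rewrite lerBlDr -lerBlDl mDE.
  have -> : s * (\int[m]_(x in D) psi x)%R = (\int[m]_(x in D) (s * psi x))%R.
    by rewrite RintegralZl//; apply: (iD _ _ 1) => //; exact: measurable_funTS.
  have isp : m.-integrable D (EFin \o (fun x => s * psi x)).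
    apply: (iD _ _ 1); first by apply: measurable_funM => //; exact: measurable_funTS.
    by move=> x; rewrite normrM; case: hs => ->; rewrite ?normr1 ?normrN1 mul1r.
  rewrite -RintegralB//; last first.
    apply: (iD _ _ 2); first by apply: measurable_funB; exact: mi.
    move=> x; rewrite (le_trans (ler_normB _ _))// (_ : 2 = 1 + 1 :> R)// lerD//.
  apply: le_trans (e1 m mle); rewrite -RintegralD//; last 2 first.
    by apply: (iD _ _ 1) => //; exact: bn.
    by apply: (iD _ _ 1) => //; exact: bn.
  apply: le_Rintegral => //.
  + have := integrableB mD (iD m (fun x => (\1_A x : R) - \1_B x) 2 _ _) isp.
    apply; first by apply: measurable_funB; exact: mi.
    by move=> x; rewrite (le_trans (ler_normB _ _))// (_ : 2 = 1 + 1 :> R)// lerD//.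
  + apply: (iD _ _ 2); first exact: measurable_funD.
    by move=> x; rewrite (le_trans (ler_normD _ _))// (_ : 2 = 1 + 1 :> R)// lerD//; exact: bn.
  move=> x Dx; rewrite AB' /psi mulN1r -mulrBr.
  rewrite (_ : \1_(hahn_P nu) x - \1_(hahn_N nu) x - (p x - q x) =
    (\1_(hahn_P nu) x - p x) - (\1_(hahn_N nu) x - q x)); last ring.
  apply: le_trans (ler_norm _) _; rewrite normrM.
  have -> : `|s| = 1 by case: hs => ->; rewrite ?normr1 ?normrN1.
  by rewrite mul1r ler_normB.
rewrite cvarE fineD ?fin_num_measure// /rint !rD.
have k1 := key (cpos nu) (hahn_P nu) (hahn_N nu) 1 (or_introl erefl) mP mN (cpos_hahn_N _ _ mD) PN
  (fun x => esym (mul1r _)) (fun A _ => cpos_le_cvar nu A).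
have k2 := key (cneg nu) (hahn_N nu) (hahn_P nu) (-1) (or_intror erefl) mN mP (cneg_hahn_P _ _ mD)
  (fun x => etrans (addrC _ _) (PN x)) _ (fun A _ => cneg_le_cvar nu A).
have {}k2 := k2 (fun x => ltac:(by rewrite mulN1r opprB)).
by move: k1 k2; rewrite mul1r mulN1r => k1 k2; rewrite [eta]splitr opprD addrACA lerD.
Qed.

End charges.

(** * Masses of sliding windows and comparison of scales *)

Section sliding_windows.
Context {R : realType}.

Definition win (r x : R) : set (RT R) := `](x - r), (x + r)[%classic.

Lemma winE r x y : win r x y <-> `|x - y| < r.
Proof.
rewrite /win/= in_itv/= ltr_norml; split=> /andP[h1 h2]; apply/andP; split; lra.
Qed.

Lemma measurable_win r x : measurable (win r x).
Proof. exact: measurable_itv. Qed.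

Lemma win_sub r s x y : `|x - y| <= s - r -> win r x `<=` win s y.
Proof.
move=> h z; rewrite !winE => hz; rewrite -[y - z](subrKA x) (le_lt_trans (ler_normD _ _))//.
by rewrite (distrC y); lra.
Qed.

Lemma leb_win r x : 0 <= r -> leb (win r x) = (2 * r)%:E.
Proof.
move=> r0; rewrite /win lebesgue_measure_itv/= lte_fin; case: ltP => h.
  by rewrite -EFinD; congr (_%:E); ring.
by congr (_%:E); lra.
Qed.

Definition band (r : R) : set (RT R * RT R) := [set p | `|p.1 - p.2| < r].

Lemma measurable_band r : measurable (band r).
Proof.
have mf : measurable_fun setT ((fun p => `|p.1 - p.2|) : RT R * RT R -> R).
  apply: measurableT_comp => //; apply: measurable_funB.
    exact: measurable_fst.
  exact: measurable_snd.
have := mf measurableT _ (measurable_itv `]-oo, r[); rewrite setTI; congr measurable.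
Qed.

Lemma measurable_massI_win (m : {sigma_finite_measure set (RT R) -> \bar R}) (A : set (RT R)) (r : R) :
  measurable A -> measurable_fun setT (fun x : RT R => m (A `&` win r x)).
Proof.
move=> mA; have mB : measurable ((setT `*` A) `&` band r).
  by apply: measurableI; [exact: measurableX|exact: measurable_band].
have := @measurable_fun_xsection _ _ (RT R) (RT R) R m _ mB.
congr measurable_fun; apply/funext => x /=; congr (m _); apply/seteqP; split=> y.
  by rewrite /xsection/= inE /band/= => -[[_ Ay] /winE].
by move=> [Ay /winE]; rewrite /xsection/= inE.
Qed.

Lemma in_band r (x y : RT R) : ((x, y) \in band r) = (y \in win r x).
Proof. by apply/idP/idP; rewrite !inE => /winE. Qed.

Lemma in_winC r (x y : RT R) : (y \in win r x) = (x \in win r y).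
Proof. by apply/idP/idP; rewrite !inE => /winE h; apply/winE; rewrite distrC. Qed.

Lemma measurable_integral_win (m : {sigma_finite_measure set (RT R) -> \bar R}) (r : R)
    (k : RT R -> \bar R) : measurable_fun setT k -> (forall y, (0 <= k y)%E) ->
  measurable_fun setT (fun x : RT R => \int[m]_(y in win r x) k y)%E.
Proof.
move=> mk k0.
have mg : measurable_fun setT (fun p : RT R * RT R => (k p.2 * (\1_(band r) p : R)%:E)%E).
  apply: emeasurable_funM.
    by apply: (measurableT_comp mk); exact: measurable_snd.
  by apply/measurable_EFinP; apply: measurable_indic; exact: measurable_band.
have g0 (p : RT R * RT R) : (0 <= k p.2 * (\1_(band r) p : R)%:E)%E by rewrite mule_ge0// lee_fin.
have := @measurable_fun_fubini_tonelli_F _ _ (RT R) (RT R) R m _ mg g0.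
congr measurable_fun; apply/funext => x; rewrite [RHS]integral_mkcond.
apply: eq_integral => z _; rewrite patchE indicE in_band.
by case: (z \in win r x); rewrite ?mule1 ?mule0.
Qed.

(** Being in each other's window is a symmetric relation, so after the exchange the inner integral
    is the length of a window centred at y. *)
Lemma tonelli_win (m : {sigma_finite_measure set (RT R) -> \bar R}) (r : R)
    (X : set (RT R)) (k : RT R -> \bar R) : measurable X ->
  measurable_fun setT k -> (forall y, (0 <= k y)%E) ->
  (\int[leb]_(x in X) \int[m]_(y in win r x) k y = \int[m]_y (k y * leb (X `&` win r y)))%E.
Proof.
move=> mX mk k0.
pose f (p : RT R * RT R) : \bar R := (k p.2 * (\1_(X `*` setT) p * \1_(band r) p)%:E)%E.
have mf : measurable_fun setT f.
  apply: emeasurable_funM.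
    by apply: measurableT_comp => //; exact: measurable_snd.
  apply/measurable_EFinP; apply: measurable_funM; apply: measurable_indic.
    exact: measurableX.
  exact: measurable_band.
have f0 p : (0 <= f p)%E by rewrite /f mule_ge0// lee_fin mulr_ge0.
have E1 (x y : RT R) : f (x, y) = ((\1_X x : R)%:E * (k \_ (win r x)) y)%E.
  rewrite /f /= patchE !indicE.
  have -> : ((x, y) \in X `*` [set: RT R]) = (x \in X) by rewrite in_setX in_setT andbT.
  rewrite in_band.
  by case: (x \in X); case: (y \in win r x); rewrite /= ?mulr1 ?mulr0 ?mule1 ?mule0 ?mul1e ?mul0e.
have E2 (x y : RT R) : f (x, y) = (k y * (\1_(X `&` win r y) x : R)%:E)%E.
  rewrite /f /= !indicE.
  have -> : ((x, y) \in X `*` [set: RT R]) = (x \in X) by rewrite in_setX in_setT andbT.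
  by rewrite in_band in_winC in_setI; case: (x \in X); case: (x \in win r y); rewrite /= ?mulr1 ?mulr0.
have := @fubini_tonelli _ _ (RT R) (RT R) R leb m f mf f0.
have -> : (\int[leb]_x \int[m]_y f (x, y) = \int[leb]_(x in X) \int[m]_(y in win r x) k y)%E.
  rewrite [RHS]integral_mkcond; apply: eq_integral => x _.
  rewrite (eq_integral _ _ (fun y _ => E1 x y)) patchE indicE; case: (x \in X) => /=.
    by under eq_integral do rewrite mul1e; rewrite -integral_mkcond.
  by under eq_integral do rewrite mul0e; rewrite integral0.
move=> ->; apply: eq_integral => y _.
rewrite (eq_integral _ _ (fun x _ => E2 x y)) ge0_integralZl//.
- by rewrite integral_indic ?setIT//; apply: measurableI => //; exact: measurable_win.
- by apply/measurable_EFinP; apply: measurable_indic; apply: measurableI => //; exact: measurable_win.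
Qed.

Variable m : {finite_measure set (RT R) -> \bar R}.

Definition mass (r x : R) : R := fine (m (win r x)).

Lemma massE r x : m (win r x) = (mass r x)%:E.
Proof. by rewrite /mass fineK// fin_num_measure//; exact: measurable_win. Qed.

Lemma mass_ge0 r x : 0 <= mass r x.
Proof. exact: fine_ge0. Qed.

Lemma measurable_mass r (D : set (RT R)) : measurable_fun D (mass r : RT R -> R).
Proof.
apply: measurable_funTS; apply: measurableT_comp => //.
by under eq_fun do rewrite -[win r _]setTI; exact: measurable_massI_win.
Qed.

Lemma measurable_min_mass r (D : set (RT R)) :
  measurable_fun D (fun x : RT R => (Num.min (mass r x) 2)%:E).
Proof. by apply/measurable_EFinP; apply: measurable_minr => //; exact: measurable_mass. Qed.

Lemma mass_sub r s x y : `|x - y| <= s - r -> mass r x <= mass s y.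
Proof.
move=> h; rewrite -lee_fin -!massE; apply: le_measure; last exact: win_sub.
  by rewrite inE; exact: measurable_win.
by rewrite inE; exact: measurable_win.
Qed.

Lemma min_mass_ge0 r x : 0 <= Num.min (mass r x) 2.
Proof. by rewrite le_min mass_ge0/=. Qed.

(* Replacing [m] by [theta m] with [theta = 2 / max 2 (m (win h x))] removes the
   truncation at 2 on [win h x], after which the two sides agree by Tonelli. *)
Lemma window_min_mass (e h x : R) : 0 < e -> 0 < h ->
  ((2 * e * Num.min (mass h x) 2)%:E <=
   \int[leb]_(z in win (h + e) x) (Num.min (mass e z) 2)%:E)%E.
Proof.
move=> e0 h0; set X := win (h + e) x.
have mX : measurable X by exact: measurable_win.
have mh := measurable_win h x.
have mi : measurable_fun setT (fun y : RT R => (\1_(win h x) y : R)%:E).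
  by apply/measurable_EFinP; exact: measurable_indic.
have := tonelli_win m e X _ mX mi (fun y => ltac:(by rewrite lee_fin)).
have -> : (\int[m]_y ((\1_(win h x) y : R)%:E * leb (X `&` win e y)) = (2 * e * mass h x)%:E)%E.
  transitivity (\int[m]_y ((2 * e)%:E * (\1_(win h x) y : R)%:E))%E.
    apply: eq_integral => y _; rewrite indicE; case: (pselect (win h x y)) => hy; last first.
      by rewrite memNset// mul0e mule0.
    rewrite mem_set// mul1e mule1 setIidr ?leb_win ?ltW// /X; apply: win_sub.
    by move/winE : hy; rewrite distrC => /ltW; rewrite addrK.
  rewrite ge0_integralZl_EFin//; last by rewrite mulr_ge0// ltW.
  by rewrite integral_indic// setIT [RHS]EFinM -massE.
have -> : (\int[leb]_(z in X) \int[m]_(y in win e z) (\1_(win h x) y : R)%:E =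
           \int[leb]_(z in X) (fine (m (win h x `&` win e z)))%:E)%E.
  apply: eq_integral => z _; rewrite integral_indic//; last exact: measurable_win.
  by rewrite fineK// fin_num_measure//; apply: measurableI => //; exact: measurable_win.
move=> E.
set M := mass h x in E *; pose th : R := 2 / Num.max 2 M.
have mx0 : 0 < Num.max 2 M by rewrite lt_max ltr0n.
have th0 : 0 <= th by rewrite divr_ge0// ltW.
have thM : th * M = Num.min M 2.
  have M0 : 0 <= M by exact: mass_ge0.
  by rewrite /th; case: (leP 2 M) => h2; [rewrite mulfVK// gt_eqF//; lra|field].
have th1 : th <= 1 by rewrite ler_pdivrMr// mul1r le_max lexx.
have mI : measurable_fun X (fun z : RT R => (fine (m (win h x `&` win e z)))%:E).
  apply/measurable_EFinP; apply: measurable_funTS; apply: measurableT_comp => //.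
  exact: measurable_massI_win.
rewrite -thM mulrCA EFinM -E -ge0_integralZl_EFin//; last first.
  by move=> z _; rewrite lee_fin fine_ge0.
apply: ge0_le_integral => //.
- by move=> z _; rewrite -EFinM lee_fin mulr_ge0// fine_ge0.
- by apply: measurable_funeM.
- exact: measurable_min_mass.
move=> z _; rewrite -EFinM lee_fin le_min; apply/andP; split.
  apply: (@le_trans _ _ (fine (m (win h x `&` win e z)))).
    by rewrite ler_piMl// fine_ge0.
  apply: fine_le.
  + by apply: fin_num_measure; apply: measurableI => //; exact: measurable_win.
  + by apply: fin_num_measure; exact: measurable_win.
  + by apply: le_measure; rewrite ?inE; [apply: measurableI => //; exact: measurable_win|exact: measurable_win|exact: subIsetr].
apply: (@le_trans _ _ (th * M)); last by rewrite thM ge_min lexx orbT.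
rewrite ler_wpM2l//; apply: fine_le.
+ by apply: fin_num_measure; apply: measurableI => //; exact: measurable_win.
+ by apply: fin_num_measure; exact: measurable_win.
+ by apply: le_measure; rewrite ?inE//; apply: measurableI => //; exact: measurable_win.
Qed.

Lemma leb_itvI_win (c d r y : R) : 0 <= r -> (leb (`]c, d[ `&` win r y) <= (2 * r)%:E)%E.
Proof.
move=> r0; rewrite -(leb_win r y r0); apply: le_measure; rewrite ?inE.
- by apply: measurableI => //; exact: measurable_win.
- exact: measurable_win.
- exact: subIsetr.
Qed.

(** Integrating [window_min_mass] over x, each z is counted with weight at most 2(h + e). The margin
    2h exceeds h + e, so all windows stay inside (a, b). When both integrals are divided by twice
    their scale, the loss is the factor 1 + e/h, which tends to 1 with e. *)
Lemma scale_comparison (a b e h : R) : 0 < e -> e < h ->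
  ((2 * e)%:E * \int[leb]_(x in `](a + 2 * h)%R, (b - 2 * h)%R[) (Num.min (mass h x) 2)%:E <=
   (2 * (h + e))%:E * \int[leb]_(z in `]a, b[) (Num.min (mass e z) 2)%:E)%E.
Proof.
move=> e0 eh; have h0 : 0 < h := lt_trans e0 eh.
set X : set (RT R) := `](a + 2 * h), (b - 2 * h)[%classic.
have mX : measurable X by exact: measurable_itv.
have nn r x : (0 <= (Num.min (mass r x) 2)%:E)%E by rewrite lee_fin min_mass_ge0.
have mk := measurable_min_mass e setT.
rewrite -ge0_integralZl_EFin//; [|exact: measurable_min_mass|by rewrite mulr_ge0// ltW].
apply: (@le_trans _ _ (\int[leb]_(x in X) \int[leb]_(z in win (h + e) x) (Num.min (mass e z) 2)%:E)%E).
  apply: ge0_le_integral => //.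
  - by move=> x _; rewrite -EFinM lee_fin mulr_ge0 ?min_mass_ge0// mulr_ge0// ltW.
  - by apply: measurable_funeM; exact: measurable_min_mass.
  - by apply: measurable_funTS; exact: measurable_integral_win.
  - by move=> x _; rewrite -EFinM; exact: window_min_mass.
rewrite tonelli_win// -ge0_integralZl_EFin//; [|exact: measurable_min_mass|by rewrite mulr_ge0// addr_ge0// ltW].
rewrite [leRHS]integral_mkcond; apply: ge0_le_integral => //.
- by move=> z _; rewrite mule_ge0.
- apply: emeasurable_funM => //; exact: measurable_massI_win.
- apply/(measurable_restrictT _ _).1 => //; apply: measurable_funeM; exact: measurable_min_mass.
move=> z _; rewrite patchE; case: ifPn => hz.
  by rewrite muleC lee_wpmul2r//; apply: leb_itvI_win; rewrite addr_ge0// ltW.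
rewrite (_ : X `&` win (h + e) z = set0) ?measure0 ?mule0//.
apply/seteqP; split=> // x [+ /winE]; rewrite /X/= in_itv/= distrC ltr_norml => /andP[h1 h2] /andP[h3 h4].
by move/negP: hz; apply; apply: mem_set => /=; rewrite in_itv/=; apply/andP; split; lra.
Qed.

(** The weight whose product with the mass of its own window is the mass truncated at 2. It
    decreases when the window grows, which serves both to change centres and to let r tend to 0. *)
Definition tau (r y : R) : R := 2 / Num.max 2 (mass r y).

Lemma tau_itv r y : 0 <= tau r y <= 1.
Proof.
have mx0 : 0 < Num.max 2 (mass r y) by rewrite lt_max ltr0n.
by rewrite /tau divr_ge0 ?(ltW mx0)//= ler_pdivrMr// mul1r le_max lexx.
Qed.

Lemma tau_ge0 r y : 0 <= tau r y.
Proof. by have /andP[] := tau_itv r y. Qed.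

Lemma measurable_tau r (D : set (RT R)) : measurable_fun D (tau r : RT R -> R).
Proof.
apply: measurable_funM => //; apply: (@measurable_funTS _ _ _ _ D).
have -> : (fun x => (Num.max 2 (mass r x))^-1) = (fun x => (Num.max 2 (mass r x)) `^ (-1)).
  by apply/funext => x; rewrite -powR_inv1// le_max ler0n.
apply: (@measurableT_comp _ _ _ _ _ _ (fun y : R => y `^ (-1)) _ (fun x : RT R => Num.max 2 (mass r x))).
  exact: measurable_powR.
by apply: measurable_maxr => //; exact: measurable_mass.
Qed.

Lemma tau_le r s x y : `|x - y| <= s - r -> tau s y <= tau r x.
Proof.
move=> h; rewrite /tau ler_pM2l// lef_pV2 ?posrE ?lt_max ?ltr0n//.
by rewrite ge_max !le_max lexx/= (mass_sub _ _ _ _ h) orbT.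
Qed.

(** The scale doubles because the window of radius 2h around y contains the window of radius h
    around any x within distance h of y. Hence [tau (2 * h) y] is at most [tau h x], whose product
    with [mass h x] is the truncated mass. The margin 3h keeps the window of radius h around y
    inside the domain of x. *)
Lemma integral_tau_le (a b h : R) : 0 < h ->
  ((2 * h)%:E * \int[m]_(y in `](a + 3 * h)%R, (b - 3 * h)%R[) (tau (2 * h) y)%:E <=
   \int[leb]_(x in `](a + 2 * h)%R, (b - 2 * h)%R[) (Num.min (mass h x) 2)%:E)%E.
Proof.
move=> h0; set X : set (RT R) := `](a + 2 * h), (b - 2 * h)[%classic.
have mX : measurable X by exact: measurable_itv.
have mt D : measurable_fun D (fun y : RT R => (tau (2 * h) y)%:E).
  by apply/measurable_EFinP; exact: measurable_tau.
have t0 y : (0 <= (tau (2 * h) y)%:E)%E by rewrite lee_fin tau_ge0.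
apply: (@le_trans _ _ (\int[leb]_(x in X) \int[m]_(y in win h x) (tau (2 * h) y)%:E)%E).
  rewrite tonelli_win// -ge0_integralZl_EFin//; last by rewrite mulr_ge0// ltW.
  rewrite [leLHS]integral_mkcond; apply: ge0_le_integral => //.
  - by move=> y _; apply: erestrict_ge0 => z _; rewrite -EFinM lee_fin mulr_ge0 ?tau_ge0// mulr_ge0// ltW.
  - by apply/(measurable_restrictT _ _).1 => //; apply: measurable_funeM.
  - by apply: emeasurable_funM => //; exact: measurable_massI_win.
  move=> y _; rewrite patchE; case: ifPn => hy; last by rewrite mule_ge0.
  rewrite muleC lee_wpmul2l// -(leb_win h y (ltW h0)) setIidr// => x /winE.
  move: hy; rewrite inE/= in_itv/= ltr_norml /X/= in_itv/= => /andP[? ?] /andP[? ?].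
  by apply/andP; split; lra.
apply: ge0_le_integral => //.
- by move=> x _; exact: integral_ge0.
- by apply: measurable_funTS; exact: measurable_integral_win.
- exact: measurable_min_mass.
suff main (x : R) : (\int[m]_(y in win h x) (tau (2 * h) y)%:E <= (Num.min (mass h x) 2)%:E)%E.
  by move=> x _; exact: main.
apply: (@le_trans _ _ (\int[m]_(y in win h x) (cst (tau h x)%:E y))%E).
  apply: ge0_le_integral => //; first exact: measurable_win.
    by move=> y /winE hy; rewrite lee_fin; apply: tau_le; lra.
rewrite integral_cst; last exact: measurable_win.
apply: (@le_trans _ _ ((tau h x)%:E * (mass h x)%:E)%E); first by rewrite -massE.
rewrite -EFinM lee_fin /tau; have := mass_ge0 h x.
case: (leP 2 (mass h x)) => h2 M0; first by rewrite mulfVK// gt_eqF//; lra.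
by rewrite divff// mul1r.
Qed.

End sliding_windows.

Lemma cvg_nat_at_right0 {R : realType} (r : nat -> R) : (forall n, 0 < r n) ->
  r n @[n --> \oo] --> 0 -> r n @[n --> \oo] --> 0^'+.
Proof.
move=> r0 cr A hA; have h := cr _ hA.
rewrite nbhs_filterE /= in h *.
by apply: filterS h => n /=; apply; exact: r0.
Qed.

Lemma leb_itv_lty {R : realType} (a b : R) : (leb (`]a, b[%classic : set (RT R)) < +oo)%E.
Proof. by rewrite lebesgue_measure_itv/=; case: ifP => _; rewrite -?EFinB ltry. Qed.

(** * Representation of u by the tails of its derivative *)

Section BV_line.
Context {R : realType}.
Variables (a b : R) (u : R -> R) (Du : chargeR R).
Hypothesis ab : a < b.
Hypothesis dd : distr_deriv a b u Du.
Let D : set (RT R) := `]a, b[%classic.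
Let mD : measurable D. Proof. exact: measurable_itv. Qed.
Let iu : leb.-integrable D (EFin \o u). Proof. by case: dd. Qed.
Let mu : measurable_fun D (u : RT R -> R).
Proof. by have /measurable_int/measurable_EFinP := iu. Qed.

(** A smooth version of the indicator of the half-line to the right of x. It equals 1 far to the
    right, so only a difference of two ramps can be a test function. *)
Definition ramp (x : R) (n : nat) (t : R) : R := step (n.+1%:R * t + - (n.+1%:R * x)).
Definition dramp (x : R) (n : nat) (t : R) : R := tent (n.+1%:R * t + - (n.+1%:R * x)) * n.+1%:R.

Lemma is_derive_ramp (x : R) n (t : R) : is_derive t 1 (ramp x n) (dramp x n t).
Proof. exact: (is_derive_affine _ _ _ _ _ is_derive_step). Qed.

Lemma C1_fun_ramp x n : C1_fun (ramp x n).
Proof. by apply: C1_fun_affine; exact: C1_fun_step. Qed.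

Lemma continuous_dramp x n : continuous (dramp x n).
Proof.
have [_] := C1_fun_derive1 _ (C1_fun_ramp x n); suff -> : derive1 (ramp x n) = dramp x n by [].
by apply/funext => t; rewrite derive1E; have [_ ->] := is_derive_ramp x n t.
Qed.

Lemma measurable_dramp x n (A : set (RT R)) : measurable_fun A (dramp x n : RT R -> R).
Proof.
by apply: (@measurable_funTS _ _ _ _ A); apply: continuous_measurable_fun; exact: continuous_dramp.
Qed.

Lemma ramp_itv x n t : 0 <= ramp x n t <= 1.
Proof. exact: step_itv. Qed.

Lemma rampE x n t : ramp x n t = step (n.+1%:R * (t - x)).
Proof. by rewrite /ramp mulrBr. Qed.

Lemma drampE x n t : dramp x n t = tent (n.+1%:R * (t - x)) * n.+1%:R.
Proof. by rewrite /dramp mulrBr. Qed.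

Lemma ramp_le x n t : t <= x -> ramp x n t = 0.
Proof. by move=> tx; rewrite rampE step_le0// mulr_ge0_le0// subr_le0. Qed.

Lemma ramp_ge x n t : x + n.+1%:R^-1 <= t -> ramp x n t = 1.
Proof. by move=> tx; rewrite rampE step_ge1// -ler_pdivrMl// mulr1 lerBrDl. Qed.

Lemma cvg_ramp x t : ramp x n t @[n --> \oo] --> (\1_(`]x, +oo[) t : R).
Proof.
rewrite indicE; case: (pselect (x < t)) => xt.
  rewrite mem_set/= ?in_itv/= ?xt//; apply: cvg_near_cst; near=> n.
  by rewrite rampE step_ge1//; near: n; apply: near_mulSn_ge; rewrite subr_gt0.
rewrite memNset/=; last by rewrite in_itv/= andbT.
apply: cvg_near_cst; near=> n; rewrite ramp_le// leNgt; exact/negP.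
Unshelve. all: by end_near. Qed.

Lemma dramp_itv x n t : 0 <= dramp x n t <= 2 * n.+1%:R.
Proof.
have /andP[h1 h2] := tent_itv (n.+1%:R * (t - x)).
by rewrite drampE mulr_ge0//= ler_wpM2r.
Qed.

Lemma dramp_out x n t : ~ (x <= t <= x + n.+1%:R^-1) -> dramp x n t = 0.
Proof.
move=> h; rewrite drampE tent_out ?mul0r// => /andP[h1 h2]; apply: h.
move: h1 h2; rewrite pmulr_rge0// subr_ge0 => ->/=.
by rewrite -ler_pdivlMl// mulr1 lerBlDl.
Qed.

Lemma Rintegral_dramp x n : a < x -> x + n.+1%:R^-1 < b ->
  (\int[leb]_(t in D) dramp x n t)%R = 1.
Proof.
move=> ax xb; have x1 : x < x + n.+1%:R^-1 by rewrite ltrDl.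
have cr : continuous (ramp x n) by apply: C1_fun_continuous; exact: C1_fun_ramp.
have : (\int[leb]_(t in `[x, (x + n.+1%:R^-1)%R]) (dramp x n t)%:E)%E =
    ((ramp x n (x + n.+1%:R^-1))%:E - (ramp x n x)%:E)%E.
  apply: continuous_FTC2 => //.
  - by apply: continuous_subspaceT; exact: continuous_dramp.
  - split.
    + by move=> t _; have [] := is_derive_ramp x n t.
    + by apply: cvg_at_right_filter; exact: cr.
    + by apply: cvg_at_left_filter; exact: cr.
  - by move=> t _; rewrite derive1E; have [_ ->] := is_derive_ramp x n t.
rewrite ramp_ge// ramp_le// sube0 => E.
rewrite /Rintegral (_ : \int[leb]_(t in D) _ = 1)%E//= -E.
rewrite integral_mkcond [RHS]integral_mkcond; apply: eq_integral => t _.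
rewrite !patchE; case: (pselect (x <= t <= x + n.+1%:R^-1)) => h.
  have -> : (t \in D) by rewrite inE /D/= in_itv/=; case/andP: h => h1 h2;
    rewrite (lt_le_trans ax h1) (le_lt_trans h2 xb).
  by have -> : t \in `[x, x + n.+1%:R^-1]%classic by rewrite inE/= in_itv.
have -> : (t \in `[x, x + n.+1%:R^-1]%classic) = false.
  by apply/negP; rewrite inE/= in_itv.
by case: ifP => // _; rewrite dramp_out.
Qed.

Lemma integrable_udramp x n : leb.-integrable D (EFin \o (fun t => u t * dramp x n t)).
Proof.
have i2 : leb.-integrable D (fun t => (2 * n.+1%:R)%:E * (EFin \o u) t)%E by exact: integrableZl.
apply: le_integrable i2 => //.
  by apply/measurable_EFinP; apply: measurable_funM => //; exact: measurable_dramp.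
move=> t _; rewrite lee_fin/= [leLHS]normrM [leRHS]normrM mulrC ler_wpM2r//.
have /andP[h1 h2] := dramp_itv x n t; rewrite (ger0_norm h1) (le_trans h2)//.
by rewrite ger0_norm.
Qed.

Definition uavg x n : R := (\int[leb]_(t in D) (u t * dramp x n t))%R.

Lemma ramp_bounded x n : @bounded_measurable _ (RT R) R (ramp x n).
Proof.
split; first by apply: C1_fun_measurable; exact: C1_fun_ramp.
by exists 1 => t; have /andP[h1 h2] := ramp_itv x n t; rewrite ger0_norm.
Qed.

(** The difference of the two ramps is compactly supported in (a, b), and its derivative is the
    difference of the two averaging kernels. Testing the definition of [Du] with it gives the
    identity. *)
Lemma uavg_ramp_const x y n : a < x < b -> a < y < b -> x + n.+1%:R^-1 < b -> y + n.+1%:R^-1 < b ->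
  uavg x n + rint Du (ramp x n) = uavg y n + rint Du (ramp y n).
Proof.
move=> /andP[ax xb] /andP[ay yb] hx hy.
pose phi t := ramp y n t + (-1) * ramp x n t.
have Cphi : C1_fun phi.
  by apply: C1_fun_add; [exact: C1_fun_ramp|apply: C1_fun_mul; [exact: C1_fun_cst|exact: C1_fun_ramp]].
have dphi t : derive1 phi t = dramp y n t - dramp x n t.
  rewrite derive1E.
  have : is_derive t 1 (ramp y n + ((-1) \*: ramp x n)) (dramp y n t + (-1) *: dramp x n t).
    apply: is_deriveD; first exact: is_derive_ramp.
    by apply: is_deriveZ; exact: is_derive_ramp.
  by move=> [_]; rewrite scaleN1r => <-.
have tphi : test_fun a b phi.
  have [d1 d2] := C1_fun_derive1 _ Cphi; split=> //.
  exists (Num.min x y), (Num.max (x + n.+1%:R^-1) (y + n.+1%:R^-1)); split.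
  - by rewrite lt_min ax ay.
  - by rewrite gt_max hx hy.
  move=> t /negP; rewrite negb_and -!ltNge lt_min gt_max => /orP[/andP[h1 h2]|/andP[h1 h2]].
    by rewrite /phi !ramp_le ?ltW// mulr0 addr0.
  by rewrite /phi !ramp_ge ?ltW// mulN1r subrr.
have [_ _ /(_ phi tphi)] := dd.
rewrite cint_rint; last exact: test_fun_bounded_measurable tphi.
under eq_integral do rewrite dphi mulrBr.
have -> : (\int[leb]_(x0 in `]a, b[) (u x0 * dramp y n x0 - u x0 * dramp x n x0)%:E =
    (uavg y n - uavg x n)%:E)%E.
  rewrite /uavg -RintegralB; [|by []|exact: integrable_udramp|exact: integrable_udramp].
  rewrite /Rintegral fineK//; apply: integrable_fin_num => //.
  have := integrableB mD (integrable_udramp y n) (integrable_udramp x n).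
  by apply: eq_integrable.
have -> : rint Du phi = rint Du (ramp y n) - rint Du (ramp x n).
  have lin (m : {finite_measure set (RT R) -> \bar R}) :
      (\int[m]_t phi t)%R = (\int[m]_t ramp y n t)%R - (\int[m]_t ramp x n t)%R.
    rewrite /phi -RintegralB//; try by apply: bounded_measurable_integrable; exact: ramp_bounded.
    by apply: eq_Rintegral => t _; rewrite mulN1r.
  by rewrite /rint !lin; ring.
by rewrite -EFinN => -[] h; lra.
Qed.

(** The half-line is open because every ramp vanishes at x itself. *)
Definition tail x : R := fine (Du `]x, +oo[%classic).

Lemma cvg_rint_ramp x : rint Du (ramp x n) @[n --> \oo] --> tail x.
Proof.
have cv (m : {finite_measure set (RT R) -> \bar R}) :
    (\int[m]_t ramp x n t)%R @[n --> \oo] --> fine (m `]x, +oo[%classic).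
  have -> : fine (m `]x, +oo[%classic) = (\int[m]_t (\1_(`]x, +oo[%classic) t : R))%R.
    by rewrite /Rintegral integral_indic// setIT.
  apply: (@Rintegral_dominated_cvg _ (RT R) R m setT _ _ (cst 1)) => //.
  - by move=> n; have [] := ramp_bounded x n.
  - by move=> t _; exact: cvg_ramp.
  - by apply: (integrable_bounded_finite _ _ 1) => // t; rewrite normr1.
  - by move=> n t _; have /andP[h1 h2] := ramp_itv x n t; rewrite ger0_norm.
by rewrite /tail fine_charge//; apply: cvgB; exact: cv.
Qed.

Lemma near_invSn (e : R) : 0 < e -> \forall n \near \oo, n.+1%:R^-1 < e.
Proof.
move=> e0; near=> n; rewrite invf_plt ?posrE//.
rewrite (@lt_le_trans _ _ n%:R) ?ler_nat//.
by near: n; exact: nbhs_infty_gtr.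
Unshelve. all: by end_near. Qed.

(** The kernels have integral 1 and are bounded by a multiple of normalised indicators of shrinking
    balls, which is enough at a Lebesgue point although they sit on one side of it. *)
Lemma cvg_uavg x : a < x < b -> lebesgue_pt (u \_ D) x -> uavg x n @[n --> \oo] --> u x.
Proof.
move=> /andP[ax xb] lx.
have Dx : D x by rewrite /D/= in_itv/= ax xb.
have vD : (u \_ D) x = u x by rewrite patchE mem_set.
(* The radius is twice the length of the support of the kernel, so that the closed support lies in
   the open ball. The constant 8 below is the bound 2(n+1) of the kernel times the length 4/(n+1) of
   the ball. *)
pose r n : R := 2 * n.+1%:R^-1.
have r0 n : 0 < r n by rewrite /r mulr_gt0.
have cr : r n @[n --> \oo] --> 0^'+.
  apply: cvg_nat_at_right0 => //.
  rewrite -[X in _ --> X](mulr0 2); apply: cvgM; first exact: cvg_cst.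
  exact: cvg_harmonic.
have cd : davg (u \_ D) x (r n) @[n --> \oo] --> 0%E by apply: cvg_comp cr lx.
have key : \forall n \near \oo, (`|uavg x n - u x|%:E <= 8%:E * davg (u \_ D) x (r n))%E.
  near=> n.
  have hx : x + n.+1%:R^-1 < b.
    by rewrite -ltrBrDl; near: n; apply: near_invSn; rewrite subr_gt0.
  have i2 : leb.-integrable D (EFin \o dramp x n).
    apply: (integrable_bounded _ _ _ _ _ (2 * n.+1%:R)) => //.
    - exact: leb_itv_lty.
    - exact: measurable_dramp.
    - by move=> t _; have /andP[h1 h2] := dramp_itv x n t; rewrite ger0_norm.
  have i2' : leb.-integrable D (EFin \o (fun t => u x * dramp x n t)).
    by have := integrableZl mD (u x) i2; apply: eq_integrable.
  have i3 : leb.-integrable D (EFin \o (fun t => (u t - u x) * dramp x n t)).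
    have := integrableB mD (integrable_udramp x n) i2'; apply: eq_integrable => // t _.
    by rewrite /= -EFinB mulrBl.
  have -> : uavg x n - u x = (\int[leb]_(t in D) ((u t - u x) * dramp x n t))%R.
    under eq_Rintegral do rewrite mulrBl.
    rewrite RintegralB//; last exact: integrable_udramp.
    by rewrite RintegralZl// Rintegral_dramp// mulr1.
  have m3 : measurable_fun D (fun t : RT R => ((u t - u x) * dramp x n t)%:E) by have /measurable_int := i3.
  apply: (@le_trans _ _ (\int[leb]_(t in D) `|((u t - u x) * dramp x n t)%:E|)%E).
    rewrite EFin_normr_Rintegral//; exact: le_abse_integral.
  have rE : (2 * n.+1%:R)%:E = (8%:E * ((r n *+ 2)%:E)^-1)%E.
    rewrite inver mulrn_eq0/= gt_eqF// -EFinM; congr (_%:E); rewrite /r -mulr_natl.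
    by field; rewrite ?pnatr_eq0.
  rewrite /davg /iavg muleA lebesgue_measure_ball; last exact/ltW.
  rewrite -rE.
  have mc : measurable_fun setT (fun t : RT R => `|((center ((u \_ D) x) \o (u \_ D)) t)%:E|%E).
    apply: measurableT_comp => //; apply/measurable_EFinP; apply: measurable_funB => //.
    by apply/(measurable_restrictT _ _).1.
  pose B : set (RT R) := ball x (r n).
  have mB : measurable B by exact: measurable_ball.
  apply: (@le_trans _ _ ((2 * n.+1%:R)%:E *
    \int[leb]_(y in B) `|((center ((u \_ D) x) \o (u \_ D)) y)%:E|)%E); last exact: lexx.
  rewrite -ge0_integralZl_EFin//; last exact: measurable_funTS.
  rewrite [leLHS]integral_mkcond [leRHS]integral_mkcond.
  apply: (@ge0_le_integral _ (RT R) R leb setT measurableT) => //.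
  - by move=> t _; apply: erestrict_ge0.
  - by apply/(measurable_restrictT _ _).1 => //; apply: measurableT_comp.
  - apply/(measurable_restrictT _ _).1 => //.
    by apply: measurable_funeM; exact: measurable_funTS.
  move=> t _; rewrite !patchE; case: (pselect (D t)) => Dt; last first.
    by rewrite memNset//; case: ifP => // _; rewrite mule_ge0.
  rewrite mem_set//; case: (pselect (x <= t <= x + n.+1%:R^-1)) => ht; last first.
    by rewrite dramp_out// mulr0 abse0; case: ifP => // _; rewrite mule_ge0.
  have -> : t \in B.
    rewrite inE /B /ball/= distrC ltr_norml; have : 0 < n.+1%:R^-1 :> R by [].
    rewrite /r; move: (n.+1%:R^-1) ht => k /andP[? ?] ?; apply/andP; split; lra.
  rewrite /shift/= ?patchE !mem_set// -EFinM lee_fin normrM mulrC ler_wpM2r//.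
  by have /andP[h1 h2] := dramp_itv x n t; rewrite ger0_norm.
apply/cvgrPdist_le => e e0.
have := cvge_near_lt _ _ (e / 8)%:E cd; rewrite lte_fin divr_gt0// => /(_ isT) hd.
near=> n; rewrite distrC -lee_fin; apply: le_trans (near key n _) _ => //.
have hn : (davg (u \_ D) x (r n) < (e / 8)%:E)%E by near: n.
apply: le_trans (lee_wpmul2l _ (ltW hn)) _ => //.
by rewrite -EFinM lee_fin mulrC mulfVK.
Unshelve. all: by end_near. Qed.


Lemma ae_itv_exists (P : R -> Prop) : {ae leb, forall x, P x} -> exists2 x, a < x < b & P x.
Proof.
move=> aeP; apply/not_exists2P => H.
have : leb.-negligible D.
  apply: negligibleS aeP => x; rewrite /D/= in_itv/= => xab Px.
  by have [] := H x.
move=> neg; have E : leb D = (b - a)%:E by rewrite /D lebesgue_measure_itv/= lte_fin ab -EFinB.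
have : leb D = 0%E by exact: (measure_negligible mD neg).
by rewrite E => -[] /eqP; rewrite subr_eq0 gt_eqF.
Qed.

Lemma ae_eq_tail : exists C : R, {ae leb, forall x, a < x < b -> u x = C - tail x}.
Proof.
have aeL : {ae leb, forall x, lebesgue_pt (u \_ D) x}.
  apply: lebesgue_differentiation; apply: integrable_locally_restrict => //.
(* A single Lebesgue point serves as base point and determines the constant. *)
have [y yab ly] := ae_itv_exists _ aeL.
have key (x : R) : a < x < b -> lebesgue_pt (u \_ D) x -> u x = u y + tail y - tail x.
  move=> xab lx.
  have cx : (uavg x n + rint Du (ramp x n)) @[n --> \oo] --> u x + tail x.
    by apply: cvgD; [exact: cvg_uavg|exact: cvg_rint_ramp].
  have cy : (uavg y n + rint Du (ramp y n)) @[n --> \oo] --> u y + tail y.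
    by apply: cvgD; [exact: cvg_uavg|exact: cvg_rint_ramp].
  suff : u x + tail x = u y + tail y by move=> <-; rewrite addrK.
  apply: cvg_unique cy => //; apply: cvg_trans cx; apply: near_eq_cvg.
  have /andP[ax xb] := xab; have /andP[ay yb] := yab; near=> n.
  apply: uavg_ramp_const => //.
    by rewrite -ltrBrDl; near: n; apply: near_invSn; rewrite subr_gt0.
  by rewrite -ltrBrDl; near: n; apply: near_invSn; rewrite subr_gt0.
exists (u y + tail y); apply: negligibleS aeL => x /= nx lx; apply: nx => xab.
exact: key.
Unshelve. all: by end_near. Qed.

End BV_line.

(** * Jumps of u are the atoms of Du *)

Section one_sided_limits.
Context {R : realType}.

Lemma cvar_lty (nu : chargeR R) (A : set (RT R)) : measurable A -> (cvar nu A < +oo)%E.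
Proof. by move=> mA; rewrite -ge0_fin_numE//; exact: fin_num_cvar. Qed.

Lemma cvg_aplim (F : R -> \bar R) : (forall r, 0 < r -> (0 <= F r)%E) ->
  (forall e : R, 0 < e -> exists2 d : R, 0 < d & forall r, 0 < r < d -> (F r <= e%:E)%E) ->
  F r @[r --> 0^'+] --> 0%E.
Proof.
move=> F0 H; apply/fine_cvgP; split.
  have [d d0 hd] := H 1 ltr01; near=> r.
  have r0 : 0 < r by near: r; exact: nbhs_right_gt.
  rewrite ge0_fin_numE ?F0// (le_lt_trans (hd r _)) ?ltry// r0/=.
  by near: r; exact: nbhs_right_lt.
apply/cvgrPdist_le => e e0; have [d d0 hd] := H e e0; near=> r.
have r0 : 0 < r by near: r; exact: nbhs_right_gt.
have hr : (F r <= e%:E)%E by apply: hd; rewrite r0/=; near: r; exact: nbhs_right_lt.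
rewrite /= sub0r normrN ger0_norm ?fine_ge0 ?F0// -lee_fin fineK//.
by rewrite ge0_fin_numE ?F0// (le_lt_trans hr) ?ltry.
Unshelve. all: by end_near. Qed.

(** The family [I] stands for the right or the left intervals of length r, so one proof serves both
    sides. Measurability is asked for small r only, when the intervals lie in (a, b). *)
Lemma aplim_of_ae_bound (u : R -> R) (c : R) (I : R -> set (RT R)) :
  (forall r, 0 < r -> leb (I r) = r%:E /\ measurable (I r)) ->
  (exists2 d, 0 < d & forall r, 0 < r < d -> measurable_fun (I r) (u : RT R -> R)) ->
  (forall e : R, 0 < e -> exists2 d : R, 0 < d &
     forall r, 0 < r < d -> {ae leb, forall t, I r t -> `|u t - c| <= e}) ->
  (fun r : R => (r^-1)%:E * \int[leb]_(t in I r) (`|u t - c|)%:E)%E @ 0^'+ --> 0%E.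
Proof.
move=> hI [d0 d00 mu] H; apply: cvg_aplim.
  move=> r r0; rewrite mule_ge0//.
    by rewrite lee_fin invr_ge0 (ltW r0).
  by apply: integral_ge0 => t _; rewrite lee_fin.
move=> e e0; have [d1 d10 hd] := H e e0; exists (Num.min d0 d1); first by rewrite lt_min d00.
move=> r /andP[r0]; rewrite lt_min => /andP[rd0 rd1]; have [lI mI] := hI r r0.
have mur : measurable_fun (I r) (u : RT R -> R) by apply: mu; rewrite r0.
have := hd r; rewrite r0 rd1 => /(_ isT) ae1.
have le1 : (\int[leb]_(t in I r) (`|u t - c|)%:E <= \int[leb]_(t in I r) (cst e%:E t))%E.
  apply: ae_ge0_le_integral => //.
  - by apply/measurable_EFinP; apply: measurableT_comp => //; exact: measurable_funB.
  - by move=> x _; rewrite lee_fin ltW.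
have E : (\int[leb]_(t in I r) (cst e%:E t) = e%:E * r%:E)%E by rewrite integral_cst// -lI.
rewrite E in le1; apply: (@le_trans _ _ ((r^-1)%:E * (e%:E * r%:E))%E).
  by rewrite lee_wpmul2l// lee_fin invr_ge0 ltW.
by rewrite -!EFinM lee_fin mulrCA mulVf ?mulr1// gt_eqF.
Qed.

Lemma aplim_uniq (u : R -> R) (c1 c2 : R) (I : R -> set (RT R)) :
  (forall r, 0 < r -> leb (I r) = r%:E /\ measurable (I r)) ->
  (exists2 d, 0 < d & forall r, 0 < r < d -> measurable_fun (I r) (u : RT R -> R)) ->
  (fun r : R => (r^-1)%:E * \int[leb]_(t in I r) (`|u t - c1|)%:E)%E @ 0^'+ --> 0%E ->
  (fun r : R => (r^-1)%:E * \int[leb]_(t in I r) (`|u t - c2|)%:E)%E @ 0^'+ --> 0%E ->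
  c1 = c2.
Proof.
move=> hI [d d0 mu] h1 h2; apply/eqP; rewrite -subr_eq0 -normr_le0 -lee_fin.
have cv : ((r^-1)%:E * \int[leb]_(t in I r) (`|u t - c1|)%:E +
    (r^-1)%:E * \int[leb]_(t in I r) (`|u t - c2|)%:E)%E @[r --> 0^'+] --> (0 + 0)%E.
  by apply: cvgeD.
rewrite adde0 in cv.
suff near_le : \forall r \near 0^'+, (`|c1 - c2|%:E <= (r^-1)%:E * \int[leb]_(t in I r) (`|u t - c1|)%:E +
    (r^-1)%:E * \int[leb]_(t in I r) (`|u t - c2|)%:E)%E.
  rewrite -[leRHS](cvg_lim (@ereal_hausdorff R) cv).
  by apply: lime_ge => //; exact: cvgP cv.
near=> r.
have r0 : 0 < r by near: r; exact: nbhs_right_gt.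
have rd : r < d by near: r; exact: nbhs_right_lt.
have [lI mI] := hI r r0.
have mur : measurable_fun (I r) (u : RT R -> R) by apply: mu; rewrite r0.
have mc c : measurable_fun (I r) (fun t : RT R => (`|u t - c|)%:E).
  by apply/measurable_EFinP; apply: measurableT_comp => //; exact: measurable_funB.
rewrite -ge0_muleDr ?integral_ge0// -ge0_integralD//.
have -> : (`|c1 - c2|%:E = (r^-1)%:E * \int[leb]_(t in I r) (cst `|c1 - c2|%:E t))%E.
  have -> : (\int[leb]_(t in I r) (cst `|c1 - c2|%:E t) = `|c1 - c2|%:E * r%:E)%E.
    by rewrite integral_cst// -lI.
  by rewrite -!EFinM mulrCA mulVf ?mulr1// gt_eqF.
apply: lee_wpmul2l; first by rewrite lee_fin invr_ge0 (ltW r0).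
apply: ge0_le_integral => //.
- by move=> t _; rewrite lee_fin.
- by apply: emeasurable_funD.
move=> t _; rewrite -EFinD lee_fin /= -[c1 - c2](subrKA (u t)) addrC.
by rewrite (le_trans (ler_normD _ _))// (distrC c1) addrC.
Unshelve. all: by end_near. Qed.

Variables (a b : R) (u : R -> R) (Du : chargeR R).
Hypothesis ab : a < b.
Hypothesis dd : distr_deriv a b u Du.
Let D : set (RT R) := `]a, b[%classic.
Let mD : measurable D. Proof. exact: measurable_itv. Qed.
Let mu : measurable_fun D (u : RT R -> R).
Proof. by case: dd => /measurable_int/measurable_EFinP. Qed.

(** These intervals exclude x, so they decrease to the empty set, whatever the mass of the point. *)
Lemma small_cvar_right x (e : R) : 0 < e ->
  exists2 d : R, 0 < d & (cvar Du `]x, (x + d)%R[%classic <= e%:E)%E.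
Proof.
move=> e0; pose F n : set (RT R) := `]x, (x + n.+1%:R^-1)[%classic.
have cv : cvar Du (F n) @[n --> \oo] --> cvar Du (\bigcap_n F n).
  apply: nonincreasing_cvg_mu => //.
  - by apply: cvar_lty; exact: measurable_itv.
  - by move=> n; exact: measurable_itv.
  - by apply: bigcap_measurableType => n _; exact: measurable_itv.
  - move=> n m nm; apply/subsetPset => t; rewrite /F/= !in_itv/= => /andP[-> h]/=.
    by rewrite (lt_le_trans h)// lerD2l lef_pV2 ?posrE// ler_nat.
have F0 : \bigcap_n F n = set0.
  apply/seteqP; split=> // t Ft; have := Ft 0%N I; rewrite /F/= in_itv/= => /andP[xt _].
  have [N _ hN] : \forall n \near \oo, n.+1%:R^-1 < t - x by apply: near_invSn; rewrite subr_gt0.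
  have := Ft N I; rewrite /F/= in_itv/= => /andP[_].
  by have := hN N (leqnn N) => /=; move: (N.+1%:R^-1) => k; lra.
rewrite F0 measure0 in cv.
have [N _ hN] := cvge_near_lt _ _ e%:E cv (ltac:(by rewrite lte_fin)).
by exists N.+1%:R^-1 => //; exact: ltW (hN N (leqnn N)).
Qed.

Lemma small_cvar_left x (e : R) : 0 < e ->
  exists2 d : R, 0 < d & (cvar Du `](x - d)%R, x[%classic <= e%:E)%E.
Proof.
move=> e0; pose F n : set (RT R) := `](x - n.+1%:R^-1), x[%classic.
have cv : cvar Du (F n) @[n --> \oo] --> cvar Du (\bigcap_n F n).
  apply: nonincreasing_cvg_mu => //.
  - by apply: cvar_lty; exact: measurable_itv.
  - by move=> n; exact: measurable_itv.
  - by apply: bigcap_measurableType => n _; exact: measurable_itv.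
  - move=> n m nm; apply/subsetPset => t; rewrite /F/= !in_itv/= => /andP[h ->]; rewrite andbT.
    by apply: le_lt_trans h; rewrite lerD2l lerN2 lef_pV2 ?posrE// ler_nat.
have F0 : \bigcap_n F n = set0.
  apply/seteqP; split=> // t Ft; have := Ft 0%N I; rewrite /F/= in_itv/= => /andP[_ tx].
  have [N _ hN] : \forall n \near \oo, n.+1%:R^-1 < x - t by apply: near_invSn; rewrite subr_gt0.
  have := Ft N I; rewrite /F/= in_itv/= => /andP[+ _].
  by have := hN N (leqnn N) => /=; move: (N.+1%:R^-1) => k; lra.
rewrite F0 measure0 in cv.
have [N _ hN] := cvge_near_lt _ _ e%:E cv (ltac:(by rewrite lte_fin)).
by exists N.+1%:R^-1 => //; exact: ltW (hN N (leqnn N)).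
Qed.

Lemma fine_chargeU (A B : set (RT R)) : measurable A -> measurable B -> A `&` B = set0 ->
  fine (Du (A `|` B)) = fine (Du A) + fine (Du B).
Proof. by move=> mA mB AB; rewrite chargeU// fineD ?fin_num_measure. Qed.

Lemma norm_fine_charge (A : set (RT R)) (e : R) : measurable A -> (cvar Du A <= e%:E)%E ->
  `|fine (Du A)| <= e.
Proof.
move=> mA h; have := le_trans (abs_charge_le_cvar Du A mA) h.
by rewrite -[Du A]fineK ?fin_num_measure// lee_fin.
Qed.


(** By the tail formula u(t) differs from [cp] by the charge of ]x, t] when t > x, and from [cm] by
    the charge of ]t, x[ when t < x. Both are small near x. The tails in [cp] and [cm] are open and
    closed at x respectively, so they differ by the charge of the point. *)
Lemma jump_limits x : a < x < b -> exists cp cm : R,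
  [/\ aplim_right u x cp, aplim_left u x cm & cp - cm = fine (Du [set x])].
Proof.
move=> /andP[ax xb]; have [C aeC] := ae_eq_tail _ _ _ _ ab dd.
exists (C - fine (Du `]x, +oo[%classic)), (C - fine (Du `[x, +oo[%classic)).
have mr r : 0 < r < b - x -> measurable_fun (`]x, (x + r)[%classic : set (RT R)) (u : RT R -> R).
  move=> /andP[r0 rb]; apply: (measurable_funS mD _ mu) => t; rewrite /D/= !in_itv/= => /andP[h1 h2].
  by apply/andP; split; lra.
have ml r : 0 < r < x - a -> measurable_fun (`](x - r), x[%classic : set (RT R)) (u : RT R -> R).
  move=> /andP[r0 rb]; apply: (measurable_funS mD _ mu) => t; rewrite /D/= !in_itv/= => /andP[h1 h2].
  by apply/andP; split; lra.
split.
- apply: (aplim_of_ae_bound u _ (fun r => `]x, (x + r)[%classic)).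
  + move=> r r0; split=> //; rewrite lebesgue_measure_itv/= lte_fin ltrDl r0 -EFinB.
    by congr (_%:E); ring.
  + by exists (b - x); [rewrite subr_gt0|exact: mr].
  move=> e e0; have [d d0 hd] := small_cvar_right x e e0.
  exists (Num.min d (b - x)); first by rewrite lt_min d0 subr_gt0.
  move=> r /andP[r0]; rewrite lt_min => /andP[rd rb].
  apply: negligibleS aeC => t /= nt ct; apply: nt; rewrite in_itv/= => /andP[xt tr].
  rewrite ct; last by apply/andP; split; lra.
  have -> : (`]x, +oo[%classic : set (RT R)) = `]x, t] `|` `]t, +oo[.
    apply/seteqP; split=> y /=; rewrite !in_itv/= !andbT.
      by move=> xy; case: (leP y t) => yt; [left; rewrite xy|right].
    by move=> [/andP[]//|]; exact: lt_trans.
  rewrite fine_chargeU//; last first.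
    apply/seteqP; split=> // y /=; rewrite !in_itv/= !andbT => -[/andP[_ yt]].
    by rewrite ltNge yt.
  rewrite (_ : _ - _ = fine (Du `]x, t]%classic)); last by rewrite /tail; ring.
  apply: norm_fine_charge => //; apply: le_trans hd; apply: le_measure; rewrite ?inE//.
  by move=> y /=; rewrite !in_itv/= => /andP[-> yt]/=; lra.
- apply: (aplim_of_ae_bound u _ (fun r => `](x - r), x[%classic)).
  + move=> r r0; split=> //; rewrite lebesgue_measure_itv/= lte_fin ltrBlDr ltrDl r0 -EFinB.
    by congr (_%:E); ring.
  + by exists (x - a); [rewrite subr_gt0|exact: ml].
  move=> e e0; have [d d0 hd] := small_cvar_left x e e0.
  exists (Num.min d (x - a)); first by rewrite lt_min d0 subr_gt0.
  move=> r /andP[r0]; rewrite lt_min => /andP[rd rb].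
  apply: negligibleS aeC => t /= nt ct; apply: nt; rewrite in_itv/= => /andP[rt tx].
  rewrite ct; last by apply/andP; split; lra.
  rewrite /tail; have -> : (`]t, +oo[%classic : set (RT R)) = `]t, x[ `|` `[x, +oo[.
    apply/seteqP; split=> y /=; rewrite !in_itv/= !andbT.
      by move=> ty; case: (ltP y x) => yx; [left; rewrite ty|right].
    by move=> [/andP[]//|]; exact: lt_le_trans.
  rewrite fine_chargeU//; last first.
    apply/seteqP; split=> // y /=; rewrite !in_itv/= !andbT => -[/andP[_ yt]].
    by rewrite leNgt yt.
  rewrite (_ : _ - _ = - fine (Du `]t, x[%classic)); last by ring.
  rewrite normrN; apply: norm_fine_charge => //; apply: le_trans hd.
  apply: le_measure; rewrite ?inE//.
  by move=> y /=; rewrite !in_itv/= => /andP[ty ->]/=; rewrite andbT; lra.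
have -> : (`[x, +oo[%classic : set (RT R)) = [set x] `|` `]x, +oo[.
  apply/seteqP; split=> y /=; rewrite !in_itv/= !andbT.
    by rewrite le_eqVlt => /orP[/eqP <-|]; [left|right].
  by move=> [->|/ltW].
rewrite fine_chargeU//; first by ring.
by apply/seteqP; split=> // y /=; rewrite in_itv/= andbT => -[->]; rewrite ltxx.
Qed.

(** Averaged one-sided limits are unique, so the number picked by [xget] in [jump] does not depend
    on the choice of a pair. *)
Lemma jump_setE x : a < x < b ->
  (jump_set a b u x <-> Du [set x] != 0%E) /\
  (jump_set a b u x -> jump u x = fine (Du [set x])).
Proof.
move=> xab; have [cp [cm [hp hm cpm]]] := jump_limits x xab; have /andP[ax xb] := xab.
have uniq p m : jump_pair u x p m -> p = cp /\ m = cm.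
  move=> [_ hp' hm']; split.
  - apply: (aplim_uniq u _ _ (fun r => `]x, (x + r)[%classic)) hp' hp.
    + move=> r r0; split=> //; rewrite lebesgue_measure_itv/= lte_fin ltrDl r0 -EFinB.
      by congr (_%:E); ring.
    + exists (b - x); first by rewrite subr_gt0.
      move=> r /andP[r0 rb]; apply: (measurable_funS mD _ mu) => t; rewrite /D/= !in_itv/= => /andP[h1 h2].
      by apply/andP; split; lra.
  - apply: (aplim_uniq u _ _ (fun r => `](x - r), x[%classic)) hm' hm.
    + move=> r r0; split=> //; rewrite lebesgue_measure_itv/= lte_fin ltrBlDr ltrDl r0 -EFinB.
      by congr (_%:E); ring.
    + exists (x - a); first by rewrite subr_gt0.
      move=> r /andP[r0 rb]; apply: (measurable_funS mD _ mu) => t; rewrite /D/= !in_itv/= => /andP[h1 h2].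
      by apply/andP; split; lra.
have f0 : (Du [set x] != 0%E) = (cp != cm).
  rewrite -(subr_eq0 cp) cpm -[in RHS]eqe fineK//; exact: fin_num_measure.
split.
  rewrite f0; split=> [[_ [p [m h]]]|h].
    by have [ep em] := uniq p m h; case: h => h _ _; rewrite -ep -em.
  by split=> //; exists cp, cm; split.
move=> [_ [p [m h]]]; rewrite /jump -cpm; case: xgetP => [d _ [p' [m' [h' ->]]]|/(_ (p - m))].
  by have [-> ->] := uniq p' m' h'.
by case; exists p, m.
Qed.

End one_sided_limits.

(** * Comparison of variations *)

Section variation.
Context {R : realType}.
Implicit Types (nu sig : chargeR R) (A B S : set (RT R)).

(** Together with [cvar_hahn], where the Hahn sets give equality, this makes the variation a maximum
    over disjoint pairs. Variations of two charges can then be compared without relating the Hahn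
    sets chosen for them. *)
Lemma cvar_ge_disjoint nu A B S : measurable A -> measurable B -> measurable S ->
  A `<=` S -> B `<=` S -> A `&` B = set0 -> (nu A - nu B <= cvar nu S)%E.
Proof.
move=> mA mB mS AS BS AB.
apply: (@le_trans _ _ (cvar nu (A `|` B))); last first.
  apply: le_measure; rewrite ?inE//; first exact: measurableU.
  by move=> x [/AS|/BS].
rewrite measureU// leeD//.
  by apply: le_trans (abs_charge_le_cvar nu A mA); exact: lee_abs.
by apply: le_trans (abs_charge_le_cvar nu B mB); rewrite -abseN; exact: lee_abs.
Qed.

Lemma cvar_hahn nu S : measurable S ->
  cvar nu S = (nu (S `&` hahn_P nu) - nu (S `&` hahn_N nu))%E.
Proof. by move=> mS; rewrite cvarE cposE// cnegE. Qed.

Lemma cvar_le_of_eq nu sig S : measurable S ->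
  (forall A, measurable A -> A `<=` S -> nu A = sig A) -> (cvar nu S <= cvar sig S)%E.
Proof.
move=> mS H; have mP := measurable_hahn_P nu; have mN := measurable_hahn_N nu.
rewrite cvar_hahn// !H; try exact: measurableI; try exact: subIsetl.
apply: cvar_ge_disjoint => //; try exact: measurableI; try exact: subIsetl.
by rewrite setIACA hahn_PIN setI0.
Qed.

Section density.
Variables (nu : chargeR R) (D : set (RT R)) (g : R -> R) (S : set (RT R)).
Hypotheses (mD : measurable D) (mS : measurable S).
Hypothesis ig : leb.-integrable D (EFin \o g).
Hypothesis H : forall A, measurable A -> A `<=` S ->
  nu A = (\int[leb]_(x in A `&` D) (g x)%:E)%E.

Let mg : measurable_fun D (g : RT R -> R).
Proof. by have /measurable_int/measurable_EFinP := ig. Qed.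

Lemma le_integral_norm_density A : measurable A ->
  (`|\int[leb]_(x in A `&` D) (g x)%:E| <= \int[leb]_(x in A `&` D) (`|g x|)%:E)%E.
Proof.
move=> mA; apply: (le_abse_integral leb) => //; first exact: measurableI.
by apply/measurable_EFinP; apply: measurable_funS mg => //; exact: subIsetr.
Qed.

Lemma cvar_le_density : (cvar nu S <= \int[leb]_(x in S `&` D) (`|g x|)%:E)%E.
Proof.
have mP := measurable_hahn_P nu; have mN := measurable_hahn_N nu.
have mSP : measurable (S `&` hahn_P nu) by exact: measurableI.
have mSN : measurable (S `&` hahn_N nu) by exact: measurableI.
rewrite cvar_hahn// !H//; try exact: subIsetl.
have -> : S `&` D = (S `&` hahn_P nu `&` D) `|` (S `&` hahn_N nu `&` D).
  by rewrite -setIUl -setIUr hahn_PUN setIT.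
rewrite ge0_integral_setU//; last 4 first.
- exact: measurableI.
- exact: measurableI.
- apply/measurable_EFinP; apply: measurableT_comp => //; apply: measurable_funS mg => //.
  by move=> x [[]|[]].
- by apply/disj_setPS => x [[[_ Px] _] [[_ Nx] _]]; have /seteqP[h _] := hahn_PIN nu; exact: h x (conj Px Nx).
rewrite leeD//.
  by apply: le_trans (le_integral_norm_density _ mSP); exact: lee_abs.
by apply: le_trans (le_integral_norm_density _ mSN); rewrite -abseN; exact: lee_abs.
Qed.

(** The sets where g is nonnegative and negative are the competing disjoint pair. The density is
    required only on subsets of S, because [gam] has one only off the null set that carries
    [Dsu]. *)
Lemma cvar_ge_density : (\int[leb]_(x in S `&` D) (`|g x|)%:E <= cvar nu S)%E.
Proof.
pose A : set (RT R) := (S `&` D) `&` [set x | 0 <= g x].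
pose B : set (RT R) := (S `&` D) `&` [set x | g x < 0].
have mSD : measurable (S `&` D) by exact: measurableI.
have mgS : measurable_fun (S `&` D) (g : RT R -> R).
  by apply: measurable_funS mg => //; exact: subIsetr.
have mA : measurable A.
  have := mgS mSD _ (measurable_itv `[0, +oo[); congr measurable.
  by apply/seteqP; split=> x [h1 h2]; split=> //; move: h2; rewrite /= in_itv/= andbT.
have mB : measurable B.
  have := mgS mSD _ (measurable_itv `]-oo, 0[); congr measurable.
have AS : A `<=` S by move=> x [[]].
have BS : B `<=` S by move=> x [[]].
have AB : A `&` B = set0.
  by apply/seteqP; split=> // x [[_ /= h1] [_ /= h2]]; move: h1; rewrite leNgt h2.
apply: le_trans (cvar_ge_disjoint nu A B S mA mB mS AS BS AB).
have AD : A `&` D = A by apply/setIidl => x [[]].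
have BD : B `&` D = B by apply/setIidl => x [[]].
rewrite !H// AD BD.
have -> : S `&` D = A `|` B.
  rewrite /A /B -setIUr; apply/esym/setIidl => x _ /=.
  by case: (leP 0 (g x)) => h; [left|right].
rewrite ge0_integral_setU//; last 2 first.
- apply/measurable_EFinP; apply: measurableT_comp => //; apply: measurable_funS mg => //.
  by move=> x [[[]]|[[]]].
- exact/disj_set2P.
have eA : (\int[leb]_(x in A) (`|g x|)%:E = \int[leb]_(x in A) (g x)%:E)%E.
  by apply: eq_integral => x; rewrite inE => -[_ /= gx]; rewrite ger0_norm.
have eB : (\int[leb]_(x in B) (`|g x|)%:E = - \int[leb]_(x in B) (g x)%:E)%E.
  have -> : (\int[leb]_(x in B) (g x)%:E = \int[leb]_(x in B) (- (`|g x|)%:E))%E.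
    by apply: eq_integral => x; rewrite inE => -[_ /= gx]; rewrite ltr0_norm//= opprK.
  by rewrite integral_ge0N ?oppeK// => x _; rewrite lee_fin.
by rewrite eA eB.
Qed.

End density.

Lemma cvar_set1 nu (x : R) : cvar nu [set x] = `|nu [set x]|%E.
Proof.
apply/eqP; rewrite eq_le abs_charge_le_cvar// andbT cvar_hahn//.
have /seteqP[_ /(_ x Logic.I)] := hahn_PUN nu; have /seteqP[/(_ x) PN _] := hahn_PIN nu => -[Px|Nx].
  rewrite (_ : _ `&` hahn_P nu = [set x]); last by apply/setIidl => y ->.
  rewrite (_ : _ `&` hahn_N nu = set0); last by apply/seteqP; split=> // y [-> Nx]; exact: PN.
  by rewrite charge0 sube0 lee_abs.
rewrite (_ : _ `&` hahn_N nu = [set x]); last by apply/setIidl => y ->.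
rewrite (_ : _ `&` hahn_P nu = set0); last by apply/seteqP; split=> // y [-> Px]; exact: PN.
by rewrite charge0 add0e -abseN lee_abs.
Qed.

End variation.

(** * The weight in the limit of vanishing windows *)

Section concentration_limit.
Context {R : realType}.
Variable m : {finite_measure set (RT R) -> \bar R}.

Definition atom (y : R) : R := fine (m [set y]).

Lemma atomE y : m [set y] = (atom y)%:E.
Proof. by rewrite /atom fineK// fin_num_measure. Qed.

Lemma atom_ge0 y : 0 <= atom y.
Proof. exact: fine_ge0. Qed.

Lemma cvg_mass_atom (k : R) y : 0 < k -> mass m (k * n.+1%:R^-1) y @[n --> \oo] --> atom y.
Proof.
move=> k0; pose F n := win (k * n.+1%:R^-1) y.
have cv : m (F n) @[n --> \oo] --> m (\bigcap_n F n).
  apply: nonincreasing_cvg_mu => //.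
  - by rewrite -ge0_fin_numE// fin_num_measure//; exact: measurable_win.
  - by move=> n; exact: measurable_win.
  - by apply: bigcap_measurableType => n _; exact: measurable_win.
  - move=> n p np; apply/subsetPset => t; rewrite /F !winE => h; apply: lt_le_trans h _.
    by rewrite ler_wpM2l ?(ltW k0)// lef_pV2 ?posrE// ler_nat.
have F1 : \bigcap_n F n = [set y].
  apply/seteqP; split=> t; last first.
    by move=> -> n _; apply/winE; rewrite subrr normr0 mulr_gt0.
  move=> Ft; apply/eqP/negP => /negP ty.
  have d0 : 0 < `|y - t| / k by rewrite divr_gt0// normr_gt0 subr_eq0 eq_sym.
  have [N _ hN] : \forall n \near \oo, n.+1%:R^-1 < `|y - t| / k by apply: near_invSn.
  have := Ft N I; rewrite /F => /winE; have := hN N (leqnn N).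
  by rewrite /= ltr_pdivlMr// mulrC => h1 h2; have := lt_trans h1 h2; rewrite ltxx.
by rewrite F1 atomE in cv; apply: fine_cvg cv.
Qed.

Lemma measurable_atom (D : set (RT R)) : measurable_fun D (atom : RT R -> R).
Proof.
apply: (@measurable_fun_cvg _ (RT R) R D (fun n y => mass m (1 * n.+1%:R^-1) y)).
  by move=> n; exact: measurable_mass.
by move=> y _; exact: cvg_mass_atom.
Qed.

(** The limit of [tau] as the windows shrink to y; it equals 1 at every y that is not an atom. *)
Definition tau0 (y : R) : R := 2 / Num.max 2 (atom y).

Lemma max2_gt0 (x : R) : 0 < Num.max 2 x.
Proof. by rewrite lt_max ltr0n. Qed.

Lemma tau0_ge0 y : 0 <= tau0 y.
Proof. by rewrite divr_ge0// ltW// max2_gt0. Qed.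

Lemma measurable_tau0 (D : set (RT R)) : measurable_fun D (tau0 : RT R -> R).
Proof.
apply: measurable_funM => //; apply: (@measurable_funTS _ _ _ _ D).
have -> : (fun x => (Num.max 2 (atom x))^-1) = (fun x => (Num.max 2 (atom x)) `^ (-1)).
  by apply/funext => x; rewrite -powR_inv1// ltW// max2_gt0.
apply: (@measurableT_comp _ _ _ _ _ _ (fun y : R => y `^ (-1)) _ (fun x : RT R => Num.max 2 (atom x))).
  exact: measurable_powR.
by apply: measurable_maxr => //; exact: measurable_atom.
Qed.

(** As h decreases the windows shrink, so the weights increase, and the intervals of integration
    grow: monotone convergence along h = 1/(n+1). *)
Lemma integral_tau0_le (a b : R) (Z : \bar R) :
  (forall h : R, 0 < h -> (\int[m]_(y in `](a + 3 * h)%R, (b - 3 * h)%R[) (tau m (2 * h) y)%:E <= Z)%E) ->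
  (\int[m]_(y in `]a, b[) (tau0 y)%:E <= Z)%E.
Proof.
move=> H; pose D : set (RT R) := `]a, b[%classic; have mD : measurable D by exact: measurable_itv.
pose h n : R := n.+1%:R^-1.
have h0 n : 0 < h n by rewrite invr_gt0.
pose Y n : set (RT R) := `](a + 3 * h n), (b - 3 * h n)[%classic.
have mY n : measurable (Y n) by exact: measurable_itv.
pose f n (y : RT R) : \bar R := ((tau m (2 * h n) y * \1_(Y n) y)%R)%:E.
have mf n : measurable_fun D (f n).
  by apply/measurable_EFinP; apply: measurable_funM; [exact: measurable_tau|exact: measurable_indic].
have f0 n y : D y -> (0 <= f n y)%E by rewrite lee_fin mulr_ge0// tau_ge0.
have YD n : Y n `<=` D.
  by move=> y; rewrite /Y/D/= !in_itv/= => /andP[? ?]; have := h0 n => ?; apply/andP; split; lra.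
have hle n p : (n <= p)%N -> h p <= h n by move=> np; rewrite lef_pV2 ?posrE// ler_nat.
have nd y : D y -> {homo f^~ y : n p / (n <= p)%N >-> (n <= p)%E}.
  move=> Dy n p np; rewrite lee_fin; apply: ler_pM; rewrite ?tau_ge0//.
    by apply: tau_le; rewrite subrr normr0 subr_ge0 ler_wpM2l// hle.
  rewrite !indicE; case: (boolP (y \in Y n)) => // yn; rewrite mem_set//=.
  move: yn; rewrite inE /Y/= !in_itv/= => /andP[? ?]; have := hle _ _ np => ?.
  by apply/andP; split; lra.
have fc y : D y -> f n y @[n --> \oo] --> (tau0 y)%:E.
  rewrite /D/= in_itv/= => /andP[ay yb].
  apply: cvg_EFin; first exact: nearW.
  have -> : tau0 y = tau0 y * 1 by rewrite mulr1.
  apply: (@cvgM _ _ _ _ (fun n => tau m (2 * h n) y) (fun n => \1_(Y n) y)).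
    apply: cvgM; first exact: cvg_cst.
    apply: cvgV; first by rewrite gt_eqF// max2_gt0.
    apply: (@cvg_comp _ _ _ (fun n => mass m (2 * h n) y) (fun z : R => Num.max 2 z)).
      exact: cvg_mass_atom.
    by apply: (@continuous_max _ _ (cst 2) (@id R)) => //; exact: cvg_cst.
  apply: cvg_near_cst; near=> n; rewrite indicE mem_set// /Y/= in_itv/=.
  have h1 : h n < (y - a) / 3 by near: n; apply: near_invSn; rewrite divr_gt0// subr_gt0.
  have h2 : h n < (b - y) / 3 by near: n; apply: near_invSn; rewrite divr_gt0// subr_gt0.
  by apply/andP; split; lra.
have := @cvg_monotone_convergence _ (RT R) R m D mD f mf f0 nd.
have -> : (\int[m]_(x in D) limn (f^~ x) = \int[m]_(y in D) (tau0 y)%:E)%E.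
  by apply: eq_integral => y; rewrite inE => /fc /cvg_lim ->.
move=> cv; rewrite -(cvg_lim (@ereal_hausdorff R) cv); apply: lime_le; first exact: cvgP cv.
apply: nearW => n; apply: le_trans (H (h n) (h0 n)).
rewrite [leRHS](_ : _ = \int[m]_(y in Y n) (tau m (2 * h n) y)%:E)%E//.
rewrite -(setIidr (YD n)) integral_mkcondr le_eqVlt; apply/orP; left; apply/eqP.
apply: eq_integral => y _; rewrite patchE /f indicE.
by case: (y \in Y n); rewrite ?mulr1 ?mulr0.
Unshelve. all: by end_near. Qed.

End concentration_limit.

(** * The limit energy in terms of |gam| *)

Section limit_energy.
Context {R : realType}.
Variables (a b c0 K : R) (u : R -> R) (gam Du : chargeR R) (u' : R -> R)
  (Dsu : chargeR R) (g : R -> R).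
Hypotheses (ab : a < b) (c00 : 0 < c0) (adm : E_adm a b K u gam Du u' Dsu g).

Let D : set (RT R) := `]a, b[%classic.
Let mD : measurable D. Proof. exact: measurable_itv. Qed.

Lemma integral_set1I (f : R -> R) (x : R) (E : set (RT R)) :
  (\int[leb]_(t in [set x] `&` E) (f t)%:E)%E = 0%E.
Proof. by apply: integral_Sset1; exact: subIsetl. Qed.

Lemma Du_set1 x : Du [set x] = gam [set x].
Proof.
have [_ _ [_ _ _ H] [_ _ H'] _] := adm.
by rewrite H// H'// !integral_set1I add0e adde0.
Qed.

(** Points are Lebesgue null, so [Du] and [gam] have the same atoms. This also makes the jump set
    Borel, as a level set of the measurable function [atom]. *)
Lemma jump_setP x : jump_set a b u x <-> D x /\ cvar gam [set x] != 0%E.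
Proof.
have [dd _ _ _ _] := adm; rewrite cvar_set1 abse_eq0 -Du_set1.
split=> [Jx|[Dx h]].
  have xab : a < x < b by case: Jx.
  by split; [rewrite /D/= in_itv|apply/((jump_setE _ _ _ _ ab dd x xab).1)].
have xab : a < x < b by move: Dx; rewrite /D/= in_itv.
exact/((jump_setE _ _ _ _ ab dd x xab).1).
Qed.

Lemma norm_jump x : jump_set a b u x -> `|jump u x| = atom (cvar gam) x.
Proof.
move=> Jx; have [dd _ _ _ _] := adm.
have xab : a < x < b by case: Jx.
rewrite ((jump_setE _ _ _ _ ab dd x xab).2 Jx) Du_set1.
have -> : atom (cvar gam) x = fine `|gam [set x]|%E by rewrite -cvar_set1.
by rewrite fine_abse// fin_num_measure.
Qed.

Let J : set (RT R) := jump_set a b u.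

Lemma measurable_jump_set : measurable J.
Proof.
have := measurable_atom (cvar gam) D mD _ (measurable_itv `]0, +oo[); congr measurable.
apply/seteqP; split=> x.
  move=> [Dx]; rewrite /= in_itv/= andbT => h; apply/jump_setP; split=> //.
  by rewrite atomE eqe gt_eqF.
move=> /jump_setP[Dx h]; split=> //; rewrite /= in_itv/= andbT.
by rewrite lt_neqAle atom_ge0 eq_sym andbT -eqe -atomE.
Qed.

Lemma tau0M (x : R) : tau0 (cvar gam) x * atom (cvar gam) x = Num.min (atom (cvar gam) x) 2.
Proof.
rewrite /tau0; have := atom_ge0 (cvar gam) x; case: (leP 2 (atom (cvar gam) x)) => h A0.
  by rewrite mulfVK// gt_eqF//; apply: lt_le_trans h.
by rewrite divff// mul1r.
Qed.

(** At a jump, 2 f(|[u]|/2) = c0 min(|[u]|, 2), which is c0 times the integral of the weight over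
    that point. A finite sum of such terms is an integral over a finite subset of the jump set. *)
Lemma sum_jump_le :
  (2%:E * (\esum_(x in J) (fD c0 (`|jump u x| / 2)%R)%:E) <=
   c0%:E * \int[cvar gam]_(y in J) (tau0 (cvar gam) y)%:E)%E.
Proof.
have mJ := measurable_jump_set.
have mt A : measurable_fun A (fun y : RT R => (tau0 (cvar gam) y)%:E).
  by apply/measurable_EFinP; exact: measurable_tau0.
have t0 (y : RT R) : (0 <= (tau0 (cvar gam) y)%:E)%E by rewrite lee_fin tau0_ge0.
have fD0 x : J x -> 2 * fD c0 (`|jump u x| / 2) = c0 * (tau0 (cvar gam) x * atom (cvar gam) x).
  move=> Jx; rewrite norm_jump// tau0M /fD mulrCA; congr (_ * _).
  by move: (atom _ x) => z; case: (leP (z / 2) 1); case: (leP z 2); lra.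
suff hF (F : {fset R}) : [set` F] `<=` J ->
    ((\sum_(x <- F) (fD c0 (`|jump u x| / 2)%R)%:E) <=
     (c0 / 2)%:E * \int[cvar gam]_(y in J) (tau0 (cvar gam) y)%:E)%E.
  have le1 : ((\esum_(x in J) (fD c0 (`|jump u x| / 2)%R)%:E) <=
     (c0 / 2)%:E * \int[cvar gam]_(y in J) (tau0 (cvar gam) y)%:E)%E.
    apply: ge_ereal_sup => _ [F [Ffin FJ] <-].
    rewrite fsbig_finite//=; apply: hF.
    by move=> x /=; rewrite in_fset_set// inE => /FJ.
  apply: le_trans (lee_wpmul2l _ le1) _ => //.
  by rewrite muleA -EFinM mulrC mulfVK.
move=> FJ.
have -> : ((\sum_(x <- F) (fD c0 (`|jump u x| / 2)%R)%:E) =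
    (c0 / 2)%:E * \sum_(x <- F) \int[cvar gam]_(y in [set x]) (tau0 (cvar gam) y)%:E)%E.
  rewrite ge0_sume_distrr; last by move=> x _; exact: integral_ge0.
  apply: eq_big_seq => x xF; have Jx : J x by apply: FJ.
  have -> : (\int[cvar gam]_(y in [set x]) (tau0 (cvar gam) y)%:E =
      (tau0 (cvar gam) x * atom (cvar gam) x)%:E)%E.
    rewrite (eq_integral (cst (tau0 (cvar gam) x)%:E)); last by move=> y; rewrite inE => ->.
    by rewrite integral_cst// [RHS]EFinM -atomE.
  by rewrite -EFinM; congr (_%:E); rewrite mulrAC -(fD0 x Jx) mulrAC divff ?mul1r.
rewrite lee_wpmul2l//; first by rewrite lee_fin divr_ge0// ltW.
have -> : ((\sum_(x <- F) \int[cvar gam]_(y in [set x]) (tau0 (cvar gam) y)%:E) =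
   \int[cvar gam]_(y in \big[setU/set0]_(x <- F) ([set x] : set (RT R))) (tau0 (cvar gam) y)%:E)%E.
  rewrite ge0_integral_bigsetU//.
  by apply/trivIsetP => x y _ _ /eqP xy; apply/seteqP; split=> // z [-> ].
apply: ge0_subset_integral => //.
- by apply: bigsetU_measurable.
- by rewrite -bigcup_seq => x [y /= yF ->]; exact: FJ.
Qed.

(** A null set N carries [Dsu]: inside N the charge [gam] coincides with [Dsu], outside N it has
    density g. The jump set lies in N, since [Dsu] has no atom outside it, so removing it does not
    change the integral of |g|. *)
Lemma diffuse_le :
  (\int[leb]_(x in D) (`|g x|)%:E + cvar Dsu (D `\` J) <= cvar gam (D `\` J))%E.
Proof.
have mJ := measurable_jump_set.
have [_ _ [_ _ [N [mN N0 DN]] _] [ig _ H'] _] := adm.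
set S := D `\` J; have mS : measurable S by exact: measurableD.
have mSN : measurable (S `&` N) by exact: measurableI.
have mSC : measurable (S `\` N) by exact: measurableD.
have split_ (nu : chargeR R) : cvar nu S = (cvar nu (S `&` N) + cvar nu (S `\` N))%E.
  rewrite -measureU//; first by rewrite setUIDK.
  by apply/seteqP; split=> // x [[_ Nx] [_]].
have Dsu0 A : measurable A -> A `<=` ~` N -> Dsu A = 0%E.
  move=> mA AN; apply/eqP; rewrite -abse_eq0 eq_le abse_ge0 andbT -DN.
  apply: le_trans (abs_charge_le_cvar Dsu A mA) _; apply: le_measure; rewrite ?inE//.
  exact: measurableC.
have JN : J `<=` N.
  move=> x /jump_setP[_ h]; apply: contrapT => Nx; move/negP: h; apply.
  by rewrite cvar_set1 abse_eq0 H'// integral_set1I adde0 Dsu0// => _ ->.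
have gamN A : measurable A -> A `<=` S `&` N -> Dsu A = gam A.
  move=> mA AN; rewrite H'// (_ : (\int[leb]_(x in A `&` `]a, b[) (g x)%:E)%E = 0%E) ?adde0//.
  apply: null_set_integral; first exact: measurableI.
    by have /measurable_int := ig; apply: measurable_funS => //; exact: subIsetr.
  apply/eqP; rewrite eq_le measure_ge0 andbT -N0; apply: le_measure; rewrite ?inE//.
    exact: measurableI.
  by move=> x [/AN[]].
have gamC A : measurable A -> A `<=` S `\` N -> gam A = (\int[leb]_(x in A `&` D) (g x)%:E)%E.
  by move=> mA AN; rewrite H'// Dsu0 ?add0e// => x /AN[].
rewrite (split_ gam) addeC; apply: leeD.
  rewrite (split_ Dsu) (_ : cvar Dsu (S `\` N) = 0%E) ?adde0.
    exact: cvar_le_of_eq.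
  apply/eqP; rewrite eq_le measure_ge0 andbT -DN; apply: le_measure; rewrite ?inE//.
  exact: measurableC.
apply: le_trans (cvar_ge_density gam D g (S `\` N) mD mSC ig gamC).
have -> : (S `\` N) `&` D = D `\` N.
  apply/seteqP; split=> x; first by move=> [[_ Nx] Dx]; split.
  by move=> [Dx Nx]; split=> //; split=> //; split=> // /JN.
rewrite (ge0_negligible_integral mN mD)//.
by apply/measurable_EFinP; apply: measurableT_comp => //; have /measurable_int/measurable_EFinP := ig.
Qed.

(** Off the jump set there are no atoms and the weight is 1, which leaves the diffuse mass there; on
    the jump set the weight produces the truncated jumps. *)
Lemma E_val_le :
  (E_val a b c0 u u' Dsu g <= \int[leb]_(x in D) ((u' x - g x) ^+ 2)%:E +
     c0%:E * \int[cvar gam]_(y in D) (tau0 (cvar gam) y)%:E)%E.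
Proof.
have mJ := measurable_jump_set.
have mt A : measurable_fun A (fun y : RT R => (tau0 (cvar gam) y)%:E).
  by apply/measurable_EFinP; exact: measurable_tau0.
have t0 (y : RT R) : (0 <= (tau0 (cvar gam) y)%:E)%E by rewrite lee_fin tau0_ge0.
have JD : J `<=` D by move=> x /jump_setP[].
have mS : measurable (D `\` J) by exact: measurableD.
have aux (x p q r s : \bar R) : (p + q + r <= s -> x + p + q + r <= x + s)%E.
  by move=> h; rewrite -!addeA leeD2l// addeA.
rewrite /E_val; apply: aux.
have -> : (\int[cvar gam]_(y in D) (tau0 (cvar gam) y)%:E = cvar gam (D `\` J) +
    \int[cvar gam]_(y in J) (tau0 (cvar gam) y)%:E)%E.
  rewrite -[in LHS](setDUK JD) setUC ge0_integral_setU//; last first.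
    by apply/disj_set2P; rewrite setIC setDIK.
  congr (_ + _)%E; rewrite (eq_integral (cst 1%E)); last first.
    move=> y; rewrite inE => -[Dy Jy]; rewrite /tau0 (_ : atom (cvar gam) y = 0).
      by rewrite max_l// divff.
    apply/eqP; apply: contra_notT Jy => h; apply/jump_setP; split=> //.
    by rewrite atomE eqe.
  by rewrite integral_cst// mul1e.
have c00' : (0 <= c0%:E)%E by rewrite lee_fin ltW.
have aux2 (x y z p q : \bar R) : (0 <= x -> 0 <= y -> 0 <= p -> 0 <= q -> c0%:E * x + c0%:E * y <= c0%:E * p ->
    z <= c0%:E * q -> c0%:E * x + z + c0%:E * y <= c0%:E * (p + q))%E.
  by move=> x0 y0 p0 q0 h1 h2; rewrite addeAC ge0_muleDr// leeD.
apply: aux2 => //; [exact: integral_ge0|exact: integral_ge0| |exact: sum_jump_le].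
have := lee_wpmul2l c00' diffuse_le; rewrite ge0_muleDr//; exact: integral_ge0.
Qed.

End limit_energy.

(** * Lower bound for the nonlocal term at scale e *)

Section approximate_energy.
Context {R : realType}.

(** The integral of a nonnegative function is a supremum over simple functions below it, hence
    monotone without measurability. The measurability of [avg_abs] in x therefore need not be
    established. *)
Lemma ge0_le_integral_nomeas (m : {measure set (RT R) -> \bar R}) (D : set (RT R))
    (f g : RT R -> \bar R) : (forall x, D x -> (0 <= f x)%E) ->
  (forall x, D x -> (f x <= g x)%E) -> (\int[m]_(x in D) f x <= \int[m]_(x in D) g x)%E.
Proof.
move=> f0 fg.
have g0 x : D x -> (0 <= g x)%E by move=> Dx; apply: le_trans (fg _ Dx); exact: f0.
rewrite !ge0_integralE//; apply: ereal_sup_le => _ [h hf <-] /=.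
by exists h => // x; apply: le_trans (hf x) _; apply: lee_restrict.
Qed.

(** The part of a window inside (a, b) has length at most 2e, so e times the average is at least
    half the mass; near the ends it can only be larger. Then min(m/2, 1) = min(m, 2)/2. *)
Lemma second_term_ge (a b c0 K e : R) (u : R -> R) (gam : chargeR R) (u' g : R -> R) :
  a < b -> 0 < c0 -> 0 < e -> Eeps_adm a b K u gam u' g ->
  ((c0 / (2 * e))%:E * \int[leb]_(z in `]a, b[) (Num.min (mass (cvar gam) e z) 2)%:E <=
   (e^-1)%:E * \int[leb]_(x in `]a, b[) (fD c0 (e * avg_abs a b e g x)%R)%:E)%E.
Proof.
move=> ab c00 e0 [_ _ ig H _].
have -> : (c0 / (2 * e))%:E = ((e^-1)%:E * (c0 / 2)%:E)%E.
  by rewrite -EFinM; congr (_%:E); field; rewrite gt_eqF.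
rewrite -muleA; apply: lee_wpmul2l; first by rewrite lee_fin invr_ge0 ltW.
rewrite -ge0_integralZl_EFin//; last 3 first.
- by move=> z _; rewrite lee_fin min_mass_ge0.
- exact: measurable_min_mass.
- by rewrite divr_ge0// ltW.
apply: ge0_le_integral_nomeas => [z _|z].
  by rewrite -EFinM lee_fin mulr_ge0 ?min_mass_ge0// divr_ge0// ltW.
rewrite /= in_itv/= => /andP[az zb].
have mD : measurable (`]a, b[%classic : set (RT R)) by exact: measurable_itv.
have mw := measurable_win e z.
have mg : measurable_fun (win e z `&` `]a, b[) (fun x : RT R => (`|g x|)%:E).
  apply/measurable_EFinP; apply: measurableT_comp => //.
  have /measurable_int/measurable_EFinP := ig; apply: measurable_funS => //; exact: subIsetr.
set I := fine (\int[leb]_(t in win e z `&` `]a, b[) (`|g t|)%:E)%E.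
have Ifin : (\int[leb]_(t in win e z `&` `]a, b[) (`|g t|)%:E)%E \is a fin_num.
  have ig' : leb.-integrable (win e z `&` `]a, b[) (EFin \o (fun x => `|g x|)).
    apply: (integrableS mD); [exact: measurableI|exact: subIsetr|].
    exact: (integrable_norm ig).
  apply: integrable_fin_num => //; exact: measurableI.
have MI : mass (cvar gam) e z <= I.
  apply: fine_le => //; first exact: fin_num_measure.
  by apply: cvar_le_density => // A mA _; exact: H.
have I0 : 0 <= I by apply: fine_ge0; exact: integral_ge0.
set L := fine (leb (win e z `&` `]a, b[)).
have lebL : (leb (win e z `&` `]a, b[) <= (2 * e)%:E)%E by rewrite setIC; apply: leb_itvI_win; exact: ltW.
have L2 : L <= 2 * e.
  rewrite -lee_fin /L fineK// ge0_fin_numE// (le_lt_trans lebL) ?ltry//.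
(* Positivity matters: division by a zero length would give the average 0 by convention. *)
have L0 : 0 < L.
  have sub : (`](Num.max a (z - e)), (Num.min b (z + e))[%classic : set (RT R)) = win e z `&` `]a, b[.
    apply/seteqP; split=> x; rewrite /win/= !in_itv/= gt_max lt_min.
      by move=> /andP[/andP[-> ->] /andP[-> ->]].
    by move=> [/andP[-> ->] /andP[-> ->]].
  rewrite /L -sub lebesgue_measure_itv/= lte_fin.
  have hlt : Num.max a (z - e) < Num.min b (z + e).
    have h1 : a < z + e by apply: lt_trans az _; rewrite ltrDl.
    have h2 : z - e < b by apply: lt_trans zb; rewrite gtrBl.
    have h3 : z - e < z + e by apply: (@lt_trans _ _ z); rewrite ?gtrBl ?ltrDl.
    by rewrite gt_max !lt_min ab h1 h2 h3.
  by rewrite hlt -EFinB/= subr_gt0.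
rewrite -EFinM lee_fin /fD /avg_abs -/(win e z) -/I -/L.
have h1 : mass (cvar gam) e z / 2 <= e * (I / L).
  apply: (@le_trans _ _ (I / 2)); first by rewrite ler_pM2r.
  rewrite mulrCA ler_wpM2l// ler_pdivlMr// mulrC ler_pdivrMr// mulrC; lra.
rewrite -mulrA ler_pM2l//.
move: h1; move: (e * (I / L)) (mass (cvar gam) e z) => x y h1.
by case: (leP y 2) => ?; case: (leP x 1) => ?; lra.
Qed.

End approximate_energy.

(** * Passage to the limit along a sequence of bounded energy *)

Section sequence.
Context {R : realType}.
Variables (a b c0 K t : R) (u : R -> R) (gam Du : chargeR R) (u' : R -> R)
  (Dsu : chargeR R) (g : R -> R).
Hypotheses (ab : a < b) (c00 : 0 < c0) (adm : E_adm a b K u gam Du u' Dsu g).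
Variables (e : nat -> R) (uk : nat -> R -> R) (gamk : nat -> chargeR R)
  (uk' gk : nat -> R -> R).
Hypotheses (e0 : forall k, 0 < e k) (ecv : e k @[k --> \oo] --> 0).
Hypothesis admk : forall k, Eeps_adm a b K (uk k) (gamk k) (uk' k) (gk k).
Hypothesis L1 : (\int[leb]_(x in `]a, b[) (`|uk k x - u x|)%:E)%E @[k --> \oo] --> 0%E.
Hypothesis flat : flat_dist a b (gamk k) gam @[k --> \oo] --> 0%E.
Hypothesis bound : forall k, (Eeps_val a b c0 (e k) (uk' k) (gk k) <= t%:E)%E.

Let D : set (RT R) := `]a, b[%classic.
Let mD : measurable D. Proof. exact: measurable_itv. Qed.

Lemma rint_scale (nu : chargeR R) (k : R) phi : @bounded_measurable _ (RT R) R phi ->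
  rint nu (fun x => k * phi x) = k * rint nu phi.
Proof.
move=> bp; rewrite /rint !RintegralZl//; try exact: bounded_measurable_integrable.
by rewrite mulrBr.
Qed.

(** Divided by its bound M, the test function lies in the unit ball of the flat norm. The distance
    is a supremum of signed differences, so it is used with both signs of phi. *)
Lemma cvg_rint_gamk phi : test_fun a b phi -> rint (gamk k) phi @[k --> \oo] --> rint gam phi.
Proof.
move=> tphi; have bp := test_fun_bounded_measurable _ _ _ ab tphi.
have [M M0 [hM _ lM hout]] := test_fun_bounds _ _ _ ab tphi.
have key (s : R) k : `|s| = 1 -> ((s * (rint (gamk k) phi - rint gam phi))%:E <=
    M%:E * flat_dist a b (gamk k) gam)%E.
  move=> s1; pose psi x := (s / M) * phi x.
  have nsM : `|s / M| = M^-1 by rewrite normrM s1 mul1r normfV gtr0_norm.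
  have Wpsi : W1inf0_ball a b psi.
    split=> [x /hout|x|x y]; rewrite /psi.
    - by move=> ->; rewrite mulr0.
    - by rewrite normrM nsM ler_pdivrMl// mulr1.
    - by rewrite -mulrBr normrM nsM ler_pdivrMl.
  have : (cint (gamk k) psi - cint gam psi <= flat_dist a b (gamk k) gam)%E.
    by apply: ereal_sup_ubound; exists psi.
  rewrite !cint_rint; try exact: bounded_measurable_scale.
  rewrite !rint_scale// -EFinB -mulrBr.
  move=> h; have := lee_wpmul2l (_ : (0 <= M%:E)%E) h.
  rewrite lee_fin ltW// => /(_ isT); apply: le_trans.
  by rewrite -EFinM lee_fin mulrA (mulrC M) mulfVK// gt_eqF.
apply/cvgrPdist_le => eta eta0.
have := cvge_near_lt _ _ (eta / M)%:E flat; rewrite lte_fin divr_gt0// => /(_ isT) hd.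
near=> k; have hk : (flat_dist a b (gamk k) gam < (eta / M)%:E)%E by near: k.
have le1 (s : R) : `|s| = 1 -> s * (rint (gamk k) phi - rint gam phi) <= eta.
  move=> s1; rewrite -lee_fin; apply: le_trans (key s k s1) _.
  apply: le_trans (lee_wpmul2l _ (ltW hk)) _; first by rewrite lee_fin ltW.
  by rewrite -EFinM lee_fin mulrC mulfVK// gt_eqF.
have l1 := le1 1 (normr1 _); have l2 := le1 (-1) (normrN1 _).
by rewrite distrC ler_norml; apply/andP; split; lra.
Unshelve. all: by end_near. Qed.

Definition vk k x : R := uk' k x - gk k x.
Definition v x : R := u' x - g x.

Lemma integrable_mul_bounded (f phi : R -> R) : leb.-integrable D (EFin \o f) ->
  @bounded_measurable _ (RT R) R phi -> leb.-integrable D (EFin \o (fun x => f x * phi x)).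
Proof. by move=> fi bp; exact: bounded_measurable_integrableM. Qed.

Lemma derive1_bounded_measurable phi : test_fun a b phi ->
  @bounded_measurable _ (RT R) R (derive1 phi).
Proof.
move=> tphi; have [M _ [_ hM _ _]] := test_fun_bounds _ _ _ ab tphi.
split; last by exists M.
by apply: continuous_measurable_fun; case: tphi.
Qed.

Lemma cvg_uk_dphi phi : test_fun a b phi ->
  (\int[leb]_(x in D) (uk k x * derive1 phi x))%R @[k --> \oo] -->
  (\int[leb]_(x in D) (u x * derive1 phi x))%R.
Proof.
move=> tphi; have [M M0 [_ hM _ _]] := test_fun_bounds _ _ _ ab tphi.
have bd := derive1_bounded_measurable _ tphi; have [mdp _] := bd.
have iu : leb.-integrable D (EFin \o u) by case: adm => -[].
have iuk k : leb.-integrable D (EFin \o uk k) by case: (admk k) => -[].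
apply/cvgrPdist_le => eta eta0.
have := cvge_near_lt _ _ (eta / M)%:E L1; rewrite lte_fin divr_gt0// => /(_ isT) hd.
near=> k.
have hk : (\int[leb]_(x in `]a, b[) (`|uk k x - u x|)%:E < (eta / M)%:E)%E by near: k.
rewrite distrC -RintegralB//; try exact: integrable_mul_bounded.
have idf : leb.-integrable D (EFin \o (fun x => uk k x - u x)).
  by have := integrableB mD (iuk k) iu; apply: eq_integrable.
have mdf : measurable_fun D ((fun x => uk k x - u x) : RT R -> R) by have /measurable_int/measurable_EFinP := idf.
have -> : (\int[leb]_(x in D) (uk k x * derive1 phi x - u x * derive1 phi x))%R =
    (\int[leb]_(x in D) ((uk k x - u x) * derive1 phi x))%R.
  by apply: eq_Rintegral => x _; rewrite mulrBl.
rewrite -lee_fin EFin_normr_Rintegral//; last exact: integrable_mul_bounded.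
apply: le_trans (le_abse_integral _ _ _) _ => //.
  by apply/measurable_EFinP; apply: measurable_funM => //; exact: measurable_funTS.
apply: (@le_trans _ _ (M%:E * \int[leb]_(x in D) (`|uk k x - u x|)%:E)%E); last first.
  apply: le_trans (lee_wpmul2l _ (ltW hk)) _; first by rewrite lee_fin ltW.
  by rewrite -EFinM lee_fin mulrC mulfVK// gt_eqF.
rewrite -ge0_integralZl_EFin//; last 2 first.
- by apply/measurable_EFinP; apply: measurableT_comp.
- exact: ltW.
apply: ge0_le_integral => //.
- apply: measurableT_comp => //; apply/measurable_EFinP; apply: measurable_funM => //; exact: measurable_funTS.
- by apply: measurable_funeM; apply/measurable_EFinP; apply: measurableT_comp.
by move=> x _; rewrite -EFinM lee_fin normrM mulrC ler_wpM2r.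
Unshelve. all: by end_near. Qed.

Lemma EFin_Rintegral (f : R -> R) : leb.-integrable D (EFin \o f) ->
  (\int[leb]_(x in D) (f x)%:E)%E = (\int[leb]_(x in D) f x)%R%:E.
Proof. by move=> fi; rewrite /Rintegral fineK//; exact: integrable_fin_num. Qed.

Lemma integrable_v : leb.-integrable D (EFin \o v).
Proof.
have [_ _ [iu' _ _ _] [ig _ _] _] := adm.
by have := integrableB mD iu' ig; apply: eq_integrable.
Qed.

Lemma integrable_vk k : leb.-integrable D (EFin \o vk k).
Proof.
have [[_ iu' _] _ ig _ _] := admk k.
by have := integrableB mD iu' ig; apply: eq_integrable.
Qed.

(** As distributions, [vk k] is the derivative of [uk k] minus [gamk k], and [v] is [Du] minus
    [gam]. Integration by parts leaves only the L1 and flat convergences, so neither the derivatives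
    nor the densities have to converge separately. *)
Lemma cvg_vk phi : test_fun a b phi ->
  (\int[leb]_(x in D) (vk k x * phi x))%R @[k --> \oo] --> (\int[leb]_(x in D) (v x * phi x))%R.
Proof.
move=> tphi; have bp := test_fun_bounded_measurable _ _ _ ab tphi.
have bd := derive1_bounded_measurable _ tphi.
have [[iu cDu dDu] _ [iu' _ _ HDu] [ig _ Hgam] _] := adm.
have E k : (\int[leb]_(x in D) (vk k x * phi x))%R =
    - (\int[leb]_(x in D) (uk k x * derive1 phi x))%R - rint (gamk k) phi.
  have [[iuk iuk' wd] _ igk Hk _] := admk k.
  have := wd phi tphi; rewrite EFin_Rintegral; last exact: integrable_mul_bounded.
  rewrite EFin_Rintegral; last exact: integrable_mul_bounded.
  move=> -[] ->; rewrite opprK (rint_density (gamk k) D (gk k))//.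
  rewrite -RintegralB//; try exact: integrable_mul_bounded.
  by apply: eq_Rintegral => x _; rewrite mulrBl.
have -> : (\int[leb]_(x in D) (v x * phi x))%R =
    - (\int[leb]_(x in D) (u x * derive1 phi x))%R - rint gam phi.
  have := dDu phi tphi; rewrite EFin_Rintegral; last exact: integrable_mul_bounded.
  rewrite cint_rint// => -[] ->; rewrite opprK.
  rewrite (rint_diff_density Du gam D v)//; first exact: integrable_v.
  move=> A mA; rewrite HDu// Hgam//.
  have fin (f : R -> R) : leb.-integrable D (EFin \o f) ->
      (\int[leb]_(x in A `&` D) (f x)%:E)%E \is a fin_num.
    move=> fi; apply: integrable_fin_num; first exact: measurableI.
    by apply: (integrableS mD _ _ fi); [exact: measurableI|exact: subIsetr].
  have -> : (\int[leb]_(x in A `&` D) (v x)%:E = \int[leb]_(x in A `&` D) (u' x)%:E -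
     \int[leb]_(x in A `&` D) (g x)%:E)%E.
    under eq_integral do rewrite EFinB.
    apply: integralB; first exact: measurableI.
      by apply: (integrableS mD _ _ iu'); [exact: measurableI|exact: subIsetr].
    by apply: (integrableS mD _ _ ig); [exact: measurableI|exact: subIsetr].
  have f1 : Dsu A \is a fin_num by exact: fin_num_measure.
  move: (fin _ iu') (fin _ ig) f1; rewrite -/D.
  move: (\int[leb]_(x in A `&` D) (u' x)%:E)%E (\int[leb]_(x in A `&` D) (g x)%:E)%E (Dsu A).
  by move=> [x| |] [y| |] [z| |]//= _ _ _; rewrite -!EFinD; congr (_%:E); ring.
under eq_fun do rewrite E.
by apply: cvgB; [apply: cvgN; exact: cvg_uk_dphi|exact: cvg_rint_gamk].
Qed.

(** The variation of an open interval is a supremum over test functions, and each of these passes to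
    the limit under flat convergence; one that is nearly optimal for [gam] decides. *)
Lemma mass_lsc h x (s : R) : 0 < h -> a <= x - h -> x + h <= b -> s < mass (cvar gam) h x ->
  \forall k \near \oo, s <= mass (cvar (gamk k)) h x.
Proof.
move=> h0 ax xb sm; pose eta := (mass (cvar gam) h x - s) / 2.
have eta0 : 0 < eta by rewrite divr_gt0// subr_gt0.
have cd : x - h < x + h by lra.
have [psi [tpsi psi1 hpsi]] := cvar_itv_approx gam (x - h) (x + h) eta cd eta0.
have tpsi' := test_fun_sub _ _ _ _ _ ax xb tpsi.
have cv := cvg_rint_gamk _ tpsi'.
have sr : s < rint gam psi.
  apply: lt_le_trans hpsi; rewrite -/(win h x) -/(mass (cvar gam) h x) /eta.
  by move: (mass _ h x) sm => z sz; lra.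
near=> k; have sk : s < rint (gamk k) psi by near: k; exact: cvgr_gt cv _ sr.
apply: le_trans (ltW sk) _.
apply: rint_le_cvar => //; first exact: measurable_win.
- by apply: C1_fun_measurable; exact: test_fun_C1 tpsi.
- move=> y ny; have [M _ [_ _ _]] := test_fun_bounds _ _ _ cd tpsi; apply => h1; apply: ny.
  by rewrite /win/= in_itv.
Unshelve. all: by end_near. Qed.

(** A form of Fatou's lemma: capped by the limiting integrand, the truncated masses converge
    pointwise, and the constant 2 dominates them. *)
Lemma integral_min_mass_lsc h (j : R) : 0 < h ->
  (j%:E < \int[leb]_(x in `](a + 2 * h)%R, (b - 2 * h)%R[) (Num.min (mass (cvar gam) h x) 2)%:E)%E ->
  \forall k \near \oo, (j%:E <=
    \int[leb]_(x in `](a + 2 * h)%R, (b - 2 * h)%R[) (Num.min (mass (cvar (gamk k)) h x) 2)%:E)%E.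
Proof.
move=> h0 hj; set X : set (RT R) := `](a + 2 * h), (b - 2 * h)[%classic.
have mX : measurable X by exact: measurable_itv.
pose L x : R := Num.min (mass (cvar gam) h x) 2.
pose w k x : R := Num.min (Num.min (mass (cvar (gamk k)) h x) 2) (L x).
have mm (nu : chargeR R) : measurable_fun X ((fun x => Num.min (mass (cvar nu) h x) 2) : RT R -> R).
  by apply/measurable_EFinP; exact: measurable_min_mass.
have mw k : measurable_fun X (w k : RT R -> R) by apply: measurable_minr; exact: mm.
have w0 k x : 0 <= w k x by rewrite le_min !min_mass_ge0.
have w2 k x : w k x <= 2 by rewrite ge_min ge_min lexx orbT.
have cvw x : X x -> w k x @[k --> \oo] --> L x.
  rewrite /X/= in_itv/= => /andP[xa xb].
  apply/cvgrPdist_le => eta eta0.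
  have lt1 : L x - eta < mass (cvar gam) h x.
    by rewrite ltrBlDr (@le_lt_trans _ _ (mass (cvar gam) h x))// ?ltrDl// ge_min lexx.
  have nk : \forall k \near \oo, L x - eta <= mass (cvar (gamk k)) h x.
    apply: mass_lsc => //.
      by rewrite lerBrDr (le_trans _ (ltW xa))// lerD2l mulr_natl mulr2n lerDl ltW.
    by rewrite -lerBrDr (le_trans (ltW xb))// lerD2l lerN2 mulr_natl mulr2n lerDl ltW.
  near=> k; have hk : L x - eta <= mass (cvar (gamk k)) h x by near: k.
  have wL : w k x <= L x by rewrite ge_min lexx orbT.
  have L3 : L x - eta <= L x by rewrite lerBlDr lerDl ltW.
  have L2' : L x - eta <= 2 by apply: le_trans L3 _; rewrite /L ge_min lexx orbT.
  have Lw : L x - eta <= w k x by rewrite /w le_min le_min hk L2' L3.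
  by rewrite ger0_norm ?subr_ge0// lerBlDr addrC -lerBlDr.
have : (\int[leb]_(x in X) (w k x)%:E)%E @[k --> \oo] --> (\int[leb]_(x in X) (L x)%:E)%E.
  apply: (@dominated_cvg _ _ _ _ X mX _ _ (cst 2%:E)) => //.
  - by move=> k; exact/measurable_EFinP.
  - by move=> x Xx; apply: cvg_EFin; [exact: nearW|exact: cvw].
  - have := integrable_bounded leb X mX (leb_itv_lty _ _) (cst 2) 2 (measurable_cst _).
    by apply=> x _; rewrite ger0_norm.
  - by move=> k x _; rewrite lee_fin ger0_norm.
move=> /cvge_near_gt /(_ hj); apply: filterS => k hk; apply: le_trans (ltW hk) _.
apply: ge0_le_integral => //.
- by move=> x _; rewrite lee_fin.
- exact/measurable_EFinP.
- exact: measurable_min_mass.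
- by move=> x _; rewrite lee_fin ge_min lexx.
Unshelve. all: by end_near. Qed.

Lemma integrable_sq_bounded phi : @bounded_measurable _ (RT R) R phi ->
  leb.-integrable D (EFin \o (fun x => phi x ^+ 2)).
Proof.
move=> [mp [M hM]]; apply: (integrable_bounded leb D mD (leb_itv_lty _ _) _ (M ^+ 2)).
  by apply: measurable_funX; exact: measurable_funTS.
by move=> x _; rewrite normrX lerXn2r ?nnegrE// (le_trans _ (hM x)).
Qed.

(** The defect in |f|^2 >= 2 f phi - phi^2 in exact form: its sign is used along the sequence, its
    smallness for a good phi in the limit. *)
Lemma Rintegral_sq_sub (f phi : R -> R) : leb.-integrable D (EFin \o f) ->
  leb.-integrable D (EFin \o (fun x => f x ^+ 2)) -> @bounded_measurable _ (RT R) R phi ->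
  (\int[leb]_(x in D) (f x - phi x) ^+ 2)%R = (\int[leb]_(x in D) f x ^+ 2)%R -
    (2 * (\int[leb]_(x in D) (f x * phi x))%R - (\int[leb]_(x in D) phi x ^+ 2)%R).
Proof.
move=> fi f2 bp; have p2 := integrable_sq_bounded _ bp; have fp := integrable_mul_bounded _ _ fi bp.
have fp2 : leb.-integrable D (EFin \o (fun x => 2 * (f x * phi x))).
  by have := integrableZl mD 2 fp; apply: eq_integrable.
rewrite -RintegralZl// -RintegralB// -RintegralB//.
  by apply: eq_Rintegral => x _; ring.
by have := integrableB mD fp2 p2; apply: eq_integrable.
Qed.

(** With phi and h fixed, the linearised quadratic term converges and the nonlocal term is lower
    semicontinuous, so the bound t survives for their sum. *)
Lemma energy_step phi h : test_fun a b phi -> 0 < h ->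
  ((2 * (\int[leb]_(x in D) (v x * phi x))%R - (\int[leb]_(x in D) phi x ^+ 2)%R)%:E +
   c0%:E * \int[cvar gam]_(y in `](a + 3 * h)%R, (b - 3 * h)%R[) (tau (cvar gam) (2 * h) y)%:E <= t%:E)%E.
Proof.
move=> tphi h0; have bp := test_fun_bounded_measurable _ _ _ ab tphi.
set q := (\int[leb]_(x in D) phi x ^+ 2)%R.
set X := `](a + 2 * h)%R, (b - 2 * h)%R[; set Y := `](a + 3 * h)%R, (b - 3 * h)%R[.
pose J k := (\int[leb]_(x in [set` X]) (Num.min (mass (cvar (gamk k)) h x) 2)%:E)%E.
have step k : e k < h -> ((2 * (\int[leb]_(x in D) (vk k x * phi x))%R - q)%:E +
    (c0 / (2 * (h + e k)))%:E * J k <= t%:E)%E.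
  move=> eh; apply: le_trans (bound k); rewrite /Eeps_val; apply: leeD.
    have [_ _ _ _ iv2] := admk k.
    rewrite (EFin_Rintegral (fun x => vk k x ^+ 2)) ?lee_fin//.
    have := Rintegral_sq_sub _ _ (integrable_vk k) iv2 bp; rewrite -/q => Esq.
    by rewrite -subr_ge0 -Esq; apply: Rintegral_ge0 => x _; rewrite sqr_ge0.
  apply: le_trans (second_term_ge a b c0 K (e k) (uk k) (gamk k) (uk' k) (gk k) ab c00 (e0 k) (admk k)).
  have := scale_comparison (cvar (gamk k)) a b (e k) h (e0 k) eh.
  (* This multiple of [scale_comparison] trades the prefactor c0/(2e), which blows up, for c0/(2(h +
     e)), which tends to c0/(2h). *)
  have p0 : 0 < c0 / (2 * e k) / (2 * (h + e k)) by rewrite !divr_gt0// mulr_gt0// addr_gt0.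
  move=> sc; have := lee_wpmul2l (_ : (0 <= (c0 / (2 * e k) / (2 * (h + e k)))%:E)%E) sc.
  rewrite lee_fin (ltW p0) => /(_ isT); rewrite !muleA -!EFinM.
  have he : h + e k != 0 by rewrite gt_eqF// addr_gt0.
  have -> : c0 / (2 * e k) / (2 * (h + e k)) * (2 * e k) = c0 / (2 * (h + e k)).
    by field; rewrite he gt_eqF.
  have -> // : c0 / (2 * e k) / (2 * (h + e k)) * (2 * (h + e k)) = c0 / (2 * e k).
  by rewrite mulfVK// mulf_neq0.
have tau_fin : (\int[cvar gam]_(y in [set` Y]) (tau (cvar gam) (2 * h) y)%:E)%E \is a fin_num.
  apply: integrable_fin_num; first exact: measurable_itv.
  apply: (integrable_bounded _ _ _ _ _ 1); first exact: measurable_itv.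
  - by apply: cvar_lty; exact: measurable_itv.
  - exact: measurable_tau.
  - by move=> y _; have /andP[? ?] := tau_itv (cvar gam) (2 * h) y; rewrite ger0_norm.
set Z := fine (\int[cvar gam]_(y in [set` Y]) (tau (cvar gam) (2 * h) y)%:E)%E.
have ZE : (\int[cvar gam]_(y in [set` Y]) (tau (cvar gam) (2 * h) y)%:E)%E = Z%:E by rewrite /Z fineK.
rewrite ZE -EFinM -EFinD lee_fin.
(* Lower semicontinuity is available for each number strictly below the limiting integral, so j
   approaches 2hZ only at the end. *)
have lim_step (j : R) : j < 2 * h * Z ->
    2 * (\int[leb]_(x in D) (v x * phi x))%R - q + c0 / (2 * h) * j <= t.
  move=> jZ.
  have hj : (j%:E < \int[leb]_(x in [set` X]) (Num.min (mass (cvar gam) h x) 2)%:E)%E.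
    apply: lt_le_trans (integral_tau_le (cvar gam) a b h h0).
    by rewrite ZE -EFinM lte_fin.
  have nJ := integral_min_mass_lsc _ _ h0 hj.
  have cv : 2 * (\int[leb]_(x in D) (vk k x * phi x))%R - q + c0 / (2 * (h + e k)) * j
      @[k --> \oo] --> 2 * (\int[leb]_(x in D) (v x * phi x))%R - q + c0 / (2 * h) * j.
    apply: cvgD.
      by apply: cvgB; [apply: cvgM; [exact: cvg_cst|exact: cvg_vk]|exact: cvg_cst].
    apply: cvgM; last exact: cvg_cst.
    apply: cvgM; first exact: cvg_cst.
    apply: cvgV; first by rewrite mulf_neq0// gt_eqF.
    apply: cvgM; first exact: cvg_cst.
    by rewrite -[X in _ --> X]addr0; apply: cvgD; [exact: cvg_cst|exact: ecv].
  rewrite -(cvg_lim (@Rhausdorff R) cv); apply: limr_le; first exact: cvgP cv.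
  near=> k; have eh : e k < h by near: k; exact: cvgr_lt ecv _ h0.
  have jJ : (j%:E <= J k)%E by near: k.
  rewrite -lee_fin; apply: le_trans (step k eh); rewrite EFinD; apply: leeD => //.
  rewrite EFinM; apply: lee_wpmul2l => //.
  by rewrite lee_fin divr_ge0 ?(ltW c00)// mulr_ge0// addr_ge0// ltW.
have Z2 : c0 * Z = c0 / (2 * h) * (2 * h * Z) by field; rewrite gt_eqF.
rewrite Z2 -lerBrDl; apply/ler_addgt0Pr => eta eta0.
have p0 : 0 < c0 / (2 * h) by rewrite divr_gt0// mulr_gt0.
(* This choice of j costs exactly eta after multiplication by c0/(2h). *)
have := lim_step (2 * h * Z - eta / (c0 / (2 * h))).
rewrite ltrBlDr ltrDl divr_gt0// => /(_ isT).
rewrite mulrBr (mulrC (c0 / (2 * h)) (eta / _)) mulfVK ?gt_eqF//.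
by move: (2 * _ - q) (c0 / (2 * h) * _) => x y; rewrite addrA lerBlDr -lerBrDl addrAC.
Unshelve. all: by end_near. Qed.

(** First h tends to 0 for a fixed test function, which replaces [tau] by [tau0]; then the test
    function approaches v in L2, which restores the square. *)
Lemma E_val_le_bound : (E_val a b c0 u u' Dsu g <= t%:E)%E.
Proof.
apply: le_trans (E_val_le a b c0 K u gam Du u' Dsu g ab c00 adm) _.
have [_ _ _ _ iv2] := adm.
have mv : measurable_fun D (v : RT R -> R) by have /measurable_int/measurable_EFinP := integrable_v.
rewrite (EFin_Rintegral (fun x => v x ^+ 2))//.
set V := (\int[leb]_(x in D) v x ^+ 2)%R.
set T := (\int[cvar gam]_(y in D) (tau0 (cvar gam) y)%:E)%E.
have c0E : (0 <= c0%:E)%E by rewrite lee_fin ltW.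
have T0 : (0 <= T)%E by apply: integral_ge0 => y _; rewrite lee_fin tau0_ge0.
have key phi : test_fun a b phi ->
    (T <= ((t - (2 * (\int[leb]_(x in D) (v x * phi x))%R - (\int[leb]_(x in D) phi x ^+ 2)%R)) / c0)%:E)%E.
  move=> tphi; apply: integral_tau0_le => h h0.
  have := energy_step _ _ tphi h0; set r := (2 * _ - _).
  have : (0 <= \int[cvar gam]_(y in `](a + 3 * h)%R, (b - 3 * h)%R[) (tau (cvar gam) (2 * h) y)%:E)%E.
    by apply: integral_ge0 => y _; rewrite lee_fin tau_ge0.
  case: (\int[cvar gam]_(y in `](a + 3 * h)%R, (b - 3 * h)%R[) (tau (cvar gam) (2 * h) y)%:E)%E => [z||]//= _.
    by rewrite -EFinM -EFinD !lee_fin ler_pdivlMr// => hz; rewrite lerBrDl mulrC.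
  by rewrite gt0_muley ?lte_fin// addey.
have L2 := L2_approx_sq_integrable leb a b (leb_itv_lty _ _) ab v mv iv2.
(* The zero test function already bounds T. *)
have Tfin : T \is a fin_num.
  by rewrite ge0_fin_numE// (le_lt_trans (key _ (test_fun0 a b ab)))// ltry.
rewrite -(fineK Tfin) -EFinM -EFinD lee_fin; apply/ler_addgt0Pr => eta eta0.
have [phi tphi hphi] := L2 eta eta0.
have bp := test_fun_bounded_measurable _ _ _ ab tphi.
have := key _ tphi; rewrite -(fineK Tfin) lee_fin ler_pdivlMr//.
have i2 : leb.-integrable D (EFin \o (fun x => (v x - phi x) ^+ 2)).
  have i1 := integrable_mul_bounded _ _ integrable_v bp; have i3 := integrable_sq_bounded _ bp.
  have := integrableD mD (integrableB mD iv2 (integrableZl mD 2 i1)) i3.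
  apply: eq_integrable => // x _; rewrite /= -?EFinM -?EFinB -?EFinD; congr (_%:E).
  by rewrite /v; ring.
have := Rintegral_sq_sub _ _ integrable_v iv2 bp; rewrite -/V.
have : (\int[leb]_(x in D) (v x - phi x) ^+ 2)%R <= eta by rewrite -lee_fin -EFin_Rintegral.
move: (\int[leb]_(x in D) (v x - phi x) ^+ 2)%R (2 * _ - _) (fine T) => x y z.
rewrite /= (mulrC z) => h1 h2 h3.
have -> : V = x + y by rewrite h2 subrK.
by rewrite -addrA addrC lerD// addrC -lerBrDr.
Qed.

End sequence.


(** * From the relaxed energy to a sequence *)

Theorem mainTheorem11 (R : realType) (a b c0 K : R)
  (hab : a < b) (hc0 : 0 < c0) (hK : 0 < K)
  (u : R -> R) (gam : chargeR R)
  (Du : chargeR R) (u' : R -> R) (Dsu : chargeR R) (g : R -> R) :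
  E_adm a b K u gam Du u' Dsu g ->
  (Efun a b c0 K u gam <= Eprime a b c0 K u gam)%E.
Proof.
move=> adm; apply: le_ereal_inf_tmp => _ [[ue ge] /= [_ [_ L1] flat] <-].
(* The given data compete in the infimum that defines [Efun], so it is enough to bound their
   value. *)
apply: (@le_trans _ _ (E_val a b c0 u u' Dsu g)).
  by apply: ereal_inf_lbound; exists ((Du, u'), (Dsu, g)).
set F := fun e : R => _.
suff main (t : R) : (liminf0 F < t%:E)%E -> (E_val a b c0 u u' Dsu g <= t%:E)%E.
  case: (liminf0 F) main => [r||] main; last 2 first.
  - by rewrite leey.
  (* If the liminf were -oo, [main] would put the value below every real number, in particular below
     [r - 1]. *)
  - case: (E_val _ _ _ _ _ _ _) main => [r||]// main; last by have := main 0 (ltNyr _).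
    by have := main (r - 1) (ltNyr _); rewrite lee_fin lerBrDl gerDr ler10.
  by apply/lee_addgt0Pr => eta eta0; rewrite -EFinD; apply: main; rewrite lte_fin ltrDl.
move=> Ft.
(* The strict inequality passes through both infima: the one over small e yields a scale below
   1/(k+1), and the one defining [Eeps] yields an admissible pair there. *)
have ex k : exists p : R * ((R -> R) * (R -> R)), [/\ 0 < p.1, p.1 < k.+1%:R^-1,
    Eeps_adm a b K (ue p.1) (ge p.1) p.2.1 p.2.2 &
    (Eeps_val a b c0 p.1 p.2.1 p.2.2 <= t%:E)%E].
  have : (ereal_inf [set F e | e in `]0%R, (k.+1%:R^-1)%R[] < t%:E)%E.
    apply: le_lt_trans Ft; apply: ereal_sup_ubound; exists k.+1%:R^-1 => //.
    by rewrite /= in_itv/= andbT.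
  move=> /ereal_inf_lt[_ [e /= e_in <-]].
  have /andP[e0 ek] : 0 < e < k.+1%:R^-1 by move: e_in; rewrite in_itv.
  move=> /ereal_inf_lt[_ [[u1 g1] /= ad <-] lt1].
  by exists (e, (u1, g1)); split=> //=; exact: ltW.
have [f hf] := choice ex.
have e0 k : 0 < (f k).1 by have [] := hf k.
have ecv : (f k).1 @[k --> \oo] --> 0.
  apply: (@squeeze_cvgr _ _ _ _ (cst 0) (fun k => k.+1%:R^-1)); last 2 first.
  - exact: cvg_cst.
  - exact: cvg_harmonic.
  by apply: nearW => k; have [h1 h2 _ _] := hf k; rewrite (ltW h1) (ltW h2).
have ecv' := cvg_nat_at_right0 _ e0 ecv.
apply: (@E_val_le_bound R a b c0 K t u gam Du u' Dsu g hab hc0 adm (fun k => (f k).1)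
  (fun k => ue (f k).1) (fun k => ge (f k).1) (fun k => (f k).2.1) (fun k => (f k).2.2)) => //.
- by move=> k; have [] := hf k.
- exact: (cvg_comp _ _ ecv' L1).
- exact: (cvg_comp _ _ ecv' flat).
- by move=> k; have [] := hf k.
Qed.
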